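(* Let $T$ and $L$ be positive numbers. Then there exist a smooth positive function $\psi$ on $[-L,L]$ (depending on $L$) and positive constants $s_0=s_0(L,T)$ and $C=C(L,T)$ such that, for all $s\ge s_0$ and any $$q\in L^2(0,T;H^3(-L,L))\cap H^1(0,T;L^2(-L,L))$$ satisfying $q(t,\pm L)=q_x(t,\pm L)=q_{xx}(t,\pm L)=0$ for $0\le t\le T$, we have $$\int_0^T\!\!\int_{-L}^L\left\{\frac{s^5}{t^5(T-t)^5}|q|^2+\frac{s^3}{t^3(T-t)^3}|q_x|^2+\frac{s}{t(T-t)}|q_{xx}|^2\right\}e^{-\frac{2s\psi(x)}{t(T-t)}}\,dx\,dt\le C\int_0^T\!\!\int_{-L}^L|q_t-q_{xx}+q_{xxx}|^2e^{-\frac{2s\psi(x)}{t(T-t)}}\,dx\,dt.$$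
   Context: Functions are real-valued; $q=q(t,x)$ with $t\in(0,T)$, $x\in(-L,L)$, and the boundary conditions are understood in the sense of traces. *)

(* Defs.v *)
(* MathComp-Analysis, over an arbitrary [R : realType]. *)
From HB Require Import structures.
From mathcomp Require Import all_boot all_order all_algebra.
From mathcomp Require Import all_classical all_reals all_analysis.

Set Implicit Arguments.
Unset Strict Implicit.
Unset Printing Implicit Defensive.

Import Order.TTheory GRing.Theory Num.Theory.
Import numFieldNormedType.Exports.

Local Open Scope classical_set_scope.
Local Open Scope ring_scope.

Definition smooth (R : realType) (f : R -> R) : Prop :=
  forall (n : nat) (x : R), derivable (derive1n n f) x 1.

(* C_c^oo(]a, b[), each function being extended by 0 to the whole line. *)
Definition test_function (R : realType) (a b : R) (phi : R -> R) : Prop :=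
  let supp := closure [set x | phi x != 0] in
  [/\ smooth phi, compact supp & supp `<=` `]a, b[].

Definition in_L2 (R : realType) (a b : R) (u : R -> R) : Prop :=
  measurable_fun `]a, b[ u /\
  (\int[lebesgue_measure]_(x in `]a, b[) (`|u x| ^+ 2)%:E < +oo)%E.

(* [v] is the weak derivative of order [k] of [u] on ]a, b[. *)
Definition weak_derive (R : realType) (a b : R) (k : nat) (u v : R -> R) :
    Prop :=
  forall phi : R -> R, test_function a b phi ->
    \int[lebesgue_measure]_(x in `]a, b[) (u x * derive1n k phi x) =
    (-1) ^+ k * \int[lebesgue_measure]_(x in `]a, b[) (v x * phi x).

(* [u] is in H^3(a, b), with weak derivatives [u1], [u2], [u3]. *)
Definition in_H3 (R : realType) (a b : R) (u u1 u2 u3 : R -> R) : Prop :=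
  [/\ in_L2 a b u, in_L2 a b u1, in_L2 a b u2 & in_L2 a b u3] /\
  [/\ weak_derive a b 1 u u1, weak_derive a b 2 u u2
    & weak_derive a b 3 u u3].

(* The trace at the endpoint [c] ([c = a] or [c = b]) of a function [u] of
   H^1(a, b) is the value at [c] of its representative that is continuous on
   the closed interval. *)
Definition has_trace (R : realType) (a b : R) (u : R -> R) (c v : R) : Prop :=
  exists w : R -> R,
    [/\ {within `[a, b], continuous w},
        {ae lebesgue_measure, forall x, x \in `]a, b[ -> w x = u x}
      & w c = v].

(* L^2(0, T; L^2(-L, L)): the elements are represented by functions
   that are jointly Borel measurable in (t, x). *)
Definition in_L2L2 (R : realType) (T L : R) (q : R -> R -> R) : Prop :=
  @measurable_fun _ _ (measurableTypeR R * measurableTypeR R)%type R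
    (`]0, T[ `*` `]- L, L[) (fun z => q z.1 z.2) /\
  (\int[lebesgue_measure]_(t in `]0%R, T[)
     \int[lebesgue_measure]_(x in `](- L)%R, L[) (`|q t x| ^+ 2)%:E < +oo)%E.

(* [q] is in L^2(0, T; H^3(-L, L)), with space derivatives [qx], [qxx],
   [qxxx]. Since the squared H^3 norm is the sum of the squared L^2 norms of
   the derivatives, square integrability in time is required of each of them. *)
Definition in_L2H3 (R : realType) (T L : R) (q qx qxx qxxx : R -> R -> R) :
    Prop :=
  [/\ in_L2L2 T L q, in_L2L2 T L qx, in_L2L2 T L qxx & in_L2L2 T L qxxx] /\
  {ae lebesgue_measure, forall t : R, t \in `]0, T[ ->
     in_H3 (- L) L (q t) (qx t) (qxx t) (qxxx t)}.

(* [q] is in H^1(0, T; L^2(-L, L)), with time derivative [qt]. The weak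
   derivative is that of an L^2(-L, L)-valued function: the two time integrals
   are Bochner integrals in L^2(-L, L), whose values at almost every [x] are
   the Lebesgue integrals below, and equality in L^2(-L, L) is equality for
   almost every [x]. *)
Definition in_H1L2 (R : realType) (T L : R) (q qt : R -> R -> R) : Prop :=
  [/\ in_L2L2 T L q, in_L2L2 T L qt
    & forall phi : R -> R, test_function 0 T phi ->
      {ae lebesgue_measure, forall x : R, x \in `]- L, L[ ->
        \int[lebesgue_measure]_(t in `]0, T[) (derive1n 1 phi t * q t x) =
        - \int[lebesgue_measure]_(t in `]0, T[) (phi t * qt t x)}].

(* The trace of [q] in L^2(0, T) vanishes at both endpoints of ]-L, L[. An
   element of L^2(0, T; H^3(-L, L)) has its second space derivative at [x = L]
   and [x = -L] defined for almost every [t] only. *)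
Definition zero_boundary_trace (R : realType) (T L : R) (q : R -> R -> R) :
    Prop :=
  {ae lebesgue_measure, forall t : R, t \in `]0, T[ ->
     has_trace (- L) L (q t) (- L) 0 /\ has_trace (- L) L (q t) L 0}.

Definition carleman_weight (R : realType) (T s : R) (psi : R -> R) (t x : R) :
    R :=
  expR (- (2 * s * psi x / (t * (T - t)))).

(* Main.v *)
(* The proof conjugates the equation with the weight: w = exp(-s psi xi) q, with
   xi = 1/(t(T-t)) and psi concave, psi' > 0 on [-L, L].  The conjugated operator is
   w_t + K w + S w up to lower order, K = d^3 + 3 A^2 d + 3 A A' skew-symmetric and
   S = 3 d A d + A^3 symmetric, A = s xi psi'.  Since every boundary term vanishes,
   2 <K w, S w> is the integral of
   -9 A' (w_xx^2 + 2 A^2 w_x^2 + A^4 w^2) + 3 A'^3 w^2, which is coercive because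
   psi'' < 0, and 2 <w_t, S w> only produces terms with A_t, which are absorbed for
   large s like the remaining lower order terms; then 2 <w_t + K w, S w> is at most
   the squared norm of w_t + K w + S w.

   The regularity assumptions justify the integrations by parts.  In space, for
   almost every t, w and its derivatives are primitives of integrable functions with
   zero traces (du Bois-Reymond).  In time w_x has no derivative, but for
   g = (psi' w_x)_x the form <w(t'), g(t)> is symmetric in t and t', so that
   int <(w(t+h) - w(t-h)) / 2h, g(t)> dt = 0 for every h, and the difference quotient
   is an average of w_t over ]t-h, t+h[. *)
Require Import Defs.
From HB Require Import structures.
From mathcomp Require Import all_boot all_order all_algebra.
From mathcomp Require Import all_classical all_reals all_analysis.
From mathcomp Require Import measurable_realfun ring lra.

Set Implicit Arguments.
Unset Strict Implicit.
Unset Printing Implicit Defensive.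

Import Order.TTheory GRing.Theory Num.Theory.
Import numFieldNormedType.Exports.

Local Open Scope classical_set_scope.
Local Open Scope ring_scope.

(** * Real-valued integrals and square-integrable functions *)

(** The weight function is a parabola centred at 2 L, outside [-L, L]: there psi' runs over
    [2 L, 6 L], psi over [L^2, 9 L^2], and psi'' = -2. Since t (T - t) <= T^2 / 4, xi is at least 4
    / T^2, so s >= s0 makes s xi large uniformly in t and every absorption can be done pointwise:
    the estimate reduces to lhs <= C (2 rhs - N), where N is a sum of expressions with vanishing
    integrals. All integrations by parts are confined to N. Three obstacles shape the rest. xi blows
    up at t = 0 and t = T, but psi >= L^2 makes the weight decay like exp(-s L^2 xi), which beats
    every power of xi; this gives the integrability of each term and the vanishing of w at the end
    times, where q itself need not vanish. The weak time derivative holds for almost every x with an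
    exceptional set that depends on the test function, hence a du Bois-Reymond lemma with a
    countable family of test functions. Domains are handled by extending functions by 0, so that the
    absence of boundary terms becomes the vanishing of a primitive at the right endpoint. *)

Section RealIntegral.
Context {d} {T : measurableType d} {R : realType}.
Variable m : {measure set T -> \bar R}.
Implicit Types f g : T -> R.

(** Every integral is over the whole space: functions on an interval or a rectangle are first
    extended by 0. [Int] takes the default value 0 when the integral is not finite, so integrability
    travels along as the separate predicate [itg]. *)
Definition itg f := m.-integrable setT (EFin \o f).
Definition Int f : R := \int[m]_x f x.
Definition L2 f := measurable_fun setT f /\ itg (fun x => f x ^+ 2).

Lemma aeS (P Q : T -> Prop) : (forall x, P x -> Q x) ->
  {ae m, forall x, P x} -> {ae m, forall x, Q x}.
Proof. by move=> PQ; apply: (@filterS _ _ (ae_filter_ringOfSetsType m)). Qed.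

Lemma aeS2 (P P' Q : T -> Prop) : (forall x, P x -> P' x -> Q x) ->
  {ae m, forall x, P x} -> {ae m, forall x, P' x} -> {ae m, forall x, Q x}.
Proof. by move=> PQ; apply: (@filterS2 _ _ (ae_filter_ringOfSetsType m)). Qed.

Lemma itg_measurable f : itg f -> measurable_fun setT f.
Proof. by move=> /measurable_int/measurable_EFinP. Qed.

Lemma itg_ext f g : f =1 g -> itg f -> itg g.
Proof. by move=> /funext ->. Qed.

Lemma itg0 : itg (fun=> 0).
Proof. exact: integrable0. Qed.

Lemma itgD f g : itg f -> itg g -> itg (fun x => f x + g x).
Proof. by move=> If Ig; exact: (integrableD measurableT If Ig). Qed.

Lemma itgZ k f : itg f -> itg (fun x => k * f x).
Proof. by move=> If; exact: (integrableZl measurableT k If). Qed.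

Lemma itgN f : itg f -> itg (fun x => - f x).
Proof. by move/(itgZ (-1)); apply: itg_ext => x; rewrite mulN1r. Qed.

Lemma itgB f g : itg f -> itg g -> itg (fun x => f x - g x).
Proof. by move=> If /itgN; exact: itgD. Qed.

Lemma itg_le f g : measurable_fun setT f -> itg g ->
  (forall x, `|f x| <= g x) -> itg f.
Proof.
move=> mf Ig fg; apply: (le_integrable measurableT _ _ Ig).
  exact/measurable_EFinP.
by move=> x _ /=; rewrite lee_fin (le_trans (fg x))// ler_norm.
Qed.

Lemma itg_abs f : itg f -> itg (fun x => `|f x|).
Proof. exact: integrable_norm. Qed.

Lemma itg_bddM (b f : T -> R) (C : R) : measurable_fun setT b -> itg f ->
  (forall x, `|b x| <= C) -> itg (fun x => b x * f x).
Proof.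
move=> mb If bC; apply: (@itg_le _ (fun x => C * `|f x|)).
- by apply: measurable_funM => //; exact: itg_measurable.
- exact/itgZ/itg_abs.
- by move=> x; rewrite normrM ler_wpM2r.
Qed.

Lemma IntD f g : itg f -> itg g -> Int (fun x => f x + g x) = Int f + Int g.
Proof. by move=> If Ig; exact: RintegralD. Qed.

Lemma IntZ k f : itg f -> Int (fun x => k * f x) = k * Int f.
Proof. by move=> If; exact: RintegralZl. Qed.

Lemma IntN f : itg f -> Int (fun x => - f x) = - Int f.
Proof.
move=> If; rewrite -mulN1r -IntZ//.
by apply: eq_Rintegral => x _; rewrite mulN1r.
Qed.

Lemma IntB f g : itg f -> itg g -> Int (fun x => f x - g x) = Int f - Int g.
Proof. by move=> If Ig; rewrite IntD ?IntN//; exact: itgN. Qed.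

Lemma Int_ext f g : f =1 g -> Int f = Int g.
Proof. by move=> /funext ->. Qed.

Lemma Int0 : Int (fun=> 0) = 0.
Proof. by rewrite /Int /Rintegral integral0. Qed.

Lemma EFin_Int f : itg f -> (Int f)%:E = (\int[m]_x (f x)%:E)%E.
Proof. by move=> If; rewrite /Int /Rintegral fineK//; exact: integrable_fin_num. Qed.

Lemma Int_le f g : itg f -> itg g -> (forall x, f x <= g x) -> Int f <= Int g.
Proof. by move=> If Ig fg; apply: le_Rintegral. Qed.

Lemma Int_abs_le f g : itg f -> itg g -> (forall x, `|f x| <= g x) ->
  `|Int f| <= Int g.
Proof.
move=> If Ig fg; rewrite ler_norml; apply/andP; split.
  rewrite -IntN//; apply: Int_le => //; first exact: itgN.
  by move=> x; rewrite lerNl (le_trans _ (fg x))// -normrN ler_norm.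
by apply: Int_le => // x; rewrite (le_trans _ (fg x))// ler_norm.
Qed.

Lemma Int_ae f g : itg f -> measurable_fun setT g -> {ae m, forall x, f x = g x} ->
  itg g /\ Int f = Int g.
Proof.
move=> If mg fg; have mf := itg_measurable If.
have fgE : ae_eq m setT (EFin \o f) (EFin \o g).
  by apply: filterS fg => x /= -> _.
split.
  apply/integrableP; split; first exact/measurable_EFinP.
  have -> : (\int[m]_x `|(EFin \o g) x| = \int[m]_x `|(EFin \o f) x|)%E.
    apply: ae_eq_integral => //.
    - by apply: measurableT_comp => //; exact/measurable_EFinP.
    - by apply: measurableT_comp => //; exact/measurable_EFinP.
    - by apply: filterS fgE => x /= h Dx; case: (h Dx) => ->.
  by case/integrableP : If.
by congr fine; apply: ae_eq_integral => //; exact/measurable_EFinP.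
Qed.

Lemma Int_cvg (f_ : nat -> T -> R) f g :
  (forall n, measurable_fun setT (f_ n)) -> measurable_fun setT f ->
  {ae m, forall x, f_ ^~ x @ \oo --> f x} -> itg g ->
  (forall n, {ae m, forall x, `|f_ n x| <= g x}) ->
  (fun n => Int (f_ n)) @ \oo --> Int f.
Proof.
move=> mf_ mf fcvg Ig fg.
have mE (h : T -> R) : measurable_fun setT h -> measurable_fun setT (EFin \o h).
  by move=> mh; apply/measurable_EFinP; exact: mh.
have c1 : {ae m, forall x, setT x -> (fun n => (EFin \o f_ n) x) @ \oo --> (EFin \o f) x}.
  apply: filterS fcvg => x h _; apply/fine_cvgP; split; last exact: h.
  exact: nearW.
have c2 : {ae m, forall x n, setT x -> (`|(EFin \o f_ n) x| <= (EFin \o g) x)%E}.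
  by apply: filterS (ae_foralln fg) => x h n _; rewrite /= lee_fin.
have [If _ cv] := dominated_convergence measurableT (fun n => mE _ (mf_ n)) (mE _ mf)
  c1 Ig c2.
rewrite -(EFin_Int If) in cv.
exact: (fine_cvg cv).
Qed.

Lemma L2_le C f g : measurable_fun setT g -> L2 f ->
  (forall x, `|g x| <= C * `|f x|) -> L2 g.
Proof.
move=> mg [mf If] gf; split=> //.
apply: (itg_le _ (itgZ (C ^+ 2) If)); first exact: measurable_funX.
move=> x; rewrite normrX -(real_normK (num_real (f x))) -exprMn.
by rewrite ler_sqr ?nnegrE// (le_trans _ (gf x)).
Qed.

Lemma L2M f g : L2 f -> L2 g -> itg (fun x => f x * g x).
Proof.
move=> [mf If] [mg Ig]; apply: (itg_le _ (itgD If Ig)).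
  exact: measurable_funM.
move=> x; rewrite normrM -(real_normK (num_real (f x))) -(real_normK (num_real (g x))).
by have := sqr_ge0 (`|f x| - `|g x|); have := sqr_ge0 (`|f x|);
  have := sqr_ge0 (`|g x|); nra.
Qed.

Lemma L2D f g : L2 f -> L2 g -> L2 (fun x => f x + g x).
Proof.
move=> Lf Lg; have Ifg := L2M Lf Lg; case: Lf Lg => mf If [mg Ig].
split; first exact: measurable_funD.
apply: itg_ext (itgD (itgD If (itgZ 2 Ifg)) Ig) => x; ring.
Qed.

Lemma L2_ext f g : f =1 g -> L2 f -> L2 g.
Proof. by move=> /funext ->. Qed.

(** Multiplying by the indicator of [A], which is square integrable because [A] has finite measure,
    leaves f unchanged. *)
Lemma L2_itg f (A : set T) : measurable A -> (m A < +oo)%E -> L2 f ->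
  (forall x, ~ A x -> f x = 0) -> itg f.
Proof.
move=> mA Afin Lf fA; have L1A : L2 (\1_A : T -> R).
  split; first exact: measurable_indic.
  apply: (@itg_ext (\1_A)); last first.
    apply/integrableP; split; first exact/measurable_EFinP/measurable_indic.
    under eq_integral do rewrite /= ger0_norm//.
    by rewrite integral_indic// setIT.
  move=> x /=.
  by rewrite indicE; case: (x \in A); rewrite ?expr1n ?expr0n.
apply: itg_ext (L2M L1A Lf) => x; rewrite indicE.
by case: (boolP (x \in A)) => [_|/negP xA]; rewrite ?mul1r// mul0r fA// => Ax;
  apply: xA; rewrite inE.
Qed.

Lemma L2_finite f : measurable_fun setT f ->
  (\int[m]_x (`|f x| ^+ 2)%:E < +oo)%E -> L2 f.
Proof.
move=> mf foo; split=> //; apply/integrableP; split.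
  by apply/measurable_EFinP; exact: measurable_funX.
by under eq_integral do rewrite /= normrX.
Qed.

End RealIntegral.

(** * Iterated integrals of real-valued functions on a product *)

Section Fubini.
Context {d1 d2} {T1 : measurableType d1} {T2 : measurableType d2} {R : realType}.
Variable m1 : {sigma_finite_measure set T1 -> \bar R}.
Variable m2 : {sigma_finite_measure set T2 -> \bar R}.
Implicit Type f : T1 * T2 -> R.

(** An inner integral in Fubini's theorem may be infinite on a null set; [fine] turns it into a
    real-valued function with the same integral. *)
Lemma itg_fine {d} {T : measurableType d} (m : {measure set T -> \bar R})
    (F : T -> \bar R) : m.-integrable setT F ->
  itg m (fun x => fine (F x)) /\
  Int m (fun x => fine (F x)) = fine (\int[m]_x F x)%E.
Proof.
move=> IF; have mF := measurable_int _ IF.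
have mfF : measurable_fun setT (EFin \o (fun x => fine (F x))).
  by apply/measurable_EFinP; exact: measurableT_comp.
split.
  apply: (le_integrable measurableT mfF _ IF) => x _ /=.
  by case: (F x) => [r||] //=; rewrite normr0 leey.
congr fine; apply: ae_eq_integral => //.
by apply: filterS (integrable_ae measurableT IF) => x h _; rewrite /= fineK// h.
Qed.

Lemma itg_pair_snd f : itg (m1 \x m2)%E f ->
  {ae m2, forall y, itg m1 (fun x => f (x, y))}.
Proof. by move=> /ae_integrable2. Qed.

Lemma Int_pair_fst f : itg (m1 \x m2)%E f ->
  itg m1 (fun x => Int m2 (fun y => f (x, y))) /\
  Int m1 (fun x => Int m2 (fun y => f (x, y))) = Int (m1 \x m2)%E f.
Proof.
move=> If; have [I1 E1] := itg_fine (integrable_fubini_F If); split => //.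
by rewrite [LHS]E1 integral12_prod_meas1.
Qed.

Lemma itg_swap f : itg (m1 \x m2)%E f ->
  itg (m2 \x m1)%E (fun z => f (z.2, z.1)).
Proof.
move=> If; have /measurable_EFinP mf := measurable_int _ If.
have ms : measurable_fun setT (EFin \o (fun z : T2 * T1 => f (z.2, z.1))).
  apply/measurable_EFinP; apply: (measurableT_comp mf).
  by apply/measurable_fun_pairP; split; [exact: measurable_snd|exact: measurable_fst].
apply/(integrable12ltyP m2 m1 ms).
exact/(integrable21ltyP m1 m2 (measurable_int _ If)).
Qed.

Lemma Int_pair_snd f : itg (m1 \x m2)%E f ->
  itg m2 (fun y => Int m1 (fun x => f (x, y))) /\
  Int m2 (fun y => Int m1 (fun x => f (x, y))) = Int (m1 \x m2)%E f.
Proof.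
move=> If; have [I1 E1] := itg_fine (integrable_fubini_F (itg_swap If)); split => //.
rewrite [LHS]E1 /Int /Rintegral; congr fine.
exact: (integral21_prod_meas1 If).
Qed.

Lemma itg_tensor (f : T1 -> R) (g : T2 -> R) : itg m1 f -> itg m2 g ->
  itg (m1 \x m2)%E (fun z => f z.1 * g z.2).
Proof.
move=> If Ig; apply/integrable12ltyP.
  apply/measurable_EFinP; apply: measurable_funM.
    by apply: (measurableT_comp (itg_measurable If)); exact: measurable_fst.
  by apply: (measurableT_comp (itg_measurable Ig)); exact: measurable_snd.
rewrite (@eq_integral _ _ _ _ _ (fun x => `|f x|%:E * (Int m2 (fun y => `|g y|))%:E)%E).
  have := itgZ (Int m2 (fun y => `|g y|)) (itg_abs If).
  move=> /integrable_lty -/(_ measurableT) /=.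
  by under eq_integral do rewrite mulrC EFinM.
move=> x _; rewrite EFin_Int; last exact: itg_abs.
rewrite -integralZl//; last exact: itg_abs.
by apply: eq_integral => y _ /=; rewrite normrM EFinM.
Qed.

End Fubini.

(** * Translations and primitives on the line *)

Section Line.
Context {R : realType}.
Notation mu := (@lebesgue_measure R).
Notation measurableR := (@measurable_fun _ _ (measurableTypeR R) R setT).
Implicit Types f g : R -> R.

Lemma measurable_shift (s : R) : measurableR (fun x : R => x + s).
Proof. exact: measurable_funD. Qed.

(** A measure with the values of Lebesgue measure on half-open intervals is Lebesgue measure. *)
Lemma lebesgue_measure_shift (s : R) (A : set R) : measurable A ->
  pushforward mu ((fun x : R => x + s) : _ -> measurableTypeR R) A = mu A.
Proof.
move=> mA; apply/esym/lebesgue_measure_unique => //=.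
  exact: measurable_shift.
move=> ms _ [[a b]] _ <-.
rewrite /pushforward /= (_ : _ @^-1` _ = `]a - s, b - s]%classic); last first.
  by apply/seteqP; split => x /=; rewrite !in_itv/= => /andP[h1 h2]; apply/andP; split; lra.
by rewrite !lebesgue_measure_itv/= !lte_fin ltrD2r -!EFinB; congr (if _ then _%:E else _); ring.
Qed.

Lemma ge0_integral_shift (s : R) (h : measurableTypeR R -> \bar R) :
  measurable_fun setT h -> (forall x, 0 <= h x)%E ->
  (\int[mu]_x h (x + s)%R = \int[mu]_x h x)%E.
Proof.
move=> mh h0.
have ms : measurable_fun setT ((fun x => x + s) : measurableTypeR R -> measurableTypeR R).
  exact: measurable_shift.
rewrite -(@ge0_integral_pushforward _ _ (measurableTypeR R) (measurableTypeR R) R _ ms mu setT h)//=.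
by apply: eq_measure_integral => //= A mA _; exact: lebesgue_measure_shift.
Qed.

Lemma Int_shift (s : R) f : measurableR f -> Int mu (fun x => f (x + s)) = Int mu f.
Proof.
move=> mf; rewrite /Int /Rintegral; congr fine.
rewrite [LHS]integralE [RHS]integralE; congr (_ - _)%E.
  transitivity (\int[mu]_x ((EFin \o f)^\+ (x + s)%R))%E.
    by apply: eq_integral => x _; rewrite !funeposE.
  apply: (@ge0_integral_shift s ((EFin \o f)^\+)%E) => [|x]; last exact: funepos_ge0.
  exact/measurable_funepos/measurable_EFinP.
transitivity (\int[mu]_x ((EFin \o f)^\- (x + s)%R))%E.
  by apply: eq_integral => x _; rewrite !funenegE.
apply: (@ge0_integral_shift s ((EFin \o f)^\-)%E) => [|x]; last exact: funeneg_ge0.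
exact/measurable_funeneg/measurable_EFinP.
Qed.

Lemma ae_shift (s : R) (P : R -> Prop) : {ae mu, forall x, P x} ->
  {ae mu, forall x, P (x + s)}.
Proof.
move=> [N [mN N0 hN]]; have ms := measurable_shift s.
exists ((fun x => x + s) @^-1` N); split.
- by rewrite -[X in measurable X]setTI; exact: ms.
- by rewrite -[RHS]N0 -(lebesgue_measure_shift s mN).
- by move=> x /= nP; apply: hN.
Qed.

Lemma itg_shift_pair (s : R) (f : measurableTypeR R * measurableTypeR R -> R) :
  itg (mu \x mu)%E f ->
  itg (mu \x mu)%E (fun z => f (z.1 + s, z.2)) /\
  Int (mu \x mu)%E (fun z => f (z.1 + s, z.2)) = Int (mu \x mu)%E f.
Proof.
move=> If; have mf := itg_measurable If.
have ms : measurable_fun setT (fun z : measurableTypeR R * measurableTypeR R =>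
    ((z.1 + s, z.2) : measurableTypeR R * measurableTypeR R)).
  apply/measurable_fun_pairP; split => /=; last exact: measurable_snd.
  by apply: (measurableT_comp (measurable_shift s)); exact: measurable_fst.
have sec x : measurableR (fun t => f (t, x)).
  exact: (measurable_fun_pair1 x mf).
have Is : itg (mu \x mu)%E (fun z => f (z.1 + s, z.2)).
  apply/integrable21ltyP; first by apply/measurable_EFinP; exact: (measurableT_comp mf ms).
  rewrite [X in (X < _)%E](_ : _ = (\int[mu]_x \int[mu]_t `|(f (t, x))%:E|)%E).
    exact/(integrable21ltyP mu mu (measurable_int _ If)).
  apply: eq_integral => x _.
  apply: (@ge0_integral_shift s (fun t => `|(f (t, x))%:E|%E)) => //.
  by apply: measurableT_comp => //; apply/measurable_EFinP; exact: sec.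
split=> //; have [_ <-] := Int_pair_snd Is; have [_ <-] := Int_pair_snd If.
by apply: Int_ext => x /=; exact: (Int_shift s (sec x)).
Qed.

(** The primitive that vanishes at minus infinity. For a function extended by 0 outside ]a, b[ it is
    the primitive starting from a, and it is constant to the right of b. *)
Definition prim f (x : R) : R := Int mu (fun y => if y <= x then f y else 0).

Lemma measurable_le_if d (T : measurableType d) (u v : T -> R) (f g : T -> R) :
  measurable_fun setT u -> measurable_fun setT v ->
  measurable_fun setT f -> measurable_fun setT g ->
  measurable_fun setT (fun z => if u z <= v z then f z else g z).
Proof.
by move=> mu_ mv mf mg; apply: measurable_fun_ifT => //; exact: measurable_fun_ler.
Qed.

Lemma itg_cut x f : itg mu f -> itg mu (fun y => if y <= x then f y else 0).
Proof.
move=> If; apply: (itg_le _ (itg_abs If)).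
  by apply: measurable_le_if; [exact: measurable_id|exact: measurable_cst|exact: (itg_measurable If)|exact: measurable_cst].
by move=> y; case: ifP => // _; rewrite normr0.
Qed.

Lemma prim_le f x : itg mu f -> `|prim f x| <= Int mu (fun y => `|f y|).
Proof.
move=> If; apply: Int_abs_le; [exact: itg_cut|exact: itg_abs|].
by move=> y; case: ifP => // _; rewrite normr0.
Qed.

Lemma primD f g x : itg mu f -> itg mu g ->
  prim (fun y => f y + g y) x = prim f x + prim g x.
Proof.
move=> If Ig; rewrite /prim -IntD; try exact: itg_cut.
by apply: Int_ext => y; case: ifP; rewrite ?addr0.
Qed.

Lemma primZ k f x : itg mu f -> prim (fun y => k * f y) x = k * prim f x.
Proof.
move=> If; rewrite /prim -IntZ; try exact: itg_cut.
by apply: Int_ext => y; case: ifP; rewrite ?mulr0.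
Qed.

(** Absolute continuity of the integral: an increment of the primitive is the integral of f over a
    half-open interval of small measure. *)
Lemma prim_continuous f : itg mu f -> continuous (prim f).
Proof.
move=> If x; apply/cvgrPdist_le => e e0.
have /= [d [d0 hd]] := integral_normr_continuous If e0.
near=> y.
have h a b : a <= b -> `|b - a| < d -> `|prim f b - prim f a| <= e.
  move=> ab abd; rewrite /prim -IntB; try exact: itg_cut.
  have -> : (fun y => (if y <= b then f y else 0) - (if y <= a then f y else 0)) =
      f \_ `]a, b].
    apply/funext => z; rewrite patchE mem_setE in_itv /=.
    case: (leP z a) => za.
      by rewrite (le_trans za ab) subrr.
    by case: ifP; rewrite ?subr0.
  rewrite /Int -Rintegral_mkcond.
  apply: (le_trans (le_normr_Rintegral _ _)) => //.
    exact: integrableS If.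
  apply/ltW/hd => //; rewrite lebesgue_measure_itv/= lte_fin.
  by case: ifP => _ //; rewrite -EFinD lte_fin (le_lt_trans (ler_norm _)).
have xyd : `|x - y| < d by near: y; exact: cvgr_dist_lt.
case: (leP x y) => xy; first by rewrite distrC h// distrC.
by rewrite h// ltW.
Unshelve. all: by end_near. Qed.

Lemma prim_measurable f : itg mu f -> measurableR (prim f).
Proof. by move=> If; apply: continuous_measurable_fun; exact: prim_continuous. Qed.

Lemma ae_neq (x : R) : {ae mu, forall y, y != x}.
Proof.
exists [set x]; split; first exact: measurable_set1.
  by rewrite lebesgue_measure_set1.
by move=> y /= /negP; rewrite negbK => /eqP.
Qed.

(** Integration by parts for merely integrable densities. The product of the primitives at x is the
    integral of f(y) g(z) over the pairs with y, z <= x; the diagonal cuts this square into two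
    triangles, and Fubini integrates each of them along the smaller variable. *)
Lemma prim_mul f g x : itg mu f -> itg mu g ->
  itg mu (fun y => f y * prim g y + prim f y * g y) /\
  prim f x * prim g x = prim (fun y => f y * prim g y + prim f y * g y) x.
Proof.
move=> If Ig.
have Ifg : itg mu (fun y => f y * prim g y).
  apply: (itg_ext (fun y => mulrC _ _)); apply: (@itg_bddM _ _ _ _ _ _ (Int mu (fun y => `|g y|))) => //.
    exact: prim_measurable.
  by move=> y; exact: prim_le.
have Igf : itg mu (fun y => prim f y * g y).
  apply: (@itg_bddM _ _ _ _ _ _ (Int mu (fun y => `|f y|))) => //.
    exact: prim_measurable.
  by move=> y; exact: prim_le.
split; first exact: itgD.
rewrite primD//.
pose fx y := if y <= x then f y else 0.
pose gx y := if y <= x then g y else 0.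
have Ifx : itg mu fx by exact: itg_cut.
have Igx : itg mu gx by exact: itg_cut.
have I2 := itg_tensor Ifx Igx.
pose F1 (z : measurableTypeR R * measurableTypeR R) := if z.2 <= z.1 then fx z.1 * gx z.2 else 0.
pose F2 (z : measurableTypeR R * measurableTypeR R) := if z.2 <= z.1 then 0 else fx z.1 * gx z.2.
have I1 : itg (mu \x mu)%E F1.
  apply: (itg_le _ (itg_abs I2)).
    by apply: measurable_le_if => //; exact: itg_measurable I2.
  by move=> z; rewrite /F1; case: ifP => // _; rewrite normr0.
have I3 : itg (mu \x mu)%E F2.
  apply: (itg_le _ (itg_abs I2)).
    by apply: measurable_le_if => //; exact: itg_measurable I2.
  by move=> z; rewrite /F2; case: ifP => // _; rewrite normr0.
have -> : prim f x * prim g x = Int (mu \x mu)%E (fun z => fx z.1 * gx z.2).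
  have [_ <-] := Int_pair_fst I2.
  under Int_ext do rewrite /= IntZ//.
  by under Int_ext do rewrite mulrC; rewrite IntZ// mulrC.
have -> : Int (mu \x mu)%E (fun z => fx z.1 * gx z.2) =
    Int (mu \x mu)%E F1 + Int (mu \x mu)%E F2.
  by rewrite -IntD//; apply: Int_ext => z; rewrite /F1 /F2; case: ifP; rewrite ?addr0 ?add0r.
congr (_ + _).
  have [_ <-] := Int_pair_fst I1; apply: Int_ext => y; rewrite /F1 /=.
  case: ifP => [yx|yx]; last first.
    rewrite -[RHS](Int0 mu); apply: Int_ext => z; rewrite /fx yx mul0r.
    by case: ifP.
  rewrite -IntZ; last exact: itg_cut.
  apply: Int_ext => z; rewrite /fx yx /gx; case: ifP => [zy|]; last by rewrite mulr0.
  by rewrite (le_trans zy yx).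
have [_ <-] := Int_pair_snd I3; apply: Int_ext => y; rewrite /F2 /=.
case: ifP => [yx|yx]; last first.
  rewrite -[RHS](Int0 mu); apply: Int_ext => z; rewrite /gx yx mulr0.
  by case: ifP.
rewrite mulrC -IntZ; last exact: itg_cut.
(* The inner integral runs over z < y whereas [prim] includes z = y, a null set. *)
apply/esym; apply: (Int_ae _ _ _).2.
- by apply: itgZ; exact: itg_cut.
- apply: measurable_le_if => //; apply: measurable_funM => //.
  exact: (itg_measurable Ifx).
- apply: aeS (ae_neq y) => z zy.
  rewrite /gx yx /fx; case: (leP y z) => yz.
    have /negbTE -> : ~~ (z <= y) by rewrite -ltNge lt_neqAle eq_sym zy.
    by rewrite mulr0.
  by rewrite (ltW yz) (le_trans (ltW yz) yx) mulrC.
Qed.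

End Line.

(** * Averages over balls and their convergence *)

Section Average.
Context {R : realType}.
Notation mu := (@lebesgue_measure R).
Notation measurableR := (@measurable_fun _ _ (measurableTypeR R) R setT).
Implicit Types (f g h : R -> R) (r t : R).

Definition ballcut r t h : R -> R := fun s => if `|t - s| < r then h s else 0.

Definition average r h t : R := (2 * r)^-1 * Int mu (ballcut r t h).

Lemma ballcutE r t h : ballcut r t h = h \_ (ball t r).
Proof.
apply/funext => s; rewrite /ballcut patchE.
by have -> : (s \in (ball t r : set R)) = (`|t - s| < r) by apply/idP/idP; rewrite inE.
Qed.

Lemma itg_ballcut r t h : itg mu h -> itg mu (ballcut r t h).
Proof.
move=> Ih; rewrite ballcutE /itg -restrict_EFin; 
have mb : measurable (ball t r : set (measurableTypeR R)) by exact: measurable_ball.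
apply/(integrable_mkcond _ mb).
by apply: integrableS Ih => //; exact: measurable_ball.
Qed.

Lemma ballcut1 r t : 0 < r -> itg mu (ballcut r t (fun=> 1)) /\
  Int mu (ballcut r t (fun=> 1)) = 2 * r.
Proof.
move=> r0; have mb : measurable (ball t r) by exact: measurable_ball.
have -> : ballcut r t (fun=> 1) = \1_(ball t r).
  rewrite ballcutE; apply/funext => s; rewrite patchE indicE.
  by case: (_ \in _).
have mE : mu (ball t r) = (2 * r)%:E.
  by rewrite lebesgue_measure_ball ?ltW// mulr_natl.
split.
  apply/integrableP; split; first exact/measurable_EFinP/measurable_indic.
  under eq_integral do rewrite /= ger0_norm//.
  rewrite integral_indic// setIT; apply: le_lt_trans (ltry (2 * r)).
  by rewrite -mE.
by rewrite /Int /Rintegral integral_indic// setIT -[RHS]/(fine (2 * r)%:E) -mE.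
Qed.

(** Hence the symmetric difference quotient of a primitive is the average of its density, which is
    how difference quotients in time are handled later. The open ball and ]t - r, t + r] differ by
    one point. *)
Lemma ballcut_prim r t h : 0 < r -> itg mu h ->
  Int mu (ballcut r t h) = prim h (t + r) - prim h (t - r).
Proof.
move=> r0 Ih; rewrite /prim -IntB; try exact: itg_cut.
apply/esym; apply: (Int_ae _ _ _).2.
- by apply: itgB; exact: itg_cut.
- exact: itg_measurable (itg_ballcut _ _ Ih).
apply: aeS (ae_neq (t + r)) => s st; rewrite /ballcut ltr_distlC.
case: (leP s (t - r)) => s1 /=.
  have -> : s <= t + r by lra.
  by rewrite subrr.
by rewrite subr0 lt_neqAle st.
Qed.

Lemma average_measurable r h : 0 < r -> itg mu h -> measurableR (average r h).
Proof.
move=> r0 Ih; rewrite /average; apply: measurable_funM => //.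
under eq_fun do rewrite (ballcut_prim _ r0 Ih).
apply: measurable_funB; apply: (measurableT_comp (prim_measurable Ih)).
  exact: measurable_funD.
exact: measurable_funB.
Qed.

(** Fubini for the kernel |t - s| < r, which is symmetric in t and s and has integral 2 r in each
    variable. *)
Lemma Int_average r h : 0 < r -> itg mu h ->
  itg mu (average r h) /\ Int mu (average r h) = Int mu h.
Proof.
move=> r0 Ih.
pose K (z : measurableTypeR R * measurableTypeR R) := ballcut r z.1 h z.2.
have mK : measurable_fun setT K.
  apply: measurable_fun_ifT => //.
    apply: measurable_fun_ltr => //; apply: measurableT_comp => //.
    by apply: measurable_funB; [exact: measurable_fst|exact: measurable_snd].
  by apply: (measurableT_comp (itg_measurable Ih)); exact: measurable_snd.
have KE t s : K (t, s) = h s * ballcut r s (fun=> 1) t.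
  by rewrite /K /ballcut /= distrC; case: ifP; rewrite ?mulr1 ?mulr0.
have IK : itg (mu \x mu)%E K.
  apply/integrable21ltyP; first exact/measurable_EFinP.
  rewrite [X in (X < _)%E](_ : _ = (\int[mu]_s (2 * r * `|h s|)%:E)%E).
    exact: (integrable_lty measurableT (itgZ (2 * r) (itg_abs Ih))).
  apply: eq_integral => s _; rewrite -(proj2 (ballcut1 s r0)).
  rewrite mulrC -IntZ; last exact: (proj1 (ballcut1 s r0)).
  rewrite EFin_Int; last exact: itgZ (proj1 (ballcut1 s r0)).
  apply: eq_integral => t _ /=; rewrite KE normrM; congr (_ * _)%:E.
  by rewrite /ballcut; case: ifP; rewrite ?normr1 ?normr0.
have [I1 E1] := Int_pair_fst IK; have [_ E2] := Int_pair_snd IK.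
split; first exact: itgZ I1.
rewrite /average IntZ// E1 -E2.
under Int_ext => s.
  under Int_ext do rewrite KE.
  rewrite IntZ; last exact: (proj1 (ballcut1 s r0)).
  rewrite (proj2 (ballcut1 s r0)).
  over.
under Int_ext do rewrite mulrC.
by rewrite IntZ// mulKf// mulf_neq0// gt_eqF.
Qed.

(** The expression is the average over s of (f t + g s)^2. *)
Lemma average_sqr r f g t : 0 < r -> itg mu g -> itg mu (fun s => g s ^+ 2) ->
  0 <= f t ^+ 2 + 2 * (f t * average r g t) + average r (fun s => g s ^+ 2) t.
Proof.
move=> r0 Ig Ig2; set c := f t.
have [I1 E1] := ballcut1 t r0.
have r20 : 2 * r != 0 by rewrite mulf_neq0// gt_eqF.
have -> : c ^+ 2 + 2 * (c * average r g t) + average r (fun s => g s ^+ 2) t =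
    (2 * r)^-1 * Int mu (ballcut r t (fun s => (c + g s) ^+ 2)).
  have -> : ballcut r t (fun s => (c + g s) ^+ 2) = fun s =>
     c ^+ 2 * ballcut r t (fun=> 1) s + (2 * c) * ballcut r t g s +
     ballcut r t (fun s => g s ^+ 2) s.
    apply/funext => s; rewrite /ballcut; case: ifP => _; ring.
  have J1 := itgZ (c ^+ 2) I1.
  have J2 := itgZ (2 * c) (itg_ballcut r t Ig).
  have J3 := itg_ballcut r t Ig2.
  rewrite IntD//; last exact: itgD.
  rewrite IntD// IntZ// IntZ; last exact: itg_ballcut.
  rewrite E1 /average mulrDr mulrDr; congr (_ + _ + _).
    by rewrite mulrCA mulVf// mulr1.
  ring.
apply: mulr_ge0; first by rewrite invr_ge0 mulr_ge0// ltW.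
by apply: Rintegral_ge0 => s _; rewrite /ballcut; case: ifP => // _; rewrite sqr_ge0.
Qed.

Lemma itg_ballcut_dev r t h : 0 < r -> itg mu h ->
  itg mu (ballcut r t (fun s => `|h s - h t|)).
Proof.
move=> r0 Ih; have [I1 _] := ballcut1 t r0; have mh := itg_measurable Ih.
apply: (itg_le _ (itgD (itg_abs (itg_ballcut r t Ih)) (itgZ `|h t| I1))).
  have mb : measurable (ball t r : set (measurableTypeR R)) by exact: measurable_ball.
  rewrite ballcutE; apply/(measurable_restrictT _ mb).
  by apply: measurable_funTS; apply: measurableT_comp => //; exact: measurable_funB.
move=> s; rewrite /ballcut; case: ifP => _; last by rewrite normr0 mulr0 addr0.
by rewrite normr_id mulr1 ler_normB.
Qed.

(** Lebesgue points, along the radii 1/(n+1). The form with absolute deviations serves both the ball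
    averages and the mollifiers. *)
Lemma lebesgue_dev h : itg mu h -> {ae mu, forall t,
  forall e, 0 < e -> \forall n \near \oo, (2 * n.+1%:R^-1)^-1 *
    Int mu (ballcut n.+1%:R^-1 t (fun s => `|h s - h t|)) <= e}.
Proof.
move=> Ih; have lh : locally_integrable setT h.
  by apply: open_integrable_locally => //; exact: openT.
apply: aeS (lebesgue_differentiation lh) => t ht e e0.
have davgE r : 0 < r -> davg h t r =
    ((2 * r)^-1 * Int mu (ballcut r t (fun s => `|h s - h t|)))%:E.
  move=> r0; rewrite /davg /iavg lebesgue_measure_ball ?ltW// -(mulr_natl r).
  rewrite inver gt_eqF ?mulr_gt0// EFinM; congr (_ * _)%E.
  rewrite integral_mkcond EFin_Int; last exact: itg_ballcut_dev.
  by apply: eq_integral => s _; rewrite ballcutE !patchE; case: ifP.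
have /= [d d0 hd] : \forall r \near (0 : R)^'+, (davg h t r <= e%:E)%E.
  move/fine_cvgP : ht => [fin /cvgrPdist_le /(_ e e0)] hc.
  near=> r; have r0 : 0 < r by near: r; exact: nbhs_right_gt.
  have : `|0 - fine (davg h t r)| <= e by near: r.
  by rewrite davgE//= sub0r normrN lee_fin => /(le_trans (ler_norm _)).
near=> n.
have p0 : 0 < n.+1%:R^-1 :> R by rewrite invr_gt0.
rewrite -lee_fin -davgE//.
apply: hd => //=; rewrite sub0r normrN gtr0_norm//.
by near: n; exact: (near_infty_natSinv_lt (PosNum d0)).
Unshelve. all: by end_near. Qed.

Lemma average_cvg h : itg mu h ->
  {ae mu, forall t, average n.+1%:R^-1 h t @[n --> \oo] --> h t}.
Proof.
move=> Ih; apply: aeS (lebesgue_dev Ih) => t ht; apply/cvgrPdist_le => e e0.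
apply: filterS (ht e e0) => n; apply: le_trans.
have r0 : 0 < n.+1%:R^-1 :> R by rewrite invr_gt0.
set r := n.+1%:R^-1 in r0 *.
have [I1 E1] := ballcut1 t r0.
have -> : h t - average r h t =
    (2 * r)^-1 * Int mu (fun s => h t * ballcut r t (fun=> 1) s - ballcut r t h s).
  rewrite IntB ?IntZ ?E1//; [|exact: itgZ|exact: itg_ballcut].
  by rewrite mulrBr; congr (_ - _); rewrite mulrCA mulVf ?mulr1// mulf_neq0// gt_eqF.
rewrite normrM ger0_norm ?invr_ge0 ?mulr_ge0 ?(ltW r0)//.
rewrite ler_wpM2l ?invr_ge0 ?mulr_ge0 ?(ltW r0)//.
apply: Int_abs_le; [|exact: itg_ballcut_dev|].
  by apply: itgB; [exact: itgZ|exact: itg_ballcut].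
move=> s; rewrite /ballcut; case: ifP => _; first by rewrite mulr1 distrC.
by rewrite mulr0 subrr normr0.
Qed.

Lemma average_L2 r g : 0 < r -> itg mu g -> L2 mu g -> L2 mu (average r g) /\
  Int mu (fun t => average r g t ^+ 2) <= Int mu (fun t => g t ^+ 2).
Proof.
move=> r0 Ig [mg Ig2]; have [I1 E1] := Int_average r0 Ig2.
have ma := average_measurable r0 Ig.
have le t : average r g t ^+ 2 <= average r (fun s => g s ^+ 2) t.
  (* Jensen's inequality: [average_sqr] with minus the average as the constant. *)
  by have /= := @average_sqr r (fun s => - average r g t) g t r0 Ig Ig2; lra.
have La : itg mu (fun t => average r g t ^+ 2).
  apply: (itg_le _ I1); first exact: measurable_funX.
  by move=> t; rewrite ger0_norm ?sqr_ge0.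
by split=> //; rewrite -E1; apply: Int_le.
Qed.

(** Fatou's lemma, by dominated convergence for the minimum of [D_ n] and [D], which is dominated by
    [D] and still tends to [D]. *)
Lemma fatou_near (D_ : nat -> R -> R) (D : R -> R) :
  (forall n, itg mu (D_ n)) -> itg mu D -> (forall n t, 0 <= D_ n t) ->
  (forall t, 0 <= D t) -> {ae mu, forall t, D_ ^~ t @ \oo --> D t} ->
  forall e, 0 < e -> \forall n \near \oo, Int mu D - e <= Int mu (D_ n).
Proof.
move=> ID_ ID D_0 D0 cv e e0.
pose m_ n t := Num.min (D_ n t) (D t).
have mm n : measurableR (m_ n).
  exact: (measurable_minr (itg_measurable (ID_ n)) (itg_measurable ID)).
have mle n t : `|m_ n t| <= D t.
  by rewrite ger0_norm ?le_min ?D_0 ?D0// ge_min lexx orbT.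
have cm : (fun n => Int mu (m_ n)) @ \oo --> Int mu D.
  apply: (@Int_cvg _ _ _ mu m_ D D) => //.
  - exact: (itg_measurable ID).
  - apply: aeS cv => t /cvgrPdist_le cvt; apply/cvgrPdist_le => d d0.
    apply: filterS (cvt d d0) => n; apply: le_trans.
    by rewrite /m_; case: (leP (D_ n t) (D t)) => // _; rewrite subrr normr0.
  - by move=> n; apply: nearW.
near=> n.
apply: (@le_trans _ _ (Int mu (m_ n))).
  have : `|Int mu D - Int mu (m_ n)| < e by near: n; exact: cvgr_dist_lt.
  by move/ltr_normlW; lra.
have Im : itg mu (m_ n) := itg_le (mm n) ID (mle n).
by apply: (Int_le Im (ID_ n)) => t; rewrite ge_min lexx.
Unshelve. all: by end_near. Qed.

(* Fatou's lemma for the averages of (f(t) +- g(s))^2 over s near t: their integrals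
   are int f^2 + int g^2 +- 2 int f (average of g). *)
Lemma Int_average_cvg f g : itg mu g -> L2 mu f -> L2 mu g ->
  Int mu (fun t => f t * average n.+1%:R^-1 g t) @[n --> \oo] -->
  Int mu (fun t => f t * g t).
Proof.
move=> Ig Lf Lg; have [mg Ig2] := Lg; have [mf If2] := Lf.
have Ifg := L2M Lf Lg.
have p0 n : 0 < n.+1%:R^-1 :> R by rewrite invr_gt0.
have Ifa n := L2M Lf (average_L2 (p0 n) Ig Lg).1.
have key (c : R) : `|c| = 1 -> forall e, 0 < e -> \forall n \near \oo,
    2 * c * Int mu (fun t => f t * g t) - e <=
    2 * c * Int mu (fun t => f t * average n.+1%:R^-1 g t).
  move=> c1 e e0; have c2 : c ^+ 2 = 1 by rewrite -(real_normK (num_real c)) c1 expr1n.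
  pose D_ n t := (c * f t) ^+ 2 + 2 * (c * f t * average n.+1%:R^-1 g t) +
    average n.+1%:R^-1 (fun s => g s ^+ 2) t.
  pose D t := (c * f t) ^+ 2 + 2 * (c * f t * g t) + g t ^+ 2.
  have DE n : D_ n = fun t => f t ^+ 2 + (2 * c) * (f t * average n.+1%:R^-1 g t) +
    average n.+1%:R^-1 (fun s => g s ^+ 2) t.
    by apply/funext => t; rewrite /D_ exprMn c2 mul1r; ring.
  have DE' : D = fun t => f t ^+ 2 + (2 * c) * (f t * g t) + g t ^+ 2.
    by apply/funext => t; rewrite /D exprMn c2 mul1r; ring.
  have ID_ n : itg mu (D_ n).
    rewrite DE; apply: itgD; last exact: (Int_average _ Ig2).1.
    by apply: itgD => //; exact: itgZ.
  have ID : itg mu D.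
    by rewrite DE'; apply: itgD => //; apply: itgD => //; exact: itgZ.
  have := @fatou_near D_ D ID_ ID _ _ _ e e0.
  have -> : Int mu D = Int mu (fun t => f t ^+ 2) + 2 * c * Int mu (fun t => f t * g t)
     + Int mu (fun t => g t ^+ 2).
    have I2 := itgZ (2 * c) Ifg.
    by rewrite DE' (IntD (itgD If2 I2) Ig2) (IntD If2 I2) (IntZ _ Ifg).
  have DnE n : Int mu (D_ n) = Int mu (fun t => f t ^+ 2) +
    2 * c * Int mu (fun t => f t * average n.+1%:R^-1 g t) + Int mu (fun t => g t ^+ 2).
    have [Ia Ea] := Int_average (p0 n) Ig2.
    have I2 := itgZ (2 * c) (Ifa n).
    by rewrite DE (IntD (itgD If2 I2) Ia) (IntD If2 I2) Ea (IntZ _ (Ifa n)).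
  move=> H; have {}H : \forall n \near \oo, Int mu (fun t => f t ^+ 2) +
      2 * c * Int mu (fun t => f t * g t) + Int mu (fun t => g t ^+ 2) - e <=
      Int mu (D_ n).
    apply: H.
    - by move=> n t; exact: (@average_sqr _ (fun s => c * f s)).
    - by move=> t; rewrite (_ : D t = (c * f t + g t) ^+ 2) ?sqr_ge0// /D; ring.
    - apply: aeS2 (average_cvg Ig) (average_cvg Ig2) => t h1 h2.
      apply: cvgD => //; apply: cvgD; first exact: cvg_cst.
      by apply: cvgMr; apply: cvgMr.
  by apply: filterS H => n; rewrite DnE; lra.
apply/cvgrPdist_le => e e0; near=> n.
have h1 : 2 * 1 * Int mu (fun t => f t * g t) - e <=
    2 * 1 * Int mu (fun t => f t * average n.+1%:R^-1 g t).
  by near: n; apply: key => //; rewrite normr1.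
have h2 : 2 * (-1) * Int mu (fun t => f t * g t) - e <=
    2 * (-1) * Int mu (fun t => f t * average n.+1%:R^-1 g t).
  by near: n; apply: key => //; rewrite normrN1.
rewrite ler_norml; apply/andP; split; lra.
Unshelve. all: by end_near. Qed.

End Average.

(** * Smooth functions *)

Section Derivatives.
Context {R : realType}.
Implicit Types (f g : R -> R) (x : R).

Definition has_derivative f f' := forall x, is_derive x 1 f (f' x).

Lemma has_derivativeE f f' : has_derivative f f' -> (derive1 f) = f'.
Proof. by move=> D; apply/funext => x; rewrite derive1E; have [_ ->] := D x. Qed.

Lemma has_derivative_ext f f1 f' f1' : has_derivative f f' ->
  f =1 f1 -> f' =1 f1' -> has_derivative f1 f1'.
Proof. by move=> + /funext <- /funext <-. Qed.

Lemma has_derivative_continuous f f' : has_derivative f f' -> continuous f.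
Proof.
move=> D x; apply/differentiable_continuous/derivable1_diffP.
by have [? _] := D x.
Qed.

Lemma has_derivative_cst k : has_derivative (fun=> k) (fun=> 0).
Proof. by move=> x; exact: is_derive_cst. Qed.

Lemma has_derivative_id : has_derivative (fun x => x) (fun=> 1).
Proof. by move=> x; exact: is_derive_id. Qed.

Lemma has_derivativeD f f' g g' : has_derivative f f' -> has_derivative g g' ->
  has_derivative (fun x => f x + g x) (fun x => f' x + g' x).
Proof. by move=> Df Dg x; exact: is_deriveD (Df x) (Dg x). Qed.

Lemma has_derivativeM f f' g g' : has_derivative f f' -> has_derivative g g' ->
  has_derivative (fun x => f x * g x) (fun x => f' x * g x + f x * g' x).
Proof.
move=> Df Dg x; apply: (@is_derive_eq _ _ _ _ _ _ _ _ (is_deriveM (Df x) (Dg x))).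
by rewrite /GRing.scale /= addrC mulrC.
Qed.

Lemma has_derivativeZ k f f' : has_derivative f f' ->
  has_derivative (fun x => k * f x) (fun x => k * f' x).
Proof.
move=> Df; apply: has_derivative_ext (has_derivativeM (has_derivative_cst k) Df) _ _ => // x.
by rewrite mul0r add0r.
Qed.

Lemma has_derivativeN f f' : has_derivative f f' ->
  has_derivative (fun x => - f x) (fun x => - f' x).
Proof.
by move/(has_derivativeZ (-1)) => D; apply: has_derivative_ext D _ _ => x; rewrite mulN1r.
Qed.

Lemma has_derivativeB f f' g g' : has_derivative f f' -> has_derivative g g' ->
  has_derivative (fun x => f x - g x) (fun x => f' x - g' x).
Proof. by move=> Df /has_derivativeN; exact: has_derivativeD. Qed.

Lemma has_derivative_comp f f' g g' : has_derivative f f' -> has_derivative g g' ->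
  has_derivative (fun x => f (g x)) (fun x => f' (g x) * g' x).
Proof. by move=> Df Dg x; exact: is_derive1_comp (Df (g x)) (Dg x). Qed.

Lemma has_derivativeV f f' : (forall x, f x != 0) -> has_derivative f f' ->
  has_derivative (fun x => (f x)^-1) (fun x => - f' x * ((f x)^-1 * (f x)^-1)).
Proof.
move=> f0 Df x; apply: (@is_derive_eq _ _ _ _ _ _ _ _ (is_deriveV (f0 x) (Df x))).
by rewrite /GRing.scale /= -exprVn expr2; ring.
Qed.

(** The slope f z / (z - x) is at most M |z - x|. This settles differentiability at the points where
    a function glued with 0 changes its formula. *)
Lemma is_derive_sqr_bound f x M : f x = 0 ->
  (forall y, `|f y| <= M * (y - x) ^+ 2) -> is_derive x 1 f 0.
Proof.
move=> fx0 fM; apply/is_derive1_caratheodory.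
exists (fun z => if z == x then 0 else f z / (z - x)); split; last by rewrite eqxx.
  move=> z; rewrite fx0 subr0; case: (eqVneq z x) => [->|zx]; first by rewrite mul0r.
  by rewrite divfK// subr_eq0.
rewrite /prop_for /continuous_at eqxx; apply/cvgrPdist_le => e e0.
have M0 : 0 <= M by have := fM (x + 1); rewrite addrAC subrr add0r expr1n mulr1; exact: le_trans.
near=> z; rewrite sub0r normrN; case: eqVneq => [_|zx]; first by rewrite normr0 ltW.
rewrite normrM normfV ler_pdivrMr ?normr_gt0 ?subr_eq0//.
apply: (le_trans (fM z)); rewrite -(real_normK (num_real _)) expr2 mulrA.
rewrite ler_wpM2r//.
have : `|x - z| < e / (M + 1).
  by near: z; apply: cvgr_dist_lt => //; rewrite divr_gt0// ltr_wpDl.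
rewrite distrC ltr_pdivlMr ?ltr_wpDl// => h.
by have := normr_ge0 (z - x); nra.
Unshelve. all: by end_near. Qed.

(** A single term x^k / k! of the exponential series is at most exp x. *)
Lemma exp_decay k (x : R) : 0 <= x -> x ^+ k * expR (- x) <= k`!%:R.
Proof.
move=> x0; rewrite expRN ler_pdivrMr ?expR_gt0//.
case: k => [|k]; first by rewrite expr0 fact0 mul1r -expR0 ler_expR.
have := expR_ge1Dxn k x0; rewrite -ler_pdivrMl ?ltr0n ?fact_gt0// mulrC.
by move=> h; apply: le_trans h; rewrite lerDr.
Qed.

(** The recursion differentiates f first, so that closure under sums, products and inverses follows
    by induction on n from the first-order rules, without a Leibniz formula. *)
Fixpoint nderivable n f : Prop :=
  if n is n'.+1 then (forall x, derivable f x 1) /\ nderivable n' (derive1 f) else True.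

Lemma nderivable_smooth f : (forall n, nderivable n f) <-> smooth f.
Proof.
split=> [h n x|h n].
  have : nderivable n.+1 f by [].
  by elim: n f {h} => [|n IH] f [D0 D1]; [exact: D0|rewrite derive1Sn; exact: IH].
elim: n f h => [//|n IH] f h; split; first exact: (h 0%N).
by apply: IH => m x; rewrite -derive1Sn; exact: h.
Qed.

Lemma has_nderivable n f f' : has_derivative f f' -> nderivable n f' -> nderivable n.+1 f.
Proof.
by move=> D Df'; split=> [x|]; [have [] := D x|rewrite (has_derivativeE D)].
Qed.

Lemma nderivable_has n f : nderivable n.+1 f ->
  has_derivative f (derive1 f) /\ nderivable n (derive1 f).
Proof.
by case=> D D'; split=> // x; rewrite derive1E; exact: derivableP.
Qed.

Lemma nderivableW n f : nderivable n.+1 f -> nderivable n f.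
Proof. by elim: n f => [//|n IH] f [D /IH]. Qed.

Lemma nderivable_cst n k : nderivable n (fun=> k).
Proof.
by elim: n k => [//|n IH] k; apply: has_nderivable (has_derivative_cst k) (IH 0).
Qed.

Lemma nderivable_id n : nderivable n (fun x => x).
Proof.
by case: n => [//|n]; apply: has_nderivable has_derivative_id (nderivable_cst n 1).
Qed.

Lemma nderivableD n f g : nderivable n f -> nderivable n g ->
  nderivable n (fun x => f x + g x).
Proof.
elim: n f g => [//|n IH] f g /nderivable_has[Df f'] /nderivable_has[Dg g'].
by apply: has_nderivable (has_derivativeD Df Dg) (IH _ _ f' g').
Qed.

Lemma nderivableM n f g : nderivable n f -> nderivable n g ->
  nderivable n (fun x => f x * g x).
Proof.
elim: n f g => [//|n IH] f g nf ng.
have [Df f'] := nderivable_has nf; have [Dg g'] := nderivable_has ng.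
apply: has_nderivable (has_derivativeM Df Dg) _.
by apply: nderivableD; apply: IH => //; exact: nderivableW.
Qed.

Lemma nderivableZ n k f : nderivable n f -> nderivable n (fun x => k * f x).
Proof. exact/nderivableM/nderivable_cst. Qed.

Lemma nderivableB n f g : nderivable n f -> nderivable n g ->
  nderivable n (fun x => f x - g x).
Proof.
move=> nf /(nderivableZ (-1)) ng; rewrite (_ : (fun x => _) = fun x => f x + (-1) * g x).
  exact: nderivableD.
by apply/funext => x; rewrite mulN1r.
Qed.

Lemma nderivableV n f : (forall x, f x != 0) -> nderivable n f ->
  nderivable n (fun x => (f x)^-1).
Proof.
move=> f0; elim: n => [//|n IH] nf; have [Df f'] := nderivable_has nf.
apply: has_nderivable (has_derivativeV f0 Df) _.
have nV := IH (nderivableW nf).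
apply: nderivableM; last exact: nderivableM.
rewrite (_ : (fun x => _) = fun x => (-1) * (derive1 f) x); first exact: nderivableZ.
by apply/funext => x; rewrite mulN1r.
Qed.

Lemma nderivable_affine n f (a b : R) : nderivable n f ->
  nderivable n (fun x => f (a * x + b)).
Proof.
elim: n f => [//|n IH] f /nderivable_has[Df f'].
have Da : has_derivative (fun x => a * x + b) (fun=> a).
  apply: has_derivative_ext (has_derivativeD (has_derivativeZ a has_derivative_id) (has_derivative_cst b)) _ _ => // x.
  by rewrite mulr1 addr0.
apply: has_nderivable (has_derivative_comp Df Da) _.
by apply: nderivableM; [exact: IH|exact: nderivable_cst].
Qed.

(* The span of these functions is stable under differentiation. *)
Definition flat k (x : R) : R := if 0 < x then x^-1 ^+ k * expR (- x^-1) else 0.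

Lemma flat_derivative k :
  has_derivative (flat k) (fun x => (- k%:R) * flat k.+1 x + flat k.+2 x).
Proof.
move=> x; case: (ltgtP x 0) => x0.
- have -> : - k%:R * flat k.+1 x + flat k.+2 x = 0.
    by rewrite /flat ltNge (ltW x0) /= mulr0 addr0.
  apply: (near_eq_is_derive _ (is_derive_cst (0 : R) x 1)).
  near=> y; have y0 : y < 0 by near: y; exact: lt_nbhsl.
  by rewrite /flat ltNge (ltW y0).
- have h1 : is_derive x 1 (fun y : R => y^-1) (- x ^- 2 *: 1).
    by apply: is_deriveV => //; rewrite gt_eqF.
  have h2 : is_derive x 1 (fun y : R => expR (- y^-1)) (expR (- x^-1) * - (- x ^- 2 *: 1)).
    exact: (@is_derive1_comp _ expR (fun y => - y^-1)).
  have h3 := @is_deriveX _ _ _ k _ _ _ h1.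
  apply: (@near_eq_is_derive _ _ _ (((fun y => y^-1) ^+ k) * (fun y => expR (- y^-1)))).
    near=> y; have y0 : 0 < y by near: y; exact: lt_nbhsr.
    by rewrite /flat y0 !fctE.
  apply: (@is_derive_eq _ _ _ _ _ _ _ _ (is_deriveM h3 h2)).
  rewrite /flat x0 /GRing.scale /= !mulr1 -exprVn !fctE.
  case: k {h3} => [|k]; first by rewrite !expr0 /=; ring.
  rewrite -[k.+1.-1]/k !exprS; ring.
rewrite x0 /flat ltxx mulr0 addr0.
(* At 0 the exponential beats the power: flat k y <= (k+2)! y^2. *)
apply: (@is_derive_sqr_bound _ _ (k.+2)`!%:R); first by rewrite ltxx.
move=> y; rewrite subr0; case: ifP => y0; last by rewrite normr0 mulr_ge0// sqr_ge0.
have yi0 : 0 < y^-1 by rewrite invr_gt0.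
rewrite ger0_norm; last by rewrite mulr_ge0 ?expR_ge0// exprn_ge0// ltW.
rewrite -ler_pdivrMr ?exprn_gt0//; apply: le_trans (exp_decay k.+2 (ltW yi0)).
by rewrite -exprVn mulrAC -exprD addn2.
Unshelve. all: by end_near. Qed.

Lemma flat_nderivable n k : nderivable n (flat k).
Proof.
elim: n k => [//|n IH] k; apply: has_nderivable (flat_derivative k) _.
by apply: nderivableD => //; exact: nderivableZ.
Qed.

(** A smooth transition from 0 on ]-oo, -1] to 1 on [1, +oo[. The arguments are kept in the form a *
    x + b of [nderivable_affine]. *)
Definition smooth_step (x : R) : R :=
  flat 0 (1 * x + 1) / (flat 0 (1 * x + 1) + flat 0 ((-1) * x + 1)).

(** The two arguments add up to 2, so one of them is positive. *)
Lemma smooth_step_den (x : R) : flat 0 (1 * x + 1) + flat 0 ((-1) * x + 1) != 0.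
Proof.
have h y : 0 <= flat 0 y by rewrite /flat; case: ifP; rewrite // expr0 mul1r expR_ge0.
have h' y : 0 < y -> 0 < flat 0 y by rewrite /flat => ->; rewrite expr0 mul1r expR_gt0.
case: (ltP 0 (1 * x + 1)) => x0; first by rewrite gt_eqF// ltr_wpDr// h'.
by rewrite gt_eqF// ltr_wpDl// h'//; lra.
Qed.

Lemma smooth_step_nderivable n : nderivable n smooth_step.
Proof.
apply: nderivableM; first exact/nderivable_affine/flat_nderivable.
apply: nderivableV; first exact: smooth_step_den.
by apply: nderivableD; exact/nderivable_affine/flat_nderivable.
Qed.

Lemma smooth_step0 x : x <= -1 -> smooth_step x = 0.
Proof. by move=> h; rewrite /smooth_step /flat ifF ?mul0r//; apply/negbTE; lra. Qed.

Lemma smooth_step1 x : 1 <= x -> smooth_step x = 1.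
Proof.
move=> h; have := smooth_step_den x; rewrite /smooth_step.
have -> : flat 0 (-1 * x + 1) = 0 by rewrite /flat ifF//; apply/negbTE; lra.
by rewrite addr0; exact: divff.
Qed.

End Derivatives.

(** * The lemma of du Bois-Reymond *)

Section DuBoisReymond.
Context {R : realType}.
Notation mu := (@lebesgue_measure R).
Notation measurableR := (@measurable_fun _ _ (measurableTypeR R) R setT).
Implicit Types (f g : R -> R) (a b c d x t : R).

Lemma FTC_everywhere F f a b : a < b -> has_derivative F f -> continuous f ->
  itg mu (f \_ `[a, b]) /\ Int mu (f \_ `[a, b]) = F b - F a.
Proof.
move=> ab D cf; have cw : {within `[a, b], continuous f}.
  by apply: continuous_subspaceT => x; exact: cf.
have If : mu.-integrable `[a, b] (EFin \o f).
  by apply: continuous_compact_integrable => //; exact: segment_compact.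
split.
  rewrite /itg -restrict_EFin.
  have mab : measurable (`[a, b]%classic : set (measurableTypeR R)) by [].
  exact/(integrable_mkcond _ mab).
rewrite /Int -Rintegral_mkcond /Rintegral (@continuous_FTC2 _ f F a b)//.
  have cF := has_derivative_continuous D.
  split; first by move=> x _; have [] := D x.
    by apply: cvg_at_right_filter; exact: cF.
  by apply: cvg_at_left_filter; exact: cF.
by move=> x _; rewrite (has_derivativeE D).
Qed.

Lemma continuous_bounded f a b : continuous f -> exists M, 0 <= M /\
  forall x, a <= x <= b -> `|f x| <= M.
Proof.
move=> cf; have cw : {within `[a, b], continuous f}.
  by apply: continuous_subspaceT => x; exact: cf.
have /compact_bounded[M [_ hM]] := continuous_compact cw (@segment_compact _ a b).
exists (`|M| + 1); split; first by rewrite addr_ge0.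
move=> x xab; apply: hM; first by rewrite ltr_pwDr// ler_norm.
by exists x => //=; rewrite in_itv.
Qed.

Definition step_derivative := derive1 (@smooth_step R).

Lemma step_has_derivative : has_derivative (@smooth_step R) step_derivative.
Proof. exact: (proj1 (nderivable_has (@smooth_step_nderivable R 1))). Qed.

Lemma step_derivative_continuous : continuous step_derivative.
Proof.
have [_ h] := nderivable_has (@smooth_step_nderivable R 2).
by have [D _] := nderivable_has h; exact: has_derivative_continuous D.
Qed.

Lemma step_derivative_out x : 1 < `|x| -> step_derivative x = 0.
Proof.
have near_cst (k : R) : (\forall y \near x, smooth_step y = k) -> step_derivative x = 0.
  move=> h; rewrite /step_derivative derive1E (@near_eq_derive _ _ _ _ (cst k))//.
  exact: derive_cst.
case: (leP 0 x) => x0 h.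
  rewrite ger0_norm// in h; apply: (near_cst 1).
  by apply: filterS (lt_nbhsr h) => y y1; rewrite smooth_step1// ltW.
rewrite ltr0_norm// ltrNr in h; apply: (near_cst 0).
by apply: filterS (lt_nbhsl h) => y y1; rewrite smooth_step0// ltW.
Qed.

Lemma step_derivative_bounded : exists M, 0 < M /\ forall x, `|step_derivative x| <= M.
Proof.
have [M [M0 hM]] := @continuous_bounded _ (-1) 1 step_derivative_continuous.
exists (M + 1); split; first by rewrite ltr_wpDl.
move=> x; case: (leP `|x| 1) => x1.
  by rewrite (le_trans (hM x _)) ?lerDl// -ler_norml.
by rewrite step_derivative_out// normr0 addr_ge0.
Qed.

(* A mollifier supported in the open ball of radius 1/n.+1 around c: the dilation
   factor is 2 n.+1 because [step_derivative] vanishes outside [-1, 1]. *)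
Definition mollifier n c t : R :=
  2 * n.+1%:R * step_derivative (2 * n.+1%:R * (t - c)).

Definition mollifier_step n c t : R := smooth_step (2 * n.+1%:R * (t - c)).

Lemma mollifier_stepE n c : mollifier_step n c =
  fun t => smooth_step (2 * n.+1%:R * t + (- (2 * n.+1%:R * c))).
Proof. by apply/funext => t; rewrite /mollifier_step mulrBr. Qed.

Lemma mollifier_step_derivative n c : has_derivative (mollifier_step n c) (mollifier n c).
Proof.
rewrite mollifier_stepE.
have Da : has_derivative (fun x => 2 * n.+1%:R * x + (- (2 * n.+1%:R * c))) (fun=> 2 * n.+1%:R).
  apply: has_derivative_ext (has_derivativeD (has_derivativeZ (2 * n.+1%:R) has_derivative_id)
    (has_derivative_cst (- (2 * n.+1%:R * c)))) _ _ => // x.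
  by rewrite mulr1 addr0.
apply: has_derivative_ext (has_derivative_comp step_has_derivative Da) _ _ => // x.
by rewrite /mollifier mulrBr mulrC.
Qed.

Lemma mollifier_continuous n c : continuous (mollifier n c).
Proof.
have [_ h] := nderivable_has (nderivable_affine (2 * n.+1%:R) (- (2 * n.+1%:R * c))
  (@smooth_step_nderivable R 2)).
have [D _] := nderivable_has h.
rewrite -(has_derivativeE (mollifier_step_derivative n c)) mollifier_stepE.
exact: has_derivative_continuous D.
Qed.

Lemma mollifier_out n c t : n.+1%:R^-1 <= `|c - t| -> mollifier n c t = 0.
Proof.
move=> h; rewrite /mollifier step_derivative_out ?mulr0//.
have n0 : 0 < n.+1%:R :> R by rewrite ltr0n.
rewrite normrM ger0_norm ?mulr_ge0//.
rewrite distrC; apply: (@lt_le_trans _ _ (2 * n.+1%:R * n.+1%:R^-1)).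
  by rewrite mulfK ?gt_eqF// ltr1n.
by rewrite ler_wpM2l// mulr_ge0// ltW.
Qed.

Lemma mollifier_bounded : exists M, 0 < M /\ forall n c t,
  `|mollifier n c t| <= n.+1%:R * M.
Proof.
have [M [M0 hM]] := step_derivative_bounded.
exists (2 * M); split; first by rewrite mulr_gt0.
move=> n c t; rewrite normrM ger0_norm ?mulr_ge0 ?ler0n//.
by rewrite mulrA [_ * 2]mulrC ler_wpM2l ?mulr_ge0 ?ler0n.
Qed.

(** The mollifier is the derivative of a rescaled step, which rises from 0 to 1 between c - 1/(n+1)
    and c + 1/(n+1). *)
Lemma Int_mollifier n c : itg mu (mollifier n c) /\ Int mu (mollifier n c) = 1.
Proof.
have n0 : 0 < n.+1%:R :> R by rewrite ltr0n.
have r0 : 0 < n.+1%:R^-1 :> R by rewrite invr_gt0.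
pose a := c - n.+1%:R^-1; pose b := c + n.+1%:R^-1.
have ab : a < b by rewrite /a /b ltrBlDr -addrA ltrDl addr_gt0.
have E : mollifier n c = mollifier n c \_ `[a, b].
  apply/funext => t; rewrite patchE; case: ifPn => //; rewrite mem_setE in_itv /=.
  move=> h; rewrite mollifier_out//; rewrite leNgt ltr_distlC; apply/negP => /andP[h1 h2].
  by move/negP: h; apply; rewrite /a /b (ltW h1) (ltW h2).
have [I1 E1] := FTC_everywhere ab (mollifier_step_derivative n c) (@mollifier_continuous n c).
rewrite E; split=> //; rewrite E1 /mollifier_step smooth_step1 ?smooth_step0 ?subr0//.
  by rewrite /a addrAC subrr add0r mulrN mulfK ?gt_eqF//; lra.
by rewrite /b addrAC subrr add0r mulfK ?gt_eqF//; lra.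
Qed.

(** The two steps agree far to the left and far to the right, so the difference has compact support;
    its derivative is the difference of the mollifiers at c and d, so testing against it compares
    two mollified values. All primitives below are recovered by testing against these functions
    alone. *)
Definition test_step n c d t : R := mollifier_step n c t - mollifier_step n d t.

Lemma test_step_test n a b c d : a + n.+1%:R^-1 < c -> c < b - n.+1%:R^-1 ->
  a + n.+1%:R^-1 < d -> d < b - n.+1%:R^-1 -> test_function a b (test_step n c d).
Proof.
move=> ac cb ad db.
have n0 : 0 < n.+1%:R :> R by rewrite ltr0n.
have r0 : 0 < n.+1%:R^-1 :> R by rewrite invr_gt0.
set r := n.+1%:R^-1 in r0 ac cb ad db *.
pose l := Num.min c d - r; pose u := Num.max c d + r.
have nr : n.+1%:R * r = 1 by rewrite mulfV ?gt_eqF.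
have below x y : x + r <= y -> 2 * n.+1%:R * (x - y) <= -1.
  move=> h; have : n.+1%:R * (x - y) <= n.+1%:R * (- r).
    by rewrite ler_wpM2l ?(ltW n0)// lerBlDr addrC lerBrDr.
  by rewrite mulrN nr -mulrA; lra.
have above x y : y <= x - r -> 1 <= 2 * n.+1%:R * (x - y).
  move=> h; have : n.+1%:R * r <= n.+1%:R * (x - y).
    by rewrite ler_wpM2l ?(ltW n0)// lerBrDr addrC -lerBrDr.
  by rewrite nr -mulrA; lra.
have supp : [set x | test_step n c d x != 0] `<=` `[l, u].
  move=> x /=; rewrite in_itv /=; apply: contraNT; rewrite negb_and -!ltNge => /orP[h|h].
    move: h; rewrite /l ltrBrDr lt_min => /andP[/ltW/below h1 /ltW/below h2].
    by rewrite /test_step /mollifier_step !smooth_step0 ?subrr.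
  move: h; rewrite /u -ltrBrDr gt_max => /andP[/ltW/above h1 /ltW/above h2].
  by rewrite /test_step /mollifier_step !smooth_step1 ?subrr.
have csupp : closure [set x | test_step n c d x != 0] `<=` `[l, u].
  have /closure_id E : closed `[l, u]%classic by exact: itv_closed.
  by rewrite [X in _ `<=` X]E; exact: closure_subset.
split.
- apply/nderivable_smooth => m; rewrite /test_step; apply: nderivableB.
    by rewrite mollifier_stepE; exact/nderivable_affine/smooth_step_nderivable.
  by rewrite mollifier_stepE; exact/nderivable_affine/smooth_step_nderivable.
- apply: (subclosed_compact _ (@segment_compact _ l u) csupp).
  exact: closed_closure.
- apply: (subset_trans csupp) => x /=; rewrite !in_itv /= => /andP[lx xu].
  have h1 : a < l by rewrite /l ltrBrDr lt_min ac ad.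
  have h2 : u < b by rewrite /u -ltrBrDr gt_max cb db.
  by rewrite (lt_le_trans h1 lx) (le_lt_trans xu h2).
Qed.

Lemma test_step_derivative n c d :
  derive1 (test_step n c d) = fun t => mollifier n c t - mollifier n d t.
Proof.
apply: has_derivativeE.
by apply: has_derivativeB; exact: mollifier_step_derivative.
Qed.

Definition mollify f n c : R := Int mu (fun t => f t * mollifier n c t).

Lemma mollifier_measurable n c : measurableR (mollifier n c).
Proof. by apply: continuous_measurable_fun; exact: mollifier_continuous. Qed.

Lemma itg_mollify f n c : itg mu f -> itg mu (fun t => f t * mollifier n c t).
Proof.
move=> If; have [M [M0 hM]] := mollifier_bounded.
have I1 := itg_bddM (mollifier_measurable n c) If (hM n c).
by apply: itg_ext I1 => t; rewrite mulrC.
Qed.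

(** Continuity lets equalities between mollified values pass from rational to real centres. *)
Lemma mollify_continuous f n : itg mu f -> continuous (mollify f n).
Proof.
move=> If c; have [M [M0 hM]] := mollifier_bounded.
have : {in `](c - 1), (c + 1)[%classic, continuous (mollify f n)}.
  apply: (@continuity_under_integral R _ _ mu (fun c t => f t * mollifier n c t) setT measurableT
    (c - 1) (c + 1) _ _ (fun t => `|f t| * (n.+1%:R * M))).
  - by move=> x _; exact: itg_mollify.
  - apply: nearW => t _ x _; apply: cvgM; first exact: cvg_cst.
    have E : (fun y => mollifier n y t) =
        (fun s => 2 * n.+1%:R * step_derivative s) \o (fun y => 2 * n.+1%:R * (t - y)).
      by apply/funext.
    have : {for x, continuous ((fun s => 2 * n.+1%:R * step_derivative s) \o
        (fun y => 2 * n.+1%:R * (t - y)))}.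
      apply: continuous_comp.
        apply: cvgM; first exact: cvg_cst.
        by apply: cvgB; [exact: cvg_cst|exact: cvg_id].
      by apply: cvgM; [exact: cvg_cst|exact: step_derivative_continuous].
    by rewrite -E.
  - by apply: itg_ext (itgZ (n.+1%:R * M) (itg_abs If)) => t; rewrite mulrC.
  - by move=> x _; apply: nearW => t _; rewrite normrM ler_wpM2l.
by apply; rewrite inE /= in_itv /=; apply/andP; split; lra.
Qed.

(** At a Lebesgue point c: the mollifier is at most (n+1) M and lives on the ball of radius 1/(n+1),
    so the error is at most 2 M times the mean deviation of f on that ball, whence the tolerance e /
    (2 M). *)
Lemma mollify_cvg f : itg mu f ->
  {ae mu, forall c, mollify f n c @[n --> \oo] --> f c}.
Proof.
move=> If; have [M [M0 hM]] := mollifier_bounded.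
apply: aeS (lebesgue_dev If) => c hc; apply/cvgrPdist_le => e e0.
have e'0 : 0 < e / (2 * M) by rewrite divr_gt0// mulr_gt0.
apply: filterS (hc _ e'0) => n hn.
have [I1 E1] := Int_mollifier n c.
have n0 : 0 < n.+1%:R :> R by rewrite ltr0n.
have r0 : 0 < n.+1%:R^-1 :> R by rewrite invr_gt0.
have Id := itg_ballcut_dev c r0 If.
have -> : f c - mollify f n c =
    Int mu (fun t => f c * mollifier n c t - f t * mollifier n c t).
  by rewrite (IntB (itgZ (f c) I1) (itg_mollify n c If)) IntZ// E1 mulr1.
apply: (@le_trans _ _ (n.+1%:R * M * Int mu (ballcut n.+1%:R^-1 c (fun s => `|f s - f c|)))).
  rewrite -IntZ//; apply: Int_abs_le; [|exact: itgZ|].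
    by apply: itgB; [exact: itgZ|exact: itg_mollify].
  move=> t; rewrite -mulrBl normrM /ballcut; case: ltP => ht.
    by rewrite mulrC distrC ler_wpM2r.
  by rewrite mollifier_out// normr0 !mulr0.
move: hn; rewrite -ler_pdivlMl ?invr_gt0 ?mulr_gt0// invrK => hn.
apply: (@le_trans _ _ (n.+1%:R * M * (2 * n.+1%:R^-1 * (e / (2 * M))))).
  by rewrite ler_wpM2l// mulr_ge0// ltW.
rewrite le_eqVlt; apply/orP; left; apply/eqP; field.
by rewrite !gt_eqF.
Qed.

Lemma const_on_rat (u : R -> R) a b : continuous u ->
  (forall p q : rat, a < ratr p -> ratr p < b -> a < ratr q -> ratr q < b ->
     u (ratr p) = u (ratr q)) ->
  forall c d, a < c -> c < b -> a < d -> d < b -> u c = u d.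
Proof.
move=> cu hu.
have approx c e : a < c -> c < b -> 0 < e -> exists p : rat,
    [/\ a < ratr p, ratr p < b & `|u c - u (ratr p)| < e].
  move=> ac cb e0.
  have : \forall y \near c, [/\ a < y, y < b & `|u c - u y| < e].
    near=> y; split; near: y; [exact: lt_nbhsr|exact: lt_nbhsl|].
    by move/cvgrPdist_lt: (cu c) => /(_ e e0).
  move=> [k /= k0 hk].
  have /rat_in_itvoo[p] : c - k < c + k by lra.
  rewrite in_itv /= => /andP[p1 p2]; exists p; apply: hk => /=.
  by rewrite ltr_distlC p1 p2.
move=> c d ac cb ad db; apply/eqP; rewrite -subr_eq0 -normr_eq0; apply/negPn/negP => h.
have e0 : 0 < `|u c - u d| / 2 by rewrite divr_gt0// lt_neqAle eq_sym h normr_ge0.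
have [p [p1 p2 p3]] := approx c _ ac cb e0.
have [q [q1 q2 q3]] := approx d _ ad db e0.
have := hu p q p1 p2 q1 q2 => E; rewrite -E in q3.
have : `|u c - u d| <= `|u c - u (ratr p)| + `|u d - u (ratr p)|.
  by rewrite -(distrC (u (ratr p)) (u d)) -(subrKA (u (ratr p))) ler_normD.
lra.
Unshelve. all: by end_near. Qed.

(** The hypothesis makes each mollification constant at the rational points of a shrunken interval,
    hence on all of it, and f is almost everywhere the limit of these constants. Rational centres
    keep the family of test functions countable, so that null sets depending on the test function
    can be united. *)
Lemma du_bois_reymond f a b : a < b -> itg mu f ->
  (forall (n : nat) (p q : rat), a + n.+1%:R^-1 < ratr p -> ratr p < b - n.+1%:R^-1 ->
     a + n.+1%:R^-1 < ratr q -> ratr q < b - n.+1%:R^-1 ->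
     Int mu (fun t => f t * derive1 (test_step n (ratr p) (ratr q)) t) = 0) ->
  exists m, {ae mu, forall t, a < t -> t < b -> f t = m}.
Proof.
move=> ab If h; pose z := (a + b) / 2.
have hz n c : a + n.+1%:R^-1 < c -> c < b - n.+1%:R^-1 ->
    n.+1%:R^-1 < (b - a) / 2 -> mollify f n c = mollify f n z.
  move=> ac cb nab.
  have mid (r : R) : r < (b - a) / 2 -> a + r < z /\ z < b - r by rewrite /z; lra.
  have [z1 z2] := mid _ nab.
  apply: (const_on_rat (mollify_continuous If) _ ac cb z1 z2).
  move=> p q p1 p2 q1 q2; apply/eqP; rewrite -subr_eq0; apply/eqP.
  rewrite -[RHS](h n p q p1 p2 q1 q2) /mollify -IntB; try exact: itg_mollify.
  by apply: Int_ext => t; rewrite test_step_derivative mulrBr.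
have ninv e : 0 < e -> \forall n \near \oo, n.+1%:R^-1 < e :> R.
  by move=> e0; exact: (near_infty_natSinv_lt (PosNum e0)).
(* [lim] is meaningful only for a convergent sequence; convergence follows at any good point c,
   because c and the midpoint z both lie in the shrunken interval for large n. *)
exists (lim ((mollify f ^~ z) n @[n --> \oo])).
apply: aeS (mollify_cvg If) => c hc ac cb.
suff E : mollify f n z @[n --> \oo] --> f c by rewrite (cvg_lim _ E).
apply: cvg_trans hc; apply: near_eq_cvg; near=> n.
have shift (r : R) : r < c - a -> r < b - c -> a + r < c /\ c < b - r by lra.
have [c1 c2] : a + n.+1%:R^-1 < c /\ c < b - n.+1%:R^-1.
  by apply: shift; near: n; apply: ninv; rewrite subr_gt0.
apply: hz => //.
by near: n; apply: ninv; rewrite divr_gt0// subr_gt0.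
Unshelve. all: by end_near. Qed.

End DuBoisReymond.

(** * Primitives of integrable functions and integration by parts *)

Section Primitives.
Context {R : realType}.
Notation mu := (@lebesgue_measure R).
Notation measurableR := (@measurable_fun _ _ (measurableTypeR R) R setT).
Implicit Types (f g u v : R -> R) (a b c d x t : R).

Lemma test_out a b phi x : test_function a b phi -> ~~ (a < x < b) -> phi x = 0.
Proof.
case=> _ _ sub; apply: contraNeq => phix.
have : `]a, b[%classic x by apply: sub; apply: subset_closure.
by rewrite /= in_itv.
Qed.

Lemma test_derive a b phi : test_function a b phi -> test_function a b (derive1 phi).
Proof.
move=> [sm cp sub].
have sub' : closure [set x | derive1 phi x != 0] `<=` closure [set x | phi x != 0].
  have /closure_id E : closed (closure [set x | phi x != 0]) by exact: closed_closure.
  rewrite [X in _ `<=` X]E; apply: closure_subset => x /=; apply: contraNP => ncl.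
  have near0 : \forall y \near x, phi y = 0.
    have : nbhs x (~` closure [set x | phi x != 0]).
      by apply: open_nbhs_nbhs; split=> //; exact/closed_openC/closed_closure.
    apply: filterS => y /= ny; apply/eqP/negPn/negP => phiy.
    by apply: ny; apply: subset_closure.
  by rewrite derive1E (@near_eq_derive _ _ _ _ (cst 0))// derive_cst.
split; last exact: subset_trans sub.
  by move=> n x; rewrite -derive1Sn; exact: sm.
apply: (subclosed_compact _ cp sub').
exact: closed_closure.
Qed.

Lemma test_has_derivative a b phi : test_function a b phi ->
  has_derivative phi (derive1 phi) /\ continuous (derive1 phi).
Proof.
move=> tphi; have D psi : test_function a b psi -> has_derivative psi (derive1 psi).
  by move=> [sm _ _] x; rewrite derive1E; apply: derivableP; exact: (sm 0%N).
split; first exact: D.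
exact/has_derivative_continuous/D/test_derive.
Qed.

Lemma prim_low f a x : (forall y, y <= a -> f y = 0) -> x <= a -> prim f x = 0.
Proof.
move=> f0 xa; rewrite -[RHS](Int0 mu); apply: Int_ext => y.
by case: ifP => // yx; rewrite f0// (le_trans yx).
Qed.

Lemma prim_high f b x : (forall y, b <= y -> f y = 0) -> b <= x -> prim f x = Int mu f.
Proof.
move=> f0 bx; apply: Int_ext => y; case: leP => // /ltW xy.
by rewrite f0// (le_trans bx).
Qed.

Lemma prim_FTC F f a x : has_derivative F f -> continuous f ->
  (forall y, y <= a -> F y = 0) -> (forall y, y <= a -> f y = 0) -> prim f x = F x.
Proof.
move=> D cf F0 f0; case: (leP x a) => [xa|ax].
  by rewrite (prim_low f0 xa) F0.
have [_ E] := FTC_everywhere ax D cf.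
rewrite -[RHS]subr0 -[X in _ - X](F0 a (lexx a)) -E; apply: Int_ext => y.
rewrite patchE mem_setE in_itv /=; case: (leP a y) => [ay|/ltW ya] /=; first by [].
by rewrite f0//; case: ifP.
Qed.

Lemma itg_continuous_supp f a b : continuous f -> (forall x, ~~ (a < x < b) -> f x = 0) ->
  itg mu f.
Proof.
move=> cf f0; have If : mu.-integrable `[a, b] (EFin \o f).
  apply: continuous_compact_integrable; first exact: segment_compact.
  by apply: continuous_subspaceT => x; exact: cf.
have mab : measurable (`[a, b]%classic : set (measurableTypeR R)) by [].
have : itg mu (f \_ `[a, b]).
  by rewrite /itg -restrict_EFin; exact/(integrable_mkcond _ mab).
apply: itg_ext => x; rewrite patchE mem_setE in_itv /=; case: ifPn => // h.
by rewrite f0//; apply: contra h => /andP[/ltW -> /ltW ->].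
Qed.

(** phi is the primitive of its derivative and vanishes at b, so [prim_mul] at b leaves no boundary
    term. *)
Lemma test_ibp a b phi g : test_function a b phi -> itg mu g ->
  [/\ itg mu (fun t => prim g t * derive1 phi t), itg mu (fun t => g t * phi t) &
  Int mu (fun t => prim g t * derive1 phi t) = - Int mu (fun t => g t * phi t)].
Proof.
move=> tphi Ig; have [D cD] := test_has_derivative tphi.
have out x := @test_out a b phi x tphi.
have out' x := @test_out a b _ x (test_derive tphi).
have I' : itg mu (derive1 phi) by exact: itg_continuous_supp cD out'.
have nl y : y <= a -> ~~ (a < y < b) by move=> ya; rewrite ltNge ya.
have nh y : b <= y -> ~~ (a < y < b) by move=> yb; rewrite [y < b]ltNge yb andbF.
have P y : prim (derive1 phi) y = phi y.
  by apply: (prim_FTC _ D cD (a := a)) => z /nl; [exact: out|exact: out'].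
have Igp : itg mu (fun t => g t * phi t).
  apply: (@itg_ext _ (measurableTypeR R) _ _ (fun t => phi t * g t)); first by move=> t; rewrite mulrC.
  apply: (itg_bddM _ Ig (C := Int mu (fun y => `|derive1 phi y|))).
    by apply: continuous_measurable_fun; exact: has_derivative_continuous D.
  by move=> t; rewrite -P; exact: prim_le.
have Ipg : itg mu (fun t => prim g t * derive1 phi t).
  by apply: (itg_bddM (prim_measurable Ig) I') => t; exact: prim_le.
split=> //.
have [I E] := prim_mul b Ig I'.
move: E; rewrite P out ?nh// mulr0 => E; apply/eqP.
rewrite -addr_eq0 addrC -IntD// E; apply/eqP.
rewrite (@prim_high _ b)//; first by apply: Int_ext => t; rewrite P.
by move=> y by_; rewrite P out ?nh// out' ?nh// !mulr0 addr0.
Qed.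

(** The difference of u and a primitive of u1 has zero weak derivative, hence is constant by
    [du_bois_reymond]. *)
Lemma weak_primitive a b u u1 : a < b -> itg mu u -> itg mu u1 ->
  (forall (n : nat) (p q : rat), test_function a b (test_step n (ratr p) (ratr q)) ->
     Int mu (fun t => u t * derive1 (test_step n (ratr p) (ratr q)) t) =
     - Int mu (fun t => u1 t * test_step n (ratr p) (ratr q) t)) ->
  exists m, {ae mu, forall t, a < t -> t < b -> u t = m + prim u1 t}.
Proof.
move=> ab Iu Iu1 h.
(* The primitive is cut off outside ]a, b[ because it may tend to a nonzero constant at infinity and
   then is not integrable. *)
pose f t := u t - (if a < t < b then prim u1 t else 0).
have Ip : itg mu (fun t => if a < t < b then prim u1 t else 0).
  apply: (@itg_le _ (measurableTypeR R) _ _ _ (fun t => Int mu (fun y => `|u1 y|) * \1_(`]a, b[%classic) t)).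
  - apply: measurable_fun_ifT => //; last exact: prim_measurable.
    by apply: measurable_and; apply: measurable_fun_ltr.
  - apply: itgZ; apply/integrableP; split; first exact/measurable_EFinP/measurable_indic.
    under eq_integral do rewrite /= ger0_norm//.
    have mE : mu `]a, b[ = (b - a)%:E by rewrite lebesgue_measure_itv /= lte_fin ab.
    rewrite integral_indic// setIT; apply: le_lt_trans (ltry (b - a)).
    by rewrite -mE.
  - move=> t; rewrite indicE mem_setE in_itv /=; case: ifP => _; last by rewrite mulr0 normr0.
    by rewrite mulr1; exact: prim_le.
have [||m hm] := @du_bois_reymond R f a b ab; first exact: itgB.
  move=> n p q ap pb aq qb.
  have tphi := test_step_test ap pb aq qb.
  set phi := test_step n _ _ in tphi *.
  have [D cD] := test_has_derivative tphi.
  have [I1 I2 E] := test_ibp tphi Iu1.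
  have out' x := @test_out a b _ x (test_derive tphi).
  have [M [_ hM]] := @continuous_bounded R _ a b cD.
  have Iup : itg mu (fun t => u t * derive1 phi t).
    apply: (@itg_ext _ (measurableTypeR R) _ _ (fun t => derive1 phi t * u t)); first by move=> t; rewrite mulrC.
    apply: (itg_bddM _ Iu (C := `|M|)); first exact: continuous_measurable_fun.
    move=> t; case: (boolP (a < t < b)) => tab; last by rewrite out'// normr0.
    by rewrite (le_trans (hM t _)) ?ler_norm//; case/andP: tab => /ltW -> /ltW ->.
  rewrite (_ : (fun t => _) = fun t => u t * derive1 phi t - prim u1 t * derive1 phi t).
    by rewrite IntB// E h// subrr.
  apply/funext => t; rewrite /f mulrBl; congr (_ - _).
  by case: ifPn => // /out' ->; rewrite !mulr0.
exists m; apply: aeS hm => t ht a_t tb.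
by have := ht a_t tb; rewrite /f a_t tb /=; lra.
Qed.

(** A nonzero value persists on a neighbourhood in [a, b], which contains an open interval of
    positive measure even if c is an endpoint. *)
Lemma within_continuous_ae0 a b f : a < b -> {within `[a, b], continuous f} ->
  {ae mu, forall x, a < x -> x < b -> f x = 0} -> forall c, a <= c <= b -> f c = 0.
Proof.
move=> ab cf [N [mN N0 hN]] c /andP[ac cb]; apply/eqP/negPn/negP => fc.
have cab : `[a, b]%classic c by rewrite /= in_itv /= ac cb.
have : \forall x \near c, x \in `[a, b] -> f x != 0.
  have /subspace_continuousP /(_ c cab) := cf.
  move/cvgrPdist_lt => /(_ `|f c|); rewrite normr_gt0 => /(_ fc).
  rewrite near_withinE; apply: filterS => x hx xab.
  have {}hx : `|f c - f x| < `|f c| by exact: hx.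
  by apply: contraTN hx => /eqP ->; rewrite subr0 ltxx.
move=> [k /= k0 hk].
pose l := Num.max a (c - k); pose r := Num.min b (c + k).
have lr : l < r by rewrite /l /r gt_max !lt_min ab /=; apply/andP; split; [|apply/andP; split]; lra.
have sub : `]l, r[%classic `<=` N.
  move=> x /=; rewrite in_itv /= /l /r gt_max lt_min => /andP[/andP[ax cx] /andP[xb xc]].
  apply: hN => /= h; have := hk x; rewrite /= ltr_distlC cx xc => /(_ isT).
  by rewrite in_itv /= (ltW ax) (ltW xb) h// eqxx => /(_ isT).
have : (mu `]l, r[ <= mu N)%E by apply: le_measure; rewrite ?inE.
by rewrite N0 lebesgue_measure_itv /= lte_fin lr -EFinB lee_fin; lra.
Qed.

(* Functions of H^1(a, b) with zero traces, extended by 0 to the line: [u] is any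
   representative and [prim f] the continuous one. *)
Definition vanishing_primitive a b u f :=
  [/\ measurableR u /\ itg mu f,
      forall x, ~~ (a < x < b) -> u x = 0 /\ f x = 0,
      prim f b = 0 & {ae mu, forall x, u x = prim f x}].

Lemma vanishing_out a b u f x : vanishing_primitive a b u f -> ~~ (a < x < b) ->
  prim f x = 0.
Proof.
move=> [_ out fb _]; rewrite negb_and -!leNgt => /orP[xa|bx].
  by rewrite (@prim_low _ a)// => y ya; apply: (out y _).2; rewrite ltNge ya.
have out' y : b <= y -> f y = 0.
  by move=> yb; apply: (out y _).2; rewrite [y < b]ltNge yb andbF.
by rewrite (prim_high out' bx) -(prim_high out' (lexx b)).
Qed.

Lemma prim_ae f g x : itg mu f -> measurableR g -> {ae mu, forall y, f y = g y} ->
  prim f x = prim g x.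
Proof.
move=> If mg fg; apply: (Int_ae _ _ _).2; first exact: itg_cut.
  by apply: measurable_le_if.
by apply: aeS fg => y ->.
Qed.

(** The product rule is [prim_mul] for f and c' restricted to [a, b]. The primitive of the latter is
    c - c a on ]a, b], which explains the correction by c a times f. The computation is done with
    the continuous representative [prim f] and transferred to u almost everywhere. *)
Lemma vanishing_mul a b u f (c c' : R -> R) : a < b -> has_derivative c c' -> continuous c' ->
  vanishing_primitive a b u f ->
  vanishing_primitive a b (fun x => c x * u x) (fun x => c' x * u x + c x * f x).
Proof.
move=> ab D cc' V; have [[mu_ If] out fb upf] := V.
have cc := has_derivative_continuous D.
have [I1 E1] := FTC_everywhere ab D cc'.
set g := c' \_ `[a, b] in I1.
have mc : measurableR c by exact: continuous_measurable_fun.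
have mc' : measurableR c' by exact: continuous_measurable_fun.
have pg x : a < x -> x <= b -> prim g x = c x - c a.
  move=> ax xb; have [_ <-] := FTC_everywhere ax D cc'.
  apply: Int_ext => y; rewrite /g !patchE !mem_setE !in_itv /=.
  case: (leP y x) => yx; last by rewrite andbF.
  by rewrite (le_trans yx xb).
have bdd (h : R -> R) : continuous h -> measurableR h -> forall k : R -> R, itg mu k ->
    (forall x, ~~ (a < x < b) -> k x = 0) -> itg mu (fun x => h x * k x).
  move=> ch mh k Ik k0; have [M [M0 hM]] := @continuous_bounded R _ a b ch.
  apply: (itg_le _ (itgZ M (itg_abs Ik))).
    by apply: measurable_funM => //; exact: itg_measurable Ik.
  move=> x; rewrite normrM; case: (boolP (a < x < b)) => xab.
    by rewrite ler_wpM2r// hM//; case/andP: xab => /ltW -> /ltW ->.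
  by rewrite k0// normr0 !mulr0.
have Icf : itg mu (fun x => c x * f x) by apply: bdd => // x /out[].
pose h x := c' x * prim f x + c x * f x.
have Ipf : itg mu (fun x => c' x * prim f x).
  apply: (@itg_ext _ (measurableTypeR R) _ _ (fun x => prim f x * g x)).
    move=> x; rewrite /g patchE mem_setE in_itv /=; case: ifPn => [_|xab]; first by rewrite mulrC.
    rewrite (vanishing_out V) ?mulr0 ?mul0r//.
    by apply: contra xab => /andP[/ltW -> /ltW ->].
  by apply: (itg_bddM (prim_measurable If) I1) => x; exact: prim_le.
have Ih : itg mu h by exact: itgD.
have h_out y : ~~ (a < y < b) -> h y = 0.
  by move=> yab; rewrite /h (vanishing_out V yab) (out y yab).2 !mulr0 addr0.
have main y : a < y -> y <= b -> prim h y = c y * prim f y.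
  move=> ay yb; have [_] := prim_mul y If I1; rewrite pg//.
  rewrite (_ : (fun z => _) = fun z => h z + (- c a) * f z).
    rewrite primD//; last exact: itgZ.
    by rewrite primZ//; lra.
  apply/funext => z; case: (boolP (a < z < b)) => zab; last first.
    by rewrite (vanishing_out V zab) (out z zab).2 h_out//; ring.
  have [az zb] := andP zab; rewrite pg ?ltW// /h /g patchE mem_setE in_itv /=.
  by rewrite (ltW az) (ltW zb) /=; ring.
have ph x : prim h x = c x * prim f x.
  case: (leP x a) => [xa|ax].
    rewrite (prim_low _ xa) ?(prim_low _ xa) ?mulr0// => y ya; last first.
      by apply: h_out; rewrite ltNge ya.
    by apply: (out y _).2; rewrite ltNge ya.
  case: (leP x b) => [xb|/ltW bx]; first exact: main.
  have hb y : b <= y -> h y = 0 by move=> yb; apply: h_out; rewrite [y < b]ltNge yb andbF.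
  rewrite (vanishing_out V) ?mulr0; last by rewrite [x < b]ltNge bx andbF.
  by rewrite (prim_high hb bx) -(prim_high hb (lexx b)) main// fb mulr0.
have hE : {ae mu, forall x, h x = c' x * u x + c x * f x}.
  by apply: aeS upf => x ->.
have mfin : measurableR (fun x => c' x * u x + c x * f x).
  apply: measurable_funD; apply: measurable_funM => //.
  exact: itg_measurable If.
have [Ifin _] := Int_ae Ih mfin hE.
split.
- by split=> //; exact: measurable_funM.
- by move=> x /out[-> ->]; rewrite !mulr0 addr0.
- by rewrite -(prim_ae _ Ih mfin hE) ph fb mulr0.
- by apply: aeS upf => x ux; rewrite -(prim_ae _ Ih mfin hE) ph ux.
Qed.

Lemma vanishing_add a b u f v g : vanishing_primitive a b u f ->
  vanishing_primitive a b v g ->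
  vanishing_primitive a b (fun x => u x + v x) (fun x => f x + g x).
Proof.
move=> [[mu_ If] outf fb uf] [[mv Ig] outg gb vg]; split.
- by split; [exact: measurable_funD|exact: itgD].
- by move=> x xab; have [-> ->] := outf x xab; have [-> ->] := outg x xab; rewrite !addr0.
- by rewrite primD// fb gb addr0.
- by apply: aeS2 uf vg => x -> ->; rewrite primD.
Qed.

(** This is [prim_mul] at b, where the primitives vanish. *)
Lemma vanishing_ibp a b u f v g : vanishing_primitive a b u f ->
  vanishing_primitive a b v g ->
  itg mu (fun x => f x * v x + u x * g x) /\ Int mu (fun x => f x * v x + u x * g x) = 0.
Proof.
move=> [[mu_ If] outf fb uf] [[mv Ig] outg gb vg].
have [I E] := prim_mul b If Ig.
have mF : measurableR (fun x => f x * v x + u x * g x).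
  apply: measurable_funD; apply: measurable_funM => //.
    exact: (itg_measurable If).
  exact: (itg_measurable Ig).
have ae : {ae mu, forall x, f x * prim g x + prim f x * g x = f x * v x + u x * g x}.
  by apply: aeS2 uf vg => x -> ->.
have [I1 E1] := Int_ae I mF ae; split=> //; rewrite -E1.
move: E; rewrite fb mul0r => ->; apply/esym/prim_high => // y yb.
have /outf[_ ->] : ~~ (a < y < b) by rewrite [y < b]ltNge yb andbF.
have /outg[_ ->] : ~~ (a < y < b) by rewrite [y < b]ltNge yb andbF.
by rewrite mul0r mulr0 addr0.
Qed.

End Primitives.

(** * Representatives of the elements of the function spaces *)

Section Representatives.
Context {R : realType}.
Notation mu := (@lebesgue_measure R).
Notation R2 := (measurableTypeR R * measurableTypeR R)%type.
Notation measurableR := (@measurable_fun _ _ (measurableTypeR R) R setT).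
Notation M := (mu \x mu)%E.
Implicit Types (a b t x T L : R).

Lemma itv_measurable a b : measurable (`]a, b[%classic : set (measurableTypeR R)).
Proof. by []. Qed.

Lemma itv_finite a b : (mu `]a, b[%classic < +oo)%E.
Proof. by rewrite lebesgue_measure_itv /=; case: ifP => _; rewrite -?EFinB ltry. Qed.

Lemma restrict_mul a b (u v : R -> R) :
  (fun x => u x * v x) \_ `]a, b[ = fun x => (u \_ `]a, b[) x * v x.
Proof.
by apply/funext => x; rewrite !patchE; case: ifP => //; rewrite mul0r.
Qed.

Lemma restrict_out a b (u : R -> R) x : ~~ (a < x < b) -> (u \_ `]a, b[) x = 0.
Proof. by rewrite patchE mem_setE in_itv /= => /negbTE ->. Qed.

Lemma restrict_in a b (u : R -> R) x : a < x < b -> (u \_ `]a, b[) x = u x.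
Proof. by rewrite patchE mem_setE in_itv /= => ->. Qed.

Lemma L2_restrict a b (u : R -> R) : in_L2 a b u -> L2 mu (u \_ `]a, b[).
Proof.
move=> [mu_ uoo]; have mU : measurableR (u \_ `]a, b[).
  exact/(measurable_restrictT u (itv_measurable a b)).
apply: L2_finite => //; move: uoo; rewrite [X in (X < _)%E -> _]integral_mkcond.
suff -> : (fun x => (`|u x| ^+ 2)%:E) \_ `]a, b[ =
  fun x => (`|(u \_ `]a, b[) x| ^+ 2)%:E by [].
apply/funext => x.
by rewrite !patchE; case: ifP => // _; rewrite normr0 expr0n.
Qed.

Lemma L2_itg_itv a b (u : R -> R) : L2 mu u -> (forall x, ~~ (a < x < b) -> u x = 0) ->
  itg mu u.
Proof.
move=> Lu u0; apply: (L2_itg (itv_measurable a b) (itv_finite a b) Lu) => x xab.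
by apply: u0; apply/negP => h; apply: xab; rewrite /= in_itv.
Qed.

(** The weak derivative gives u = m + prim u1 almost everywhere, a continuous representative whose
    end values are the traces: the trace at a forces m = 0, and the one at b makes the primitive
    vanish at b. *)
Lemma space_vanishing a b (u u1 : R -> R) : a < b -> in_L2 a b u -> in_L2 a b u1 ->
  weak_derive a b 1 u u1 -> has_trace a b u a 0 -> has_trace a b u b 0 ->
  vanishing_primitive a b (u \_ `]a, b[) (u1 \_ `]a, b[).
Proof.
move=> ab /L2_restrict L0 /L2_restrict L1 W ta tb.
set U := (u \_ `]a, b[) in L0 *.
set U1 := (u1 \_ `]a, b[) in L1 *.
have IU : itg mu U by apply: L2_itg_itv L0 _ => x; exact: restrict_out.
have IU1 : itg mu U1 by apply: L2_itg_itv L1 _ => x; exact: restrict_out.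
have [|m hm] := weak_primitive ab IU IU1.
  move=> n p q tphi; have := W _ tphi.
  rewrite [LHS]Rintegral_mkcond [in RHS]Rintegral_mkcond !restrict_mul.
  by rewrite expr1 mulN1r derive1n1.
have trace c : a <= c <= b -> has_trace a b u c 0 -> m + prim U1 c = 0.
  move=> cab [w [cw wu wc0]].
  pose D x := w x - (m + prim U1 x).
  have cD : {within `[a, b], continuous D}.
    move=> x; apply: cvgB; first exact: cw.
    apply: cvgD; first exact: cvg_cst.
    by apply: (continuous_subspaceT (f := prim U1)) => y; exact: prim_continuous.
  have D0 : {ae mu, forall x, a < x -> x < b -> D x = 0}.
    apply: aeS2 hm wu => x hx wx ax xb.
    have xab : x \in `]a, b[ by rewrite in_itv /= ax xb.
    by rewrite /D (wx xab) -(hx ax xb) /U restrict_in ?ax// subrr.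
  have := within_continuous_ae0 ab cD D0 cab.
  by rewrite /D wc0 sub0r => /eqP; rewrite oppr_eq0 => /eqP.
have out1 y : ~~ (a < y < b) -> U1 y = 0 by exact: restrict_out.
have pa : prim U1 a = 0.
  by apply: (prim_low _ (lexx a)) => y ya; apply: out1; rewrite ltNge ya.
have m0 : m = 0.
  by have := trace a; rewrite lexx (ltW ab) pa addr0 => /(_ isT ta).
have pb : prim U1 b = 0.
  by have := trace b; rewrite lexx (ltW ab) m0 add0r => /(_ isT tb).
split=> //.
- by split=> //; case: L0.
- by move=> x xab; rewrite /U /U1 !restrict_out.
apply: aeS hm => x hx; case: (boolP (a < x < b)) => xab.
  by have [ax xb] := andP xab; rewrite hx// m0 add0r.
rewrite [LHS]restrict_out//; move: xab; rewrite negb_and -!leNgt => /orP[xa|bx].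
  by rewrite (prim_low _ xa)// => y ya; apply: out1; rewrite ltNge ya.
have hb y : b <= y -> U1 y = 0 by move=> yb; apply: out1; rewrite [y < b]ltNge yb andbF.
by rewrite (prim_high hb bx) -(prim_high hb (lexx b)).
Qed.

(** [in_H3] relates every derivative to u itself; testing order k against phi' and order k + 1
    against phi links consecutive derivatives. *)
Lemma weak_derive_succ a b k (u uk uk1 : R -> R) : weak_derive a b k u uk ->
  weak_derive a b k.+1 u uk1 -> weak_derive a b 1 uk uk1.
Proof.
move=> Wk Wk1 phi tphi; have := Wk1 phi tphi; rewrite derive1Sn.
rewrite (Wk _ (test_derive tphi)) exprSr -mulrA => /(mulfI _); rewrite derive1n1.
by rewrite expr1 => -> //; rewrite expf_neq0// oppr_eq0 oner_eq0.
Qed.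

Definition extend T L (q : R -> R -> R) : R2 -> R :=
  (fun z => q z.1 z.2) \_ (`]0, T[ `*` `](- L), L[).

Lemma extendE T L q t x : extend T L q (t, x) =
  if 0 < t < T then (q t \_ `](- L), L[) x else 0.
Proof.
rewrite /extend patchE patchE mem_setE in_itv /=.
have -> : ((t, x) \in (`]0, T[ `*` `](- L), L[)%classic) = (0 < t < T) && (- L < x < L).
  by apply/idP/idP; rewrite inE /= !in_itv /= => /andP.
by case: (0 < t < T).
Qed.

Lemma extend_in T L q t x : 0 < t < T -> - L < x < L -> extend T L q (t, x) = q t x.
Proof. by rewrite extendE => -> xL; rewrite restrict_in. Qed.

Lemma extend_out1 T L q t x : ~~ (0 < t < T) -> extend T L q (t, x) = 0.
Proof. by rewrite extendE => /negbTE ->. Qed.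

Lemma extend_out2 T L q t x : ~~ (- L < x < L) -> extend T L q (t, x) = 0.
Proof. by move=> h; rewrite extendE restrict_out//; case: ifP. Qed.

Lemma domain_measurable T L : measurable (`]0, T[ `*` `](- L), L[ : set R2).
Proof. by apply: measurableX. Qed.

Lemma integral_domain T L (f : R2 -> \bar R) : measurable_fun setT f ->
  (forall z, 0 <= f z)%E -> (forall z, ~ (`]0, T[ `*` `](- L), L[)%classic z -> f z = 0%E) ->
  (\int[mu]_(t in `]0%R, T[) \int[mu]_(x in `](- L)%R, L[) f (t, x) =
   \int[M]_z f z)%E.
Proof.
move=> mf f0 fout; rewrite fubini_tonelli1//= [LHS]integral_mkcond.
apply: eq_integral => t _; rewrite patchE /fubini_F; case: ifPn => [tT|tT].
  rewrite [LHS]integral_mkcond; apply: eq_integral => x _; rewrite patchE.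
  case: ifPn => // xL; rewrite fout// => -[/= _ h].
  by move/negP: xL; apply; rewrite inE.
rewrite integral0_eq// => x _; rewrite fout// => -[/= h _].
by move/negP: tT; apply; rewrite inE.
Qed.

Lemma L2_extend T L q : in_L2L2 T L q -> L2 M (extend T L q).
Proof.
move=> [mq qoo]; have mQ : measurable_fun setT (extend T L q).
  exact/(measurable_restrictT _ (domain_measurable T L)).
apply: L2_finite => //.
rewrite -(@integral_domain T L (fun z => (`|extend T L q z| ^+ 2)%:E)).
- move: qoo; apply: le_lt_trans; rewrite le_eqVlt; apply/orP; left; apply/eqP.
  apply: eq_integral => t; rewrite inE /= in_itv /= => tT.
  apply: eq_integral => x; rewrite inE /= in_itv /= => xL.
  by rewrite extend_in.
- by apply/measurable_EFinP; apply: measurable_funX; apply: measurableT_comp.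
- by move=> z; rewrite lee_fin sqr_ge0.
- move=> z zout; rewrite /extend patchE ifF ?normr0 ?expr0n//.
  by apply/negbTE/negP; rewrite inE.
Qed.

Lemma L2_section2 (f : R2 -> R) : L2 M f -> {ae mu, forall x, L2 mu (fun t => f (t, x))}.
Proof.
move=> [mf If]; apply: aeS (itg_pair_snd If) => x hx; split=> //.
exact: (measurable_fun_pair1 x mf).
Qed.

(** The null set in [in_H1L2] depends on the test function. The test steps with rational centres are
    countable, so one null set serves them all. *)
Lemma time_primitive T L (q qt : R -> R -> R) : 0 < T -> in_H1L2 T L q qt ->
  {ae mu, forall x, exists m, {ae mu, forall t, 0 < t -> t < T ->
    extend T L q (t, x) = m + prim (fun s => extend T L qt (s, x)) t}}.
Proof.
move=> T0 [/L2_extend Lq /L2_extend Lqt hw].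
pose phi n (p r : rat) : R -> R := test_step n (ratr p) (ratr r).
(* [P k] is the identity for the test step with code k, and [True] when k codes no triple. *)
pose P (k : nat) x := if unpickle k is Some (n, p, r) then
  test_function 0 T (phi n p r) -> x \in `](- L), L[ ->
  \int[mu]_(t in `]0, T[) (derive1n 1 (phi n p r) t * q t x) =
     - \int[mu]_(t in `]0, T[) (phi n p r t * qt t x) else True.
have aeP : {ae mu, forall x, forall k, P k x}.
  apply: ae_foralln => k; rewrite /P.
  case: (unpickle k) => [[[n p] r]|]; last by apply: nearW.
  have [tphi|ntphi] := pselect (test_function 0 T (phi n p r)).
    by apply: aeS (hw _ tphi) => x hx _.
  by apply: nearW => x /ntphi.
have aeL : {ae mu, forall x, L2 mu (fun t => extend T L q (t, x)) /\
    L2 mu (fun t => extend T L qt (t, x))}.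
  by apply: aeS2 (L2_section2 Lq) (L2_section2 Lqt).
apply: aeS2 aeP aeL => x hP [L0 L1].
have I0 : itg mu (fun t => extend T L q (t, x)).
  by apply: L2_itg_itv L0 _ => t; exact: extend_out1.
have I1 : itg mu (fun t => extend T L qt (t, x)).
  by apply: L2_itg_itv L1 _ => t; exact: extend_out1.
apply: (weak_primitive T0 I0 I1) => n p r tphi.
case: (boolP (- L < x < L)) => xL; last first.
  rewrite (_ : (fun t => _) = fun=> 0); last first.
    by apply/funext => t; rewrite extend_out2// mul0r.
  rewrite (_ : (fun t => extend T L qt (t, x) * _) = fun=> 0); last first.
    by apply/funext => t; rewrite extend_out2// mul0r.
  by rewrite Int0 oppr0.
have := hP (pickle (n, p, r)); rewrite /P pickleK => /(_ tphi).
rewrite in_itv /= xL => /(_ isT) E.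
rewrite [LHS]Rintegral_mkcond [in RHS]Rintegral_mkcond in E.
transitivity (Int mu ((fun t => derive1 (phi n p r) t * q t x) \_ `]0, T[)).
  apply: Int_ext => t; rewrite extendE !patchE !mem_setE !in_itv /= xL.
  by case: ifP => _; rewrite ?mul0r// mulrC.
rewrite [LHS]E; congr (- _); apply: Int_ext => t.
rewrite extendE !patchE !mem_setE !in_itv /= xL.
by case: ifP => _; rewrite ?mul0r// mulrC.
Qed.

(** q need not vanish at t = 0 and t = T. Multiplied by a factor rho that does, m + prim f becomes a
    vanishing primitive, to whose density the constant m contributes m rho'. *)
Lemma time_vanishing T (rho rho' u f : R -> R) m : 0 < T ->
  has_derivative rho rho' -> continuous rho' ->
  (forall t, ~~ (0 < t < T) -> rho t = 0 /\ rho' t = 0) ->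
  measurableR u -> itg mu f -> (forall t, ~~ (0 < t < T) -> u t = 0 /\ f t = 0) ->
  {ae mu, forall t, 0 < t -> t < T -> u t = m + prim f t} ->
  vanishing_primitive 0 T (fun t => rho t * u t) (fun t => rho' t * u t + rho t * f t).
Proof.
move=> T0 D crho' out mu_ If outf hu.
have nl y : y <= 0 -> ~~ (0 < y < T) by move=> y0; rewrite ltNge y0.
have Prho t : prim rho' t = rho t.
  by apply: (prim_FTC (a := 0) _ D crho') => y /nl/out[].
have Irho' : itg mu rho' by apply: (itg_continuous_supp (a := 0) (b := T) crho') => t /out[].
have mrho : measurableR rho.
  by apply: continuous_measurable_fun; exact: has_derivative_continuous D.
have mrho' : measurableR rho' by exact: continuous_measurable_fun.
pose h t := m * rho' t + (rho' t * prim f t + rho t * f t).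
have [I2 _] := prim_mul 0 Irho' If.
have I3 : itg mu (fun t => rho' t * prim f t + rho t * f t).
  by apply: itg_ext I2 => t; rewrite Prho.
have Ih : itg mu h by apply: itgD => //; exact: itgZ.
have Ph t : prim h t = rho t * (m + prim f t).
  rewrite /h primD//; last exact: itgZ.
  rewrite primZ// Prho.
  have [_] := prim_mul t Irho' If; rewrite Prho => E.
  rewrite mulrDr [rho t * m]mulrC E; congr (_ + _).
  by apply: Int_ext => y; rewrite Prho.
have mfin : measurableR (fun t => rho' t * u t + rho t * f t).
  apply: measurable_funD; apply: measurable_funM => //.
  exact: itg_measurable If.
have hE : {ae mu, forall t, h t = rho' t * u t + rho t * f t}.
  apply: aeS hu => t ht; case: (boolP (0 < t < T)) => tT.
    by have [t0 t1] := andP tT; rewrite (ht t0 t1) /h; ring.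
  by have [r0 r1] := out t tT; rewrite /h r0 r1; ring.
have [Ifin _] := Int_ae Ih mfin hE.
split.
- by split=> //; exact: measurable_funM.
- by move=> t /out[-> ->]; rewrite !mul0r addr0.
- rewrite -(prim_ae _ Ih mfin hE) Ph.
  have [-> _] : rho T = 0 /\ rho' T = 0 by apply: out; rewrite ltxx andbF.
  by rewrite mul0r.
- apply: aeS hu => t ht; rewrite -(prim_ae _ Ih mfin hE) Ph.
  case: (boolP (0 < t < T)) => tT.
    by have [t0 t1] := andP tT; rewrite ht.
  by have [-> _] := out t tT; rewrite !mul0r.
Qed.

End Representatives.

(** * Integration by parts in time *)

Section TimeSymmetry.
Context {R : realType}.
Notation mu := (@lebesgue_measure R).
Notation R2 := (measurableTypeR R * measurableTypeR R)%type.
Notation measurableR := (@measurable_fun _ _ (measurableTypeR R) R setT).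
Notation M := (mu \x mu)%E.
Implicit Types (v f g z k h : R2 -> R).

Definition tshift (s : R) v : R2 -> R := fun w => v (w.1 + s, w.2).

Lemma L2_tshift s v : L2 M v -> L2 M (tshift s v).
Proof.
move=> [mv Iv]; have [I2 _] := itg_shift_pair s Iv; split=> //.
apply: (measurableT_comp mv); apply/measurable_fun_pairP; split => /=; last exact: measurable_snd.
by apply: (measurableT_comp (measurable_shift s)); exact: measurable_fst.
Qed.

(** For almost every x the symmetric difference quotient of v in time is an average of f, and
    [Int_average_cvg] gives the limit of the inner integral. Averaging does not increase the L2 norm
    in time, so the time integrals of g^2 and f^2 provide a dominating function of x. *)
Lemma tshift_average T v f g : L2 M v -> L2 M f -> L2 M g ->
  {ae mu, forall x, vanishing_primitive 0 T (fun t => v (t, x)) (fun t => f (t, x))} ->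
  (2 * n.+1%:R^-1)^-1 * (Int M (fun w => g w * tshift n.+1%:R^-1 v w) -
    Int M (fun w => g w * tshift (- n.+1%:R^-1) v w)) @[n --> \oo] -->
  Int M (fun w => g w * f w).
Proof.
move=> Lv Lf Lg Hv.
pose b n x := (2 * n.+1%:R^-1)^-1 *
  (Int mu (fun t => g (t, x) * v (t + n.+1%:R^-1, x)) -
   Int mu (fun t => g (t, x) * v (t - n.+1%:R^-1, x))).
have P1 n := Int_pair_snd (L2M Lg (L2_tshift n.+1%:R^-1 Lv)).
have P2 n := Int_pair_snd (L2M Lg (L2_tshift (- n.+1%:R^-1) Lv)).
have Ib n : itg mu (b n) by apply: itgZ; apply: itgB; [have [] := P1 n|have [] := P2 n].
have -> : (fun n => (2 * n.+1%:R^-1)^-1 * (Int M (fun w => g w * tshift n.+1%:R^-1 v w) -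
    Int M (fun w => g w * tshift (- n.+1%:R^-1) v w))) = (fun n => Int mu (b n)).
  apply/funext => n; have [J1 <-] := P1 n; have [J2 <-] := P2 n.
  by rewrite /b IntZ ?IntB//; exact: itgB.
have [Jgf <-] := Int_pair_snd (L2M Lg Lf).
have [Jg2 _] := Int_pair_snd Lg.2.
have [Jf2 _] := Int_pair_snd Lf.2.
have good : {ae mu, forall x, forall n, b n x =
    Int mu (fun t => g (t, x) * average n.+1%:R^-1 (fun t => f (t, x)) t) /\
    [/\ itg mu (fun t => f (t, x)), L2 mu (fun t => g (t, x)) & L2 mu (fun t => f (t, x))]}.
  have Hs : {ae mu, forall x, L2 mu (fun t => v (t, x)) /\ forall n,
      itg mu (fun t => g (t, x) * v (t + n.+1%:R^-1, x)) /\
      itg mu (fun t => g (t, x) * v (t - n.+1%:R^-1, x))}.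
    apply: aeS2 (L2_section2 Lv) _; last first.
      apply: (ae_foralln (P := fun n x => itg mu (fun t => g (t, x) * v (t + n.+1%:R^-1, x)) /\
        itg mu (fun t => g (t, x) * v (t - n.+1%:R^-1, x)))).
      move=> n; apply: aeS2 (itg_pair_snd (L2M Lg (L2_tshift n.+1%:R^-1 Lv)))
        (itg_pair_snd (L2M Lg (L2_tshift (- n.+1%:R^-1) Lv))).
      by move=> x ? ?; split.
    by move=> x ? ?; split.
  have H2 : {ae mu, forall x, L2 mu (fun t => g (t, x)) /\ L2 mu (fun t => f (t, x))}.
    by apply: aeS2 (L2_section2 Lg) (L2_section2 Lf).
  have H3 := aeS2 (fun x (p : _ x) (q : _ x) => conj p q) Hs H2.
  apply: aeS2 Hv H3 => x [[mv If] _ _ vf] [[_ Hn] [Lgx Lfx]] n.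
  split=> //; have r0 : 0 < n.+1%:R^-1 :> R by rewrite invr_gt0.
  have [J1 J2] := Hn n.
  rewrite /b -IntB// -IntZ; last exact: itgB.
  apply: (Int_ae _ _ _).2.
  - exact/itgZ/itgB.
  - by apply: measurable_funM; [case: Lgx|exact: average_measurable].
  - apply: aeS2 (ae_shift n.+1%:R^-1 vf) (ae_shift (- n.+1%:R^-1) vf) => t -> ->.
    by rewrite /average ballcut_prim//; ring.
apply: (@Int_cvg _ _ _ mu b _ (fun x => Int mu (fun t => g (t, x) ^+ 2) + Int mu (fun t => f (t, x) ^+ 2))).
- by move=> n; exact: itg_measurable (Ib n).
- exact: itg_measurable Jgf.
- apply: aeS good => x hx; have [_ [If Lgx Lfx]] := hx 0%N.
  have -> : b ^~ x = (fun n => Int mu (fun t => g (t, x) * average n.+1%:R^-1 (fun t => f (t, x)) t)).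
    by apply/funext => n; have [-> _] := hx n.
  exact: Int_average_cvg.
- exact: itgD.
- move=> n; apply: aeS good => x /(_ n)[-> [If Lgx Lfx]].
  have r0 : 0 < n.+1%:R^-1 :> R by rewrite invr_gt0.
  have [La lea] := average_L2 r0 If Lfx.
  apply: (@le_trans _ _ (Int mu (fun t => g (t, x) ^+ 2) +
    Int mu (fun t => average n.+1%:R^-1 (fun t => f (t, x)) t ^+ 2))); last by rewrite lerD2l.
  rewrite -IntD; [|by case: Lgx|by case: La].
  apply: Int_abs_le; first exact: L2M.
    by apply: itgD; [case: Lgx|case: La].
  move=> t; rewrite ler_norml; set G := g _; set A := average _ _ _.
  by have := sqr_ge0 (G + A); have := sqr_ge0 (G - A); have := sqr_ge0 G; have := sqr_ge0 A; nra.
Qed.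

(* The bilinear form <v(t'), g(t)> = <h(t'), z(t)> makes the symmetric difference
   quotients in time of the two terms cancel exactly. *)
Lemma time_symmetry T v f g z k h (G : R -> Prop) :
  L2 M v -> L2 M f -> L2 M g -> L2 M z -> L2 M k -> L2 M h ->
  {ae mu, forall x, vanishing_primitive 0 T (fun t => v (t, x)) (fun t => f (t, x))} ->
  {ae mu, forall x, vanishing_primitive 0 T (fun t => z (t, x)) (fun t => k (t, x))} ->
  {ae mu, forall t, G t} ->
  (forall t t', G t -> G t' -> Int mu (fun x => v (t', x) * g (t, x)) =
                              Int mu (fun x => h (t', x) * z (t, x))) ->
  itg M (fun w => g w * f w + h w * k w) /\ Int M (fun w => g w * f w + h w * k w) = 0.
Proof.
move=> Lv Lf Lg Lz Lk Lh Hv Hz aeG sym.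
have I1 := L2M Lg Lf; have I2 := L2M Lh Lk.
split; first exact: itgD.
(* The symmetry at the times t and t + s, combined with a translation of t by s: a forward shift of
   v against g is a backward shift of z against h. *)
have sw s : Int M (fun w => g w * tshift s v w) = Int M (fun w => h w * tshift (- s) z w).
  have J1 := L2M Lg (L2_tshift s Lv).
  have J2 := L2M Lh (L2_tshift (- s) Lz).
  have [K1 <-] := Int_pair_fst J1.
  have [J3 <-] := itg_shift_pair s J2.
  have [K3 <-] := Int_pair_fst J3.
  apply: (Int_ae _ _ _).2 => //; first exact: itg_measurable K3.
  apply: aeS2 aeG (ae_shift s aeG) => t Gt Gts.
  have E := sym t (t + s) Gt Gts.
  transitivity (Int mu (fun x => v (t + s, x) * g (t, x))).
    by apply: Int_ext => x; rewrite /tshift /= mulrC.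
  by rewrite E; apply: Int_ext => x; rewrite /tshift /= addrK.
have c1 := tshift_average Lv Lf Lg Hv.
have c2 := tshift_average Lz Lk Lh Hz.
have := cvgD c1 c2; rewrite -IntD// => c.
have : (fun n => (2 * n.+1%:R^-1)^-1 * (Int M (fun w => g w * tshift n.+1%:R^-1 v w) -
    Int M (fun w => g w * tshift (- n.+1%:R^-1) v w)) +
    (2 * n.+1%:R^-1)^-1 * (Int M (fun w => h w * tshift n.+1%:R^-1 z w) -
    Int M (fun w => h w * tshift (- n.+1%:R^-1) z w))) = cst (0 : R).
  apply/funext => n; rewrite /= !sw opprK; ring.
move=> E; move: c; rewrite [X in X @ _ --> _](_ : _ = cst (0 : R)); last exact: E.
move=> c; have E0 := cvg_lim (@Rhausdorff R) (c _).
by rewrite -E0 lim_cst.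
Qed.

End TimeSymmetry.

(** * The conjugated operator in space *)

Section Conjugation.
Context {R : realType}.
Notation mu := (@lebesgue_measure R).
Variable L : R.
Implicit Types (sig x : R).

(* psi is concave and psi' does not vanish on [-L, L], so that the commutator below
   is positive; psi''' = 0 shortens the computation. *)
Definition psi x : R := 10 * L ^+ 2 - (x - 2 * L) ^+ 2.
Definition dpsi x : R := 4 * L - 2 * x.
Definition weight sig x : R := expR (- (sig * psi x)).

(* [wi] is the derivative of order i of weight * u, as a function of the derivatives
   u0, u1, ... of u. *)
Definition w0 sig x (u0 : R) : R := weight sig x * u0.
Definition w1 sig x (u0 u1 : R) : R := weight sig x * (u1 - sig * dpsi x * u0).
Definition w2 sig x (u0 u1 u2 : R) : R := weight sig x *
  (u2 - 2 * (sig * dpsi x) * u1 + ((sig * dpsi x) ^+ 2 + 2 * sig) * u0).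
Definition w3 sig x (u0 u1 u2 u3 : R) : R := weight sig x *
  (u3 - 3 * (sig * dpsi x) * u2 + (3 * (sig * dpsi x) ^+ 2 + 6 * sig) * u1 -
   ((sig * dpsi x) ^+ 3 + 6 * (sig * dpsi x) * sig) * u0).

Lemma dpsi_derivative : has_derivative dpsi (fun=> - 2).
Proof.
apply: has_derivative_ext (has_derivativeB (has_derivative_cst (4 * L))
  (has_derivativeZ 2 (@has_derivative_id R))) _ _ => // x.
by rewrite mulr1 sub0r.
Qed.

Lemma psi_derivative : has_derivative psi dpsi.
Proof.
have D1 : has_derivative (fun x => x - 2 * L) (fun=> 1 - 0).
  exact: has_derivativeB (@has_derivative_id R) (has_derivative_cst (2 * L)).
apply: has_derivative_ext (has_derivativeB (has_derivative_cst (10 * L ^+ 2))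
  (has_derivativeM D1 D1)) _ _ => x; first by rewrite /psi expr2.
rewrite /dpsi; ring.
Qed.

Lemma psi_smooth : smooth psi.
Proof.
apply/nderivable_smooth => n; rewrite (_ : psi = fun x => 10 * L ^+ 2 - (x - 2 * L) * (x - 2 * L)).
  apply: nderivableB; first exact: nderivable_cst.
  by apply: nderivableM; apply: nderivableB; [exact: nderivable_id|exact: nderivable_cst|
    exact: nderivable_id|exact: nderivable_cst].
by apply/funext => x; rewrite /psi expr2.
Qed.

Lemma psi_bounds x : 0 < L -> - L <= x <= L -> L ^+ 2 <= psi x <= 9 * L ^+ 2.
Proof.
move=> L0 /andP[h1 h2].
rewrite /psi; apply/andP; split; rewrite -subr_ge0.
  rewrite (_ : _ - _ = (L + x) * (5 * L - x)); last by ring.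
  by apply: mulr_ge0; lra.
rewrite (_ : _ - _ = (L - x) * (3 * L - x)); last by ring.
by apply: mulr_ge0; lra.
Qed.

Lemma dpsi_bounds x : - L <= x <= L -> 2 * L <= dpsi x <= 6 * L.
Proof. by move=> /andP[h1 h2]; rewrite /dpsi; apply/andP; split; lra. Qed.

Lemma weight_derivative sig :
  has_derivative (weight sig) (fun x => - (sig * dpsi x) * weight sig x).
Proof.
have De : has_derivative (@expR R) (@expR R) by move=> x; exact: is_derive_expR.
apply: has_derivative_ext (has_derivative_comp De
  (has_derivativeN (has_derivativeZ sig psi_derivative))) _ _ => // x.
by rewrite mulrC.
Qed.

Lemma has_derivativeX n (f f' : R -> R) : has_derivative f f' ->
  has_derivative (fun x => f x ^+ n.+1) (fun x => n.+1%:R * (f' x * f x ^+ n)).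
Proof.
move=> D; elim: n => [|n IH].
  by apply: has_derivative_ext D _ _ => x; rewrite ?expr1// expr0 mulr1 mul1r.
apply: has_derivative_ext (has_derivativeM D IH) _ _ => x; first by rewrite -exprS.
by rewrite -[in RHS]natr1 !exprS; ring.
Qed.

Definition slope sig x := sig * dpsi x.

Lemma slope_derivative sig : has_derivative (slope sig) (fun=> - (2 * sig)).
Proof.
apply: has_derivative_ext (has_derivativeZ sig dpsi_derivative) _ _ => // x; ring.
Qed.

Variables (sig : R) (u0 u1 u2 u3 : R -> R).
Hypothesis L0 : 0 < L.
Hypothesis V01 : vanishing_primitive (- L) L u0 u1.
Hypothesis V12 : vanishing_primitive (- L) L u1 u2.
Hypothesis V23 : vanishing_primitive (- L) L u2 u3.

Let LL : - L < L. Proof. by rewrite -subr_gt0 opprK addr_gt0. Qed.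

Lemma vanishing_ext a b (u f v g : R -> R) : u =1 v -> f =1 g ->
  vanishing_primitive a b u f -> vanishing_primitive a b v g.
Proof. by move=> /funext -> /funext ->. Qed.

Let mulW (c c' u f : R -> R) : has_derivative c c' -> continuous c' ->
  vanishing_primitive (- L) L u f ->
  vanishing_primitive (- L) L (fun x => c x * u x) (fun x => c' x * u x + c x * f x).
Proof. exact: vanishing_mul. Qed.

Let De := weight_derivative sig.
Let DA := slope_derivative sig.
Let ce := has_derivative_continuous De.
Let cA := has_derivative_continuous DA.

Let cont_cst (k : R) : continuous ((fun=> k) : R -> R).
Proof. exact: has_derivative_continuous (has_derivative_cst k). Qed.

Let contM (f g : R -> R) : continuous f -> continuous g -> continuous ((fun x => f x * g x) : R -> R).
Proof. by move=> cf cg x; apply: cvgM; [exact: cf|exact: cg]. Qed.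

Let contD (f g : R -> R) : continuous f -> continuous g -> continuous ((fun x => f x + g x) : R -> R).
Proof. by move=> cf cg x; apply: cvgD; [exact: cf|exact: cg]. Qed.

Let cAe : continuous ((fun x => - (sig * dpsi x) * weight sig x) : R -> R).
Proof.
apply: contM => //; apply: has_derivative_continuous (has_derivativeN DA).
Qed.

Let W0 x := w0 sig x (u0 x).
Let W1 x := w1 sig x (u0 x) (u1 x).
Let W2 x := w2 sig x (u0 x) (u1 x) (u2 x).
Let W3 x := w3 sig x (u0 x) (u1 x) (u2 x) (u3 x).

(** By the product rule, here and in the next two lemmas, a conjugated derivative is a sum of
    products of a smooth coefficient with a vanishing primitive. *)
Lemma conjugated01 : vanishing_primitive (- L) L W0 W1.
Proof.
apply: vanishing_ext (mulW De cAe V01) => x //.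
by rewrite /W1 /w1; ring.
Qed.

Let DAe := has_derivativeM DA De.
Let cDAe : continuous ((fun x => - (2 * sig) * weight sig x +
  slope sig x * (- (sig * dpsi x) * weight sig x)) : R -> R).
Proof. by apply: contD; [exact: contM|exact: contM]. Qed.

Lemma conjugated12 : vanishing_primitive (- L) L W1 W2.
Proof.
have DN := has_derivativeZ (-1) DAe.
have cN := contM (@cont_cst (-1)) cDAe.
apply: vanishing_ext (vanishing_add (mulW De cAe V12) (mulW DN cN V01)) => x.
  by rewrite /W1 /w1 /slope; ring.
by rewrite /W2 /w2 /slope; ring.
Qed.

Lemma conjugated23 : vanishing_primitive (- L) L W2 W3.
Proof.
have DN := has_derivativeZ (-2) DAe.
have cN := contM (@cont_cst (-2)) cDAe.
have DB := has_derivativeD (has_derivativeM DA DA) (has_derivative_cst (2 * sig)).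
have cB : continuous ((fun x => - (2 * sig) * slope sig x + slope sig x * (- (2 * sig)) + 0) : R -> R).
  by apply: contD => //; apply: contD; apply: contM.
have cB' := has_derivative_continuous DB.
have DBe := has_derivativeM DB De.
have cBe : continuous ((fun x => (- (2 * sig) * slope sig x + slope sig x * (- (2 * sig)) + 0) *
    weight sig x + (slope sig x * slope sig x + 2 * sig) * (- (sig * dpsi x) * weight sig x)) : R -> R).
  by apply: contD; apply: contM.
apply: vanishing_ext (vanishing_add (mulW De cAe V23)
  (vanishing_add (mulW DN cN V12) (mulW DBe cBe V01))) => x.
  by rewrite /W2 /w2 /slope; ring.
by rewrite /W3 /w3 /slope; ring.
Qed.

(** Integrations by parts are recorded in this form so that they can be combined linearly, the final
    identity between integrands being left to [ring]. *)
Definition nul (f : R -> R) := itg mu f /\ Int mu f = 0.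

Lemma nulD f g : nul f -> nul g -> nul (fun x => f x + g x).
Proof. by move=> [If f0] [Ig g0]; split; [exact: itgD|rewrite IntD// f0 g0 addr0]. Qed.

Lemma nulZ k f : nul f -> nul (fun x => k * f x).
Proof. by move=> [If f0]; split; [exact: itgZ|rewrite IntZ// f0 mulr0]. Qed.

Lemma nul_ext f g : f =1 g -> nul f -> nul g.
Proof. by move=> /funext ->. Qed.

Let ibp (c c' u f v g : R -> R) : has_derivative c c' -> continuous c' ->
  vanishing_primitive (- L) L u f -> vanishing_primitive (- L) L v g ->
  nul (fun x => c' x * (u x * v x) + c x * (f x * v x + u x * g x)).
Proof.
move=> D cc' Vu Vv; apply: nul_ext (vanishing_ibp (mulW D cc' Vu) Vv) => x; ring.
Qed.

Let cAn n : continuous ((fun x => n.+1%:R * (- (2 * sig) * slope sig x ^+ n)) : R -> R).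
Proof.
apply: contM => //; apply: contM => //; case: n => [|n]; last first.
  exact: has_derivative_continuous (has_derivativeX n DA).
by under eq_fun do rewrite expr0; exact: cont_cst.
Qed.

(** [dpsi x * W2 x - 2 * W1 x] is the derivative of psi' w_x, since psi'' = -2; its product with w
    is integrated by parts once. *)
Lemma dpsi_ibp : nul (fun x => dpsi x * (W1 x) ^+ 2 + (dpsi x * W2 x - 2 * W1 x) * W0 x).
Proof.
have := ibp dpsi_derivative (@cont_cst (-2)) conjugated12 conjugated01.
by apply: nul_ext => x; ring.
Qed.

(* 2 <K w, S w> for the skew-symmetric part K and the symmetric part S of the
   conjugated third derivative equals the integral of the commutator [S, K]; A'' = 0. *)
Lemma commutator_identity :
  nul (fun x => let A := slope sig x in
    2 * (W3 x + 3 * A ^+ 2 * W1 x - 6 * A * sig * W0 x) *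
      (3 * A * W2 x - 6 * sig * W1 x + A ^+ 3 * W0 x) -
    (18 * sig * (W2 x ^+ 2 + 2 * A ^+ 2 * W1 x ^+ 2 + A ^+ 4 * W0 x ^+ 2) -
     24 * sig ^+ 3 * W0 x ^+ 2)).
Proof.
have D n := has_derivativeX n DA.
(* [E1] to [E7] express that the derivatives of A W2^2, -2 sig W1 W2, A^3 W0 W2, A^3 W1^2, A^2 W0
   W1, A W0^2 and A^5 W0^2 have zero integral; [D n] differentiates A^(n+1). *)
have E1 := ibp (D 0%N) (@cAn 0) conjugated23 conjugated23.
have E2 := ibp (has_derivative_cst (-2 * sig)) (@cont_cst 0) conjugated12 conjugated23.
have E3 := ibp (D 2%N) (@cAn 2) conjugated01 conjugated23.
have E4 := ibp (D 2%N) (@cAn 2) conjugated12 conjugated12.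
have E5 := ibp (D 1%N) (@cAn 1) conjugated01 conjugated12.
have E6 := ibp (D 0%N) (@cAn 0) conjugated01 conjugated01.
have E7 := ibp (D 4%N) (@cAn 4) conjugated01 conjugated01.
apply: nul_ext (nulD (nulZ 3 E1) (nulD (nulZ 6 E2) (nulD (nulZ 2 E3) (nulD (nulZ 8 E4)
  (nulD (nulZ (-24 * sig) E5) (nulD (nulZ (-12 * sig ^+ 2) E6) (nulZ 3 E7))))))) => x /=.
ring.
Qed.

End Conjugation.

(** * Weights in time and square integrability *)

Section TimeWeight.
Context {R : realType}.
Variables (T c : R).
Hypothesis c0 : 0 < c.
Implicit Type t : R.

Definition xi t : R := (t * (T - t))^-1.

(** For T > 0, [xi] is not positive outside ]0, T[, so the exponential is cut off there explicitly.
    For fixed x and c = s psi(x) these are the functions xi^k times the conjugating factor, and xi'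
    = -(T - 2 t) xi^2 expresses their derivatives through functions of the same kind. *)
Definition tweight k t : R := if 0 < t < T then xi t ^+ k * expR (- (c * xi t)) else 0.

Definition tweight' k t : R :=
  - (T - 2 * t) * (k%:R * tweight k.+1 t - c * tweight k.+2 t).

Lemma xi_gt0 t : 0 < t < T -> 0 < xi t.
Proof. by move=> /andP[t0 t1]; rewrite invr_gt0 mulr_gt0// subr_gt0. Qed.

Lemma exp_decay_scale (k : nat) (y : R) : 0 <= y ->
  y ^+ k * expR (- (c * y)) <= k`!%:R / c ^+ k.
Proof.
move=> y0; rewrite ler_pdivlMr ?exprn_gt0// mulrAC -exprMn mulrC [y * c]mulrC mulrC.
by apply: exp_decay; rewrite mulr_ge0// ltW.
Qed.

(** Two more powers of xi are paid for by (t (T - t))^2, which is quadratically small at both end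
    times, as [is_derive_sqr_bound] requires. *)
Lemma tweight_sqr_bound k t :
  `|tweight k t| <= k.+2`!%:R / c ^+ k.+2 * (t * (T - t)) ^+ 2.
Proof.
have C0 : 0 <= k.+2`!%:R / c ^+ k.+2 by rewrite divr_ge0// exprn_ge0// ltW.
rewrite /tweight; case: ifPn => [tT|_]; last by rewrite normr0 mulr_ge0// sqr_ge0.
have x0 := xi_gt0 tT.
rewrite ger0_norm ?mulr_ge0 ?exprn_ge0 ?expR_ge0 ?(ltW x0)//.
apply: (@le_trans _ _ (xi t ^+ k.+2 * expR (- (c * xi t)) * (t * (T - t)) ^+ 2)).
  rewrite -addn2 exprD -mulrA -mulrA ler_wpM2l ?exprn_ge0 ?(ltW x0)//.
  rewrite [expR _ * _]mulrC mulrA -exprMn mulVf ?expr1n ?mul1r//.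
  by have := x0; rewrite invr_gt0 => /gt_eqF ->.
by rewrite ler_wpM2r ?sqr_ge0// exp_decay_scale// ltW.
Qed.

Lemma tweight_out k t : ~~ (0 < t < T) -> tweight k t = 0.
Proof. by rewrite /tweight => /negbTE ->. Qed.

Lemma tweight_derivative k : has_derivative (tweight k) (tweight' k).
Proof.
have far t : ~~ (0 <= t <= T) -> \forall y \near t, tweight k y = 0.
  rewrite negb_and -!ltNge => /orP[h|h].
    apply: filterS (lt_nbhsl h) => y y0; apply: tweight_out.
    by rewrite ltNge (ltW y0).
  apply: filterS (lt_nbhsr h) => y y0; apply: tweight_out.
  by rewrite [y < T]ltNge (ltW y0) andbF.
move=> t; case: (boolP (0 < t < T)) => tT.
  have d0 : t * (T - t) != 0 by have := xi_gt0 tT; rewrite invr_gt0 => /gt_eqF ->.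
  have h1 : is_derive t 1 (fun y => y * (T - y)) (T - 2 * t).
    have D := has_derivativeM (@has_derivative_id R)
      (has_derivativeB (has_derivative_cst T) (@has_derivative_id R)).
    apply: (@is_derive_eq _ _ _ _ _ _ _ _ (D t)); ring.
  have h2 : is_derive t 1 xi (- (T - 2 * t) * xi t ^+ 2).
    have h := @is_deriveV R (fun y => y * (T - y)) t _ _ d0 h1.
    apply: (@is_derive_eq _ _ _ _ _ _ _ _ h).
    by rewrite /GRing.scale /= /xi exprVn; ring.
  have h3 : is_derive t 1 (fun y => - (c * xi y)) (c * (T - 2 * t) * xi t ^+ 2).
    apply: (@is_derive_eq _ _ _ _ _ _ _ _ (is_deriveN (is_deriveM (is_derive_cst c t 1) h2))).
    by rewrite /GRing.scale /=; ring.
  have h4 := @is_derive1_comp _ expR (fun y => - (c * xi y)) t _ _ (is_derive_expR _) h3.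
  have h5 := @is_deriveX _ _ _ k _ _ _ h2.
  apply: (@near_eq_is_derive _ _ _ ((xi ^+ k) * (expR \o (fun y => - (c * xi y))))).
    have [t0 t1] := andP tT.
    apply: filterS2 (lt_nbhsr t0) (lt_nbhsl t1) => y y0 y1.
    by rewrite /tweight y0 y1 /= !fctE.
  apply: (@is_derive_eq _ _ _ _ _ _ _ _ (is_deriveM h5 h4)).
  rewrite /tweight' /tweight tT /GRing.scale /= !fctE.
  case: k {h5 far} => [|k]; first by rewrite !expr0; ring.
  by rewrite -[k.+1.-1]/k !exprS; ring.
have -> : tweight' k t = 0 by rewrite /tweight' !tweight_out// !mulr0 subr0 mulr0.
have C0 : 0 <= k.+2`!%:R / c ^+ k.+2 by rewrite divr_ge0// exprn_ge0// ltW.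
set C := k.+2`!%:R / _ in C0.
have [t0|t0] := eqVneq t 0.
  rewrite t0; apply: (@is_derive_sqr_bound _ _ _ (C * T ^+ 2)).
    by rewrite tweight_out// ltxx.
  move=> y; rewrite subr0; case: (boolP (0 < y < T)) => yT; last first.
    by rewrite tweight_out// normr0 (mulr_ge0 (mulr_ge0 C0 (sqr_ge0 T)) (sqr_ge0 _)).
  apply: (le_trans (tweight_sqr_bound k y)); rewrite -/C -[leRHS]mulrA (ler_wpM2l C0)//.
  have [y0 y1] := andP yT; rewrite exprMn mulrC ler_wpM2r ?sqr_ge0//.
  by rewrite ler_sqr ?nnegrE; lra.
have [tT'|tT'] := eqVneq t T.
  rewrite tT'; apply: (@is_derive_sqr_bound _ _ _ (C * T ^+ 2)).
    by rewrite tweight_out// ltxx andbF.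
  move=> y; case: (boolP (0 < y < T)) => yT; last first.
    by rewrite tweight_out// normr0 (mulr_ge0 (mulr_ge0 C0 (sqr_ge0 T)) (sqr_ge0 _)).
  apply: (le_trans (tweight_sqr_bound k y)); rewrite -/C -[leRHS]mulrA (ler_wpM2l C0)//.
  have [y0 y1] := andP yT; rewrite exprMn -[(y - T) ^+ 2]sqrrN opprB ler_wpM2r ?sqr_ge0//.
  by rewrite ler_sqr ?nnegrE; lra.
apply: (near_eq_is_derive _ (is_derive_cst (0 : R) t 1)).
have := far t; rewrite !le_eqVlt eq_sym (negbTE t0) (negbTE tT') /= => /(_ tT).
by apply: filterS => y ->.
Qed.

Lemma tweight'_continuous k : continuous (tweight' k).
Proof.
have cw j := has_derivative_continuous (tweight_derivative j).
move=> t; apply: cvgM.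
  apply: cvgN; apply: cvgB; first exact: cvg_cst.
  by apply: cvgM; [exact: cvg_cst|exact: cvg_id].
by apply: cvgB; apply: cvgM; [exact: cvg_cst|exact: cw|exact: cvg_cst|exact: cw].
Qed.

End TimeWeight.

(** The approximating continuous functions converge at 0 too, where the inverse is 0 by
    convention. *)
Lemma measurable_inv (R : realType) : measurable_fun setT (fun x : R => x^-1).
Proof.
apply: (@measurable_fun_cvg _ R R setT (fun n (x : R) => x / (x ^+ 2 + n.+1%:R^-1)) _) => [n|x _].
  apply: continuous_measurable_fun => x; apply: cvgM; first exact: cvg_id.
  apply: cvgV.
    by rewrite gt_eqF// ltr_wpDl ?sqr_ge0// invr_gt0.
  by apply: cvgD; [exact: exprn_continuous|exact: cvg_cst].
have [->|x0] := eqVneq x 0.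
  rewrite invr0 (_ : (fun n => _) = fun=> 0); first exact: cvg_cst.
  by apply/funext => n; rewrite mul0r.
rewrite -[X in _ --> X](_ : x / (x ^+ 2 + 0) = _); last first.
  by rewrite addr0 expr2 invfM mulrA divff// mul1r.
apply: cvgM; first exact: cvg_cst.
apply: cvgV; first by rewrite addr0 expf_neq0.
apply: cvgD; first exact: cvg_cst.
exact: cvg_harmonic.
Qed.

(** * Coefficients of polynomial growth in xi against the weight *)

Section Tempered.
Context {R : realType}.
Notation mu := (@lebesgue_measure R).
Notation R2 := (measurableTypeR R * measurableTypeR R)%type.
Notation M := (mu \x mu)%E.
Variables (T L s : R).
Hypotheses (T0 : 0 < T) (L0 : 0 < L) (s0 : 0 < s).
Implicit Types (b F : R2 -> R) (t x : R).

(** The factor that turns q into w; its square is the weight of the estimate, which has 2 s in the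
    exponent. *)
Definition carleman z : R := weight L (s * xi T z.1) z.2.

(** The coefficients produced by the conjugation blow up at t = 0 and t = T, but only polynomially
    in xi. *)
Definition tempered b := measurable_fun setT b /\ exists C (j : nat), 0 <= C /\
  forall t x, 0 < t < T -> - L < x < L -> `|b (t, x)| <= C * (1 + xi T t) ^+ j.

Lemma tempered_cst k : tempered (fun=> k).
Proof.
split=> //; exists `|k|, 0%N; split=> // t x _ _.
by rewrite expr0 mulr1.
Qed.

Lemma temperedM b1 b2 : tempered b1 -> tempered b2 -> tempered (fun z => b1 z * b2 z).
Proof.
move=> [m1 [C1 [j1 [C10 h1]]]] [m2 [C2 [j2 [C20 h2]]]]; split; first exact: measurable_funM.
exists (C1 * C2), (j1 + j2)%N; split=> [|t x tT xL]; first exact: mulr_ge0.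
by rewrite normrM exprD mulrACA ler_pM// ?h1 ?h2.
Qed.

Lemma temperedD b1 b2 : tempered b1 -> tempered b2 -> tempered (fun z => b1 z + b2 z).
Proof.
move=> [m1 [C1 [j1 [C10 h1]]]] [m2 [C2 [j2 [C20 h2]]]]; split; first exact: measurable_funD.
exists (C1 + C2), (j1 + j2)%N; split=> [|t x tT xL]; first exact: addr_ge0.
have x1 : 1 <= 1 + xi T t by rewrite lerDl ltW// xi_gt0.
rewrite (le_trans (ler_normD _ _))// mulrDl lerD//.
  by rewrite (le_trans (h1 t x tT xL))// ler_wpM2l// ler_weXn2l// leq_addr.
by rewrite (le_trans (h2 t x tT xL))// ler_wpM2l// ler_weXn2l// leq_addl.
Qed.

Lemma tempered_xi : tempered (fun z => xi T z.1).
Proof.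
split.
  apply: (measurableT_comp (@measurable_inv R)).
  apply: measurable_funM; first exact: measurable_fst.
  by apply: measurable_funB => //; exact: measurable_fst.
exists 1, 1%N; split=> // t x tT xL.
by rewrite mul1r expr1 gtr0_norm ?xi_gt0//= lerDr.
Qed.

Lemma tempered_fst : tempered (fun z => z.1).
Proof.
split; first exact: measurable_fst.
exists T, 0%N; split=> [|t x /andP[t0 tT] xL]; first exact: ltW.
by rewrite expr0 mulr1 /= gtr0_norm// ltW.
Qed.

Lemma tempered_snd : tempered (fun z => z.2).
Proof.
split; first exact: measurable_snd.
exists L, 0%N; split=> [|t x tT /andP[x0 xL]]; first exact: ltW.
by rewrite expr0 mulr1 /= ler_norml !ltW.
Qed.

Lemma tempered_ext b1 b2 : b1 =1 b2 -> tempered b1 -> tempered b2.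
Proof. by move=> /funext ->. Qed.

Lemma temperedX b n : tempered b -> tempered (fun z => b z ^+ n).
Proof.
move=> tb; elim: n => [|n IH].
  by apply: tempered_ext (tempered_cst 1) => z; rewrite expr0.
by apply: tempered_ext (temperedM tb IH) => z; rewrite exprS.
Qed.

Lemma temperedN b : tempered b -> tempered (fun z => - b z).
Proof. by move=> tb; apply: tempered_ext (temperedM (tempered_cst (-1)) tb) => z; rewrite mulN1r. Qed.

Lemma carleman_measurable : measurable_fun setT carleman.
Proof.
rewrite /carleman /weight /psi; apply: measurableT_comp => //.
apply: measurableT_comp => //; apply: measurable_funM.
  by apply: measurable_funM => //; case: tempered_xi.
by apply: measurable_funB => //; apply: measurable_funX; apply: measurable_funB.
Qed.

Lemma tempered_carleman b : tempered b -> exists C, 0 <= C /\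
  forall t x, 0 < t < T -> - L < x < L -> `|b (t, x) * carleman (t, x)| <= C.
Proof.
move=> [mb [C [j [C0 hC]]]]; pose c := s * L ^+ 2.
have c0 : 0 < c by rewrite mulr_gt0// exprn_gt0.
(* The factor [expR c] comes from writing the decay in 1 + xi instead of xi. *)
exists (C * (expR c * (j`!%:R / c ^+ j))); split.
  by rewrite !mulr_ge0 ?expR_ge0 ?invr_ge0 ?exprn_ge0// ltW.
move=> t x tT xL; have x0 := xi_gt0 tT.
have x1 : 0 <= 1 + xi T t by rewrite addr_ge0// ltW.
rewrite normrM [`|carleman _|]ger0_norm ?expR_ge0//.
apply: (@le_trans _ _ (C * (1 + xi T t) ^+ j * (expR c * expR (- (c * (1 + xi T t)))))).
  apply: ler_pM => //; [exact: expR_ge0|exact: hC|].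
  rewrite /carleman /weight -expRD ler_expR.
  rewrite (_ : c - c * (1 + xi T t) = - (c * xi T t)); last by ring.
  rewrite lerN2 /c /=.
  rewrite mulrAC ler_wpM2l ?mulr_ge0 ?(ltW s0) ?(ltW x0)//.
  have [xL1 xL2] := andP xL.
  have xab : - L <= x <= L by rewrite (ltW xL1) (ltW xL2).
  by have /andP[] := psi_bounds L0 xab.
rewrite -mulrA ler_wpM2l// mulrCA ler_wpM2l ?expR_ge0//.
exact: exp_decay_scale.
Qed.

Definition supported F := forall t x, ~~ ((0 < t < T) && (- L < x < L)) -> F (t, x) = 0.

(** Stable under multiplication by tempered coefficients, so that no power of xi has to be
    tracked. *)
Definition tempered_L2 F := forall b, tempered b -> L2 M (fun z => b z * F z).

Lemma carleman_tempered_L2 F : L2 M F -> supported F ->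
  tempered_L2 (fun z => carleman z * F z).
Proof.
move=> LF sF b tb; have [C [C0 hC]] := tempered_carleman tb.
apply: (@L2_le _ _ _ _ C _ _ _ LF).
  apply: measurable_funM; first by case: tb.
  by apply: measurable_funM; [exact: carleman_measurable|case: LF].
move=> [t x]; rewrite mulrA normrM.
case: (boolP ((0 < t < T) && (- L < x < L))) => [/andP[tT xL]|h].
  by rewrite ler_wpM2r// hC.
by rewrite sF// normr0 !mulr0.
Qed.

Lemma tempered_L2D F1 F2 : tempered_L2 F1 -> tempered_L2 F2 ->
  tempered_L2 (fun z => F1 z + F2 z).
Proof.
move=> h1 h2 b tb; apply: L2_ext (L2D (h1 b tb) (h2 b tb)) => z.
by rewrite mulrDr.
Qed.

Lemma tempered_L2M b F : tempered b -> tempered_L2 F -> tempered_L2 (fun z => b z * F z).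
Proof.
move=> tb hF b' tb'; apply: L2_ext (hF _ (temperedM tb' tb)) => z.
by rewrite mulrA.
Qed.

Lemma tempered_L2_ext F1 F2 : F1 =1 F2 -> tempered_L2 F1 -> tempered_L2 F2.
Proof. by move=> /funext ->. Qed.

Lemma tempered_L2_L2 F : tempered_L2 F -> L2 M F.
Proof. by move=> /(_ _ (tempered_cst 1)); apply: L2_ext => z; rewrite mul1r. Qed.

End Tempered.

(** * The pointwise inequality *)

Section Pointwise.
Context {R : realType}.

Lemma sqr_sum4 (a b c d : R) :
  (a + b + c + d) ^+ 2 <= 4 * (a ^+ 2 + b ^+ 2 + c ^+ 2 + d ^+ 2).
Proof.
have := sqr_ge0 (a - b); have := sqr_ge0 (a - c); have := sqr_ge0 (a - d).
have := sqr_ge0 (b - c); have := sqr_ge0 (b - d); have := sqr_ge0 (c - d); nra.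
Qed.

Lemma sqr_sum3 (a b c : R) : (a + b + c) ^+ 2 <= 3 * (a ^+ 2 + b ^+ 2 + c ^+ 2).
Proof.
have := sqr_ge0 (a - b); have := sqr_ge0 (a - c); have := sqr_ge0 (b - c); nra.
Qed.

Lemma sqr_sum2 (a b : R) : (a + b) ^+ 2 <= 2 * (a ^+ 2 + b ^+ 2).
Proof. have := sqr_ge0 (a - b); nra. Qed.

(* X stands for xi and D for its derivative, A is the slope s psi' xi, k the sum
   of w_t and of the skew-symmetric part, S the symmetric part. *)
Lemma carleman_pointwise (L T s X D p ps k W0 W1 W2 : R) :
  0 < L -> 0 < T -> 0 < s -> 0 < X -> `|D| <= T * X ^+ 2 ->
  2 * L <= p <= 6 * L -> L ^+ 2 <= ps <= 9 * L ^+ 2 ->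
  32 <= s * X -> 2 <= s * X * L ^+ 2 -> 3 * T <= s * (s * X) * (2 * L) ->
  41 * T ^+ 2 <= s ^+ 2 * (s * X) ->
  forall sig A S F P : R, sig = s * X -> A = sig * p ->
  S = 3 * A * W2 - 6 * sig * W1 + A ^+ 3 * W0 ->
  F = k + S + (s * D * ps * W0 - W2 - 2 * A * W1 - (A ^+ 2 - 2 * sig) * W0) ->
  P = 18 * sig * (W2 ^+ 2 + 2 * A ^+ 2 * W1 ^+ 2 + A ^+ 4 * W0 ^+ 2) -
    24 * sig ^+ 3 * W0 ^+ 2 + 3 * s * D * p * W1 ^+ 2 -
    3 * s ^+ 3 * p ^+ 3 * X ^+ 2 * D * W0 ^+ 2 ->
  sig ^+ 5 * W0 ^+ 2 + sig ^+ 3 * (W1 + A * W0) ^+ 2 +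
    sig * (W2 + 2 * A * W1 + (A ^+ 2 - 2 * sig) * W0) ^+ 2 <=
  (12 + 2 * L ^- 2 + L ^- 4) * (2 * F ^+ 2 - (2 * k * S - P)).
Proof.
move=> L0 T0 s0 X0 hD /andP[p1 p2] /andP[ps1 ps2] a1 a2 a3 a4.
move=> sig A S F P sigE AE SE FE PE; rewrite -sigE in a1 a2 a3 a4.
have sig0 : 0 < sig by rewrite sigE mulr_gt0.
have p0 : 0 < p by apply: lt_le_trans p1; exact: mulr_gt0.
have A0 : 0 < A by rewrite AE mulr_gt0.
(* psi' >= 2 L turns powers of sig into powers of A, and 2 <= sig L^2 then makes sig small against
   A^2. *)
have AL : 4 * L ^+ 2 * sig ^+ 2 <= A ^+ 2.
  rewrite AE exprMn mulrC ler_wpM2l ?sqr_ge0//.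
  have h : (2 * L) ^+ 2 <= p ^+ 2.
    by rewrite ler_sqr ?nnegrE ?(ltW p0)// mulr_ge0// ltW.
  by rewrite (_ : 4 * L ^+ 2 = (2 * L) ^+ 2)//; ring.
have A8 : 8 * sig <= A ^+ 2.
  apply: le_trans AL; rewrite (_ : 4 * L ^+ 2 * sig ^+ 2 = 4 * (sig * L ^+ 2) * sig); last by ring.
  by rewrite ler_wpM2r ?(ltW sig0)//; move: a2; lra.
have A28 : 0 <= A ^+ 2 - 2 * sig by lra.
have A4 : A ^+ 4 = A ^+ 2 * A ^+ 2 by rewrite -exprD.
have A64 : 64 * sig ^+ 2 <= A ^+ 4.
  rewrite A4 (_ : 64 * sig ^+ 2 = (8 * sig) * (8 * sig)); last by ring.
  by apply: ler_pM => //; rewrite mulr_ge0// ltW.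
have A4L : 16 * L ^+ 4 * sig ^+ 4 <= A ^+ 4.
  rewrite A4 (_ : 16 * L ^+ 4 * sig ^+ 4 = (4 * L ^+ 2 * sig ^+ 2) * (4 * L ^+ 2 * sig ^+ 2)); last by ring.
  have h : 0 <= 4 * L ^+ 2 * sig ^+ 2 by rewrite (mulr_ge0 (mulr_ge0 _ (sqr_ge0 _)) (sqr_ge0 _)).
  exact: ler_pM.
have A4s : (A ^+ 2 - 2 * sig) ^+ 2 <= A ^+ 4.
  rewrite A4 -expr2 ler_sqr ?nnegrE ?sqr_ge0//; lra.
pose x := W1 ^+ 2; pose y := W0 ^+ 2; pose z := W2 ^+ 2.
have x0 : 0 <= x by exact: sqr_ge0.
have y0 : 0 <= y by exact: sqr_ge0.
have z0 : 0 <= z by exact: sqr_ge0.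
(* By [e1], [e2] and [e3] the other terms of [P] cost at most 2 of the 18 in front of sig A^4 W0^2
   and 1 of the 36 in front of sig A^2 W1^2. *)
have e1 : 24 * sig ^+ 3 * y <= sig * A ^+ 4 * y.
  apply: ler_wpM2r => //.
  rewrite (_ : 24 * sig ^+ 3 = sig * (24 * sig ^+ 2)); last by ring.
  rewrite ler_wpM2l ?(ltW sig0)//; apply: le_trans A64.
  by rewrite ler_wpM2r ?sqr_ge0// ler_nat.
have a3' : 3 * T <= s * sig * p.
  by apply: (le_trans a3); rewrite ler_wpM2l// mulr_ge0// ltW.
have DT : `|D| * (3 * p * s) <= sig * A ^+ 2.
  apply: (@le_trans _ _ (T * X ^+ 2 * (3 * p * s))).
    by rewrite ler_wpM2r// !mulr_ge0// ltW.
  rewrite (_ : T * X ^+ 2 * (3 * p * s) = (3 * T) * (X ^+ 2 * p * s)); last by ring.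
  rewrite (_ : sig * A ^+ 2 = (s * sig * p) * (X ^+ 2 * p * s)); last by rewrite AE sigE; ring.
  by rewrite ler_wpM2r// !mulr_ge0 ?sqr_ge0// ltW.
have e2 : - (sig * A ^+ 2 * x) <= 3 * s * D * p * x.
  rewrite -mulNr; apply: ler_wpM2r => //; rewrite lerNl.
  rewrite (_ : - (3 * s * D * p) = (- D) * (3 * p * s)); last by ring.
  apply: le_trans DT; rewrite ler_wpM2r ?mulr_ge0 ?(ltW p0) ?(ltW s0)//.
  by rewrite -normrN ler_norm.
have e3 : 3 * s ^+ 3 * p ^+ 3 * X ^+ 2 * D * y <= sig * A ^+ 4 * y.
  apply: ler_wpM2r => //.
  rewrite (_ : 3 * s ^+ 3 * p ^+ 3 * X ^+ 2 * D = (D * (3 * p * s)) * A ^+ 2); last by rewrite AE sigE; ring.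
  rewrite (_ : sig * A ^+ 4 = sig * A ^+ 2 * A ^+ 2); last by ring.
  rewrite ler_wpM2r ?sqr_ge0//; apply: le_trans DT.
  by rewrite ler_wpM2r ?ler_norm// !mulr_ge0// ltW.
have e4 : 8 * (s ^+ 2 * D ^+ 2 * ps ^+ 2) <= sig * A ^+ 4.
  have D2 : D ^+ 2 <= T ^+ 2 * X ^+ 4.
    rewrite -(real_normK (num_real D)) (_ : T ^+ 2 * X ^+ 4 = (T * X ^+ 2) ^+ 2); last by ring.
    by rewrite ler_sqr ?nnegrE// (le_trans _ hD).
  have ps2' : ps ^+ 2 <= 81 * L ^+ 4.
    rewrite (_ : 81 * L ^+ 4 = (9 * L ^+ 2) ^+ 2); last by ring.
    have psp : 0 <= ps by apply: le_trans ps1; exact: sqr_ge0.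
    by rewrite ler_sqr ?nnegrE// (le_trans psp).
  apply: (@le_trans _ _ (sig * (16 * L ^+ 4 * sig ^+ 4))); last first.
    by rewrite (ler_wpM2l (ltW sig0)).
  apply: (@le_trans _ _ (8 * (s ^+ 2 * (T ^+ 2 * X ^+ 4) * (81 * L ^+ 4)))).
    have g1 : s ^+ 2 * D ^+ 2 <= s ^+ 2 * (T ^+ 2 * X ^+ 4) by rewrite ler_wpM2l ?sqr_ge0.
    have g2 : 0 <= s ^+ 2 * D ^+ 2 by rewrite (mulr_ge0 (sqr_ge0 _) (sqr_ge0 _)).
    by rewrite ler_wpM2l// (ler_pM g2 (sqr_ge0 _) g1 ps2').
  rewrite (_ : 8 * (s ^+ 2 * (T ^+ 2 * X ^+ 4) * (81 * L ^+ 4)) =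
    (648 * T ^+ 2) * (s ^+ 2 * X ^+ 4 * L ^+ 4)); last by ring.
  rewrite (_ : sig * (16 * L ^+ 4 * sig ^+ 4) =
    (16 * (s ^+ 2 * sig)) * (s ^+ 2 * X ^+ 4 * L ^+ 4)); last by rewrite sigE; ring.
  rewrite ler_wpM2r//; last by move: a4 (sqr_ge0 T); lra.
  exact: (mulr_ge0 (mulr_ge0 (sqr_ge0 _) (exprn_ge0 _ (ltW X0))) (exprn_ge0 _ (ltW L0))).
have si0 := ltW sig0; have A20 := sqr_ge0 A.
have A40 : 0 <= A ^+ 4 by rewrite A4 mulr_ge0.
have sig8 (u : R) : 0 <= u -> 32 * u <= sig * u by move=> u0; apply: ler_wpM2r.
(* The remainder has four terms, so its doubled square costs a factor 8; the term 2 A W1 then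
   requires 32 <= sig. *)
have e5 : 2 * (s * D * ps * W0 - W2 - 2 * A * W1 - (A ^+ 2 - 2 * sig) * W0) ^+ 2 <=
    sig * (z + A ^+ 2 * x + 2 * (A ^+ 4 * y)).
  have := sqr_sum4 (s * D * ps * W0) (- W2) (- (2 * A * W1)) (- ((A ^+ 2 - 2 * sig) * W0)).
  rewrite !sqrrN !exprMn -/x -/y -/z => h.
  have h1 : 8 * (s ^+ 2 * D ^+ 2 * ps ^+ 2 * y) <= sig * A ^+ 4 * y.
    by rewrite mulrA ler_wpM2r.
  have h2 := sig8 z z0.
  have h3 := sig8 (A ^+ 2 * x) (mulr_ge0 (sqr_ge0 _) x0).
  have h4 : (A ^+ 2 - 2 * sig) ^+ 2 * y <= A ^+ 4 * y by rewrite ler_wpM2r.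
  have A4y : 0 <= A ^+ 4 * y := mulr_ge0 A40 y0.
  have h5 := sig8 _ A4y.
  lra.
pose E := sig * (z + A ^+ 2 * x + A ^+ 4 * y).
have sA4y : 0 <= sig * A ^+ 4 * y := mulr_ge0 (mulr_ge0 si0 A40) y0.
have sA2x : 0 <= sig * A ^+ 2 * x := mulr_ge0 (mulr_ge0 si0 A20) x0.
have sz : 0 <= sig * z := mulr_ge0 si0 z0.
have main : E <= 2 * F ^+ 2 - (2 * k * S - P).
  (* With Rm the remainder, 2 F^2 + 2 Rm^2 - 2 k S = k^2 + S^2 + (k + S + 2 Rm)^2. *)
  have kS : 2 * k * S <= 2 * F ^+ 2 + 2 * (s * D * ps * W0 - W2 - 2 * A * W1 - (A ^+ 2 - 2 * sig) * W0) ^+ 2.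
    set Rm := s * D * ps * W0 - W2 - 2 * A * W1 - (A ^+ 2 - 2 * sig) * W0.
    rewrite FE -/Rm.
    have h1 := sqr_ge0 k; have h2 := sqr_ge0 S; have h3 := sqr_ge0 (k + S + 2 * Rm).
    nra.
  move: kS e5 e1 e2 e3 sA4y sA2x sz; rewrite PE /E -/x -/y -/z; lra.
(* It remains to return from w to q: the terms in q, q_x and q_xx cost 1/L^4, 2/L^2 and 12
   respectively. *)
have kap : sig ^+ 2 <= L ^- 2 * A ^+ 2.
  rewrite -ler_pdivrMl ?invr_gt0 ?exprn_gt0// invrK.
  by apply: le_trans AL; rewrite -mulrA ler_peMl ?ler1n// mulr_ge0 ?sqr_ge0.
have kap2 : sig ^+ 4 <= L ^- 4 * A ^+ 4.
  rewrite (_ : sig ^+ 4 = sig ^+ 2 * sig ^+ 2); last by ring.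
  rewrite A4 (_ : L ^- 4 = L ^- 2 * L ^- 2); last by rewrite -invfM -exprD.
  by rewrite [leRHS]mulrACA; apply: (ler_pM (sqr_ge0 _) (sqr_ge0 _) kap kap).
have Li2 : 0 <= L ^- 2 by rewrite invr_ge0 exprn_ge0// ltW.
have Li4 : 0 <= L ^- 4 by rewrite invr_ge0 exprn_ge0// ltW.
have C0 : 0 <= 12 + 2 * L ^- 2 + L ^- 4 by lra.
apply: (@le_trans _ _ ((12 + 2 * L ^- 2 + L ^- 4) * E)); last by rewrite ler_wpM2l.
have f1 : sig ^+ 5 * y <= L ^- 4 * E.
  apply: (@le_trans _ _ (L ^- 4 * (sig * A ^+ 4 * y))).
    rewrite (_ : sig ^+ 5 * y = sig ^+ 4 * (sig * y)); last by ring.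
    rewrite (_ : L ^- 4 * (sig * A ^+ 4 * y) = L ^- 4 * A ^+ 4 * (sig * y)); last by ring.
    by rewrite ler_wpM2r// mulr_ge0.
  rewrite (ler_wpM2l Li4)//.
  by move: sA2x sz; rewrite /E; lra.
have f2 : sig ^+ 3 * (W1 + A * W0) ^+ 2 <= 2 * L ^- 2 * E.
  have := sqr_sum2 W1 (A * W0); rewrite exprMn -/x -/y => h.
  apply: (@le_trans _ _ (sig ^+ 3 * (2 * (x + A ^+ 2 * y)))).
    by rewrite ler_wpM2l// exprn_ge0// ltW.
  rewrite (_ : sig ^+ 3 * (2 * (x + A ^+ 2 * y)) = sig ^+ 2 * (2 * sig * (x + A ^+ 2 * y))); last by ring.
  apply: (@le_trans _ _ (L ^- 2 * A ^+ 2 * (2 * sig * (x + A ^+ 2 * y)))).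
    rewrite ler_wpM2r//; apply: mulr_ge0; first by rewrite mulr_ge0.
    by rewrite addr_ge0// mulr_ge0.
  rewrite (_ : L ^- 2 * A ^+ 2 * (2 * sig * (x + A ^+ 2 * y)) =
    2 * L ^- 2 * (sig * A ^+ 2 * x + sig * A ^+ 4 * y)); last by ring.
  rewrite ler_wpM2l ?(mulr_ge0 _ Li2)//.
  by move: sz; rewrite /E; lra.
have f3 : sig * (W2 + 2 * A * W1 + (A ^+ 2 - 2 * sig) * W0) ^+ 2 <= 12 * E.
  have := sqr_sum3 W2 (2 * A * W1) ((A ^+ 2 - 2 * sig) * W0); rewrite !exprMn -/x -/y -/z => h.
  have h4 : (A ^+ 2 - 2 * sig) ^+ 2 * y <= A ^+ 4 * y by rewrite ler_wpM2r.
  apply: (@le_trans _ _ (sig * (12 * (z + A ^+ 2 * x + A ^+ 4 * y)))).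
    rewrite ler_wpM2l ?(ltW sig0)//; apply: (le_trans h).
    have A4y : 0 <= A ^+ 4 * y := mulr_ge0 A40 y0.
    lra.
  by rewrite /E mulrCA.
move: f1 f2 f3; rewrite -/y; lra.
Qed.

End Pointwise.

(** * The global estimate *)

(** The continuous representative of u is bounded, so each product in [vanishing_ibp] is integrable
    by itself. *)
Lemma vanishing_itg (R : realType) (a b : R) (u f v g : R -> R) :
  vanishing_primitive a b u f -> vanishing_primitive a b v g ->
  itg (@lebesgue_measure R) (fun x => u x * g x).
Proof.
move=> [[mu_ If] _ _ uf] [[_ Ig] _ _ _].
have I := itg_bddM (prim_measurable If) Ig (fun x => prim_le x If).
apply: (Int_ae I _ _).1; first by apply: measurable_funM => //; exact: itg_measurable Ig.
by apply: aeS uf => x ->.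
Qed.

Section Global.
Context {R : realType}.
Notation mu := (@lebesgue_measure R).
Notation R2 := (measurableTypeR R * measurableTypeR R)%type.
Notation measurableR := (@measurable_fun _ _ (measurableTypeR R) R setT).
Notation M := (mu \x mu)%E.
Variables (T L s : R) (q qx qxx qxxx qt : R -> R -> R).
Hypotheses (T0 : 0 < T) (L0 : 0 < L) (s0 : 0 < s).
Hypothesis Hspace : in_L2H3 T L q qx qxx qxxx.
Hypothesis Htime : in_H1L2 T L q qt.
Hypothesis Tq : zero_boundary_trace T L q.
Hypothesis Tqx : zero_boundary_trace T L qx.
Hypothesis Tqxx : zero_boundary_trace T L qxx.

Let Q0 := extend T L q.
Let Q1 := extend T L qx.
Let Q2 := extend T L qxx.
Let Q3 := extend T L qxxx.
Let Qt := extend T L qt.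
Let sg (z : R2) : R := s * xi T z.1.
Let cm := carleman T L s.
Let W0 z := w0 L (sg z) z.2 (Q0 z).
Let W1 z := w1 L (sg z) z.2 (Q0 z) (Q1 z).
Let W2 z := w2 L (sg z) z.2 (Q0 z) (Q1 z) (Q2 z).
Let W3 z := w3 L (sg z) z.2 (Q0 z) (Q1 z) (Q2 z) (Q3 z).
(** Inside ]0, T[, [xid] is the time derivative of xi, [Wt] that of [W0], and [Z k] that of xi^k
    [W0]. *)
Let xid (z : R2) : R := - (T - 2 * z.1) * xi T z.1 ^+ 2.
Let Wt z := cm z * (Qt z - s * psi L z.2 * xid z * Q0 z).
Let Z k (z : R2) := xi T z.1 ^+ k * Wt z - k%:R * (T - 2 * z.1) * xi T z.1 ^+ k.+1 * W0 z.

Let LL : - L < L. Proof. by rewrite -subr_gt0 opprK addr_gt0. Qed.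

Let LQ0 : L2 M Q0. Proof. by apply: L2_extend; case: Hspace => -[]. Qed.
Let LQ1 : L2 M Q1. Proof. by apply: L2_extend; case: Hspace => -[]. Qed.
Let LQ2 : L2 M Q2. Proof. by apply: L2_extend; case: Hspace => -[]. Qed.
Let LQ3 : L2 M Q3. Proof. by apply: L2_extend; case: Hspace => -[]. Qed.
Let LQt : L2 M Qt. Proof. by apply: L2_extend; case: Htime. Qed.

Let supp u : supported T L (extend T L u).
Proof.
by move=> t x; rewrite negb_and => /orP[h|h]; [exact: extend_out1|exact: extend_out2].
Qed.

Lemma vanishing_zero a b : @vanishing_primitive R a b (fun=> 0) (fun=> 0).
Proof.
have P x : prim (fun=> 0 : R) x = 0 :> R.
  by rewrite -[RHS](Int0 mu); apply: Int_ext => y; case: ifP.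
split=> //; first by split=> //; exact: itg0.
by apply: nearW => x; rewrite P.
Qed.

Let Vx t := [/\ vanishing_primitive (- L) L (fun x => Q0 (t, x)) (fun x => Q1 (t, x)),
  vanishing_primitive (- L) L (fun x => Q1 (t, x)) (fun x => Q2 (t, x)) &
  vanishing_primitive (- L) L (fun x => Q2 (t, x)) (fun x => Q3 (t, x))].

(** Each trace condition supplies one link of the chain from q to q_xxx; slices at times outside ]0,
    T[ vanish identically. *)
Let aeVx : {ae mu, forall t, Vx t}.
Proof.
have [_ H3] := Hspace.
have H := aeS2 (fun t a b => conj a b) H3 (aeS2 (fun t a b => conj a b) Tq
  (aeS2 (fun t a b => conj a b) Tqx Tqxx)).
apply: aeS H => t [h3 [t0 [t1 t2]]].
case: (boolP (0 < t < T)) => tT; last first.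
  have E u : (fun x => extend T L u (t, x)) = fun=> 0.
    by apply/funext => x; rewrite extend_out1.
  by split; rewrite /Q0 /Q1 /Q2 /Q3 !E; exact: vanishing_zero.
have tin : t \in `]0, T[ by rewrite in_itv.
have [[l0 l1 l2 l3] [d1 d2 d3]] := h3 tin.
have E u : (fun x => extend T L u (t, x)) = u t \_ `](- L), L[.
  by apply/funext => x; rewrite extendE tT.
have [a0 b0] := t0 tin; have [a1 b1] := t1 tin; have [a2 b2] := t2 tin.
split; rewrite /Q0 /Q1 /Q2 /Q3 !E; apply: space_vanishing => //.
  exact: weak_derive_succ d1 d2.
exact: weak_derive_succ d2 d3.
Qed.

Let VW t : Vx t ->
  [/\ vanishing_primitive (- L) L (fun x => W0 (t, x)) (fun x => W1 (t, x)),
  vanishing_primitive (- L) L (fun x => W1 (t, x)) (fun x => W2 (t, x)) &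
  vanishing_primitive (- L) L (fun x => W2 (t, x)) (fun x => W3 (t, x))].
Proof.
move=> [V01 V12 V23]; split.
- exact: (conjugated01 (s * xi T t) L0 V01).
- exact: (conjugated12 (s * xi T t) L0 V01 V12).
- exact: (conjugated23 (s * xi T t) L0 V01 V12 V23).
Qed.

(** For fixed x in ]-L, L[, xi^k w is q times [tweight] with c = s psi(x), and the latter vanishes
    at the end times. *)
Let Vt k : {ae mu, forall x, vanishing_primitive 0 T
  (fun t => xi T t ^+ k * W0 (t, x)) (fun t => Z k (t, x))}.
Proof.
apply: aeS2 (time_primitive T0 Htime) (L2_section2 LQt) => x [m hm] Lt.
case: (boolP (- L < x < L)) => xL; last first.
  have E0 : (fun t => xi T t ^+ k * W0 (t, x)) = fun=> 0.
    by apply/funext => t; rewrite /W0 /w0 /Q0 extend_out2// !mulr0.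
  have E1 : (fun t => Z k (t, x)) = fun=> 0.
    apply/funext => t; rewrite /Z /Wt /W0 /w0 /Q0 /Qt !extend_out2//; ring.
  by rewrite E0 E1; exact: vanishing_zero.
have c0 : 0 < s * psi L x.
  have [xL1 xL2] := andP xL; have xab : - L <= x <= L by rewrite (ltW xL1) (ltW xL2).
  have /andP[h _] := psi_bounds L0 xab.
  by rewrite mulr_gt0// (lt_le_trans _ h)// exprn_gt0.
have It : itg mu (fun t => Qt (t, x)) by apply: L2_itg_itv Lt _ => t; exact: extend_out1.
have mQ : measurableR (fun t => Q0 (t, x)) by apply: measurable_fun_pair1; case: LQ0.
have wout t : ~~ (0 < t < T) ->
    tweight T (s * psi L x) k t = 0 /\ tweight' T (s * psi L x) k t = 0.
  by move=> tT; rewrite /tweight' !tweight_out// !mulr0 subr0 mulr0.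
have := @time_vanishing R T _ _ _ _ m T0 (tweight_derivative T c0 k)
  (@tweight'_continuous R T _ c0 k) wout mQ It _ hm.
move=> /(_ (fun t h => conj (extend_out1 _ _ _ h) (extend_out1 _ _ _ h))).
have wE (t : R) : 0 < t < T -> forall j,
    tweight T (s * psi L x) j t = xi T t ^+ j * cm (t, x).
  move=> tT j; rewrite /tweight tT /cm /carleman /weight /=.
  by congr (_ * expR (- _)); ring.
apply: vanishing_ext => t; case: (boolP (0 < t < T)) => tT.
- by rewrite wE// /W0 /w0 /= -mulrA.
- by rewrite /W0 /w0 /Q0 extend_out1// !mulr0.
- rewrite /tweight' !wE// /Z /Wt /W0 /w0 -/(cm (t, x)) /xid /=.
  by rewrite -[weight L (sg (t, x)) x]/(cm (t, x)) !exprS; ring.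
- by rewrite /Z /Wt /W0 /w0 /Q0 /Qt !extend_out1//; ring.
Qed.

Let TL2 := @tempered_L2 R T L.
Let Txi := tempered_xi T L.
Let Tfst := tempered_fst L T0.
Let Tsnd := tempered_snd T L0.
Let Tcst := @tempered_cst R T L.

Let Tsg : tempered T L sg.
Proof. exact: temperedM (Tcst s) Txi. Qed.

Let Tdpsi : tempered T L (fun z => dpsi L z.2).
Proof. exact: temperedD (Tcst (4 * L)) (temperedN (temperedM (Tcst 2) Tsnd)). Qed.

Let Tpsi : tempered T L (fun z => psi L z.2).
Proof.
apply: temperedD (Tcst (10 * L ^+ 2)) (temperedN (temperedX 2 _)).
exact: temperedD Tsnd (Tcst (- (2 * L))).
Qed.

Let Txid : tempered T L xid.
Proof.
apply: temperedM; last exact: temperedX Txi.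
exact: temperedN (temperedD (Tcst T) (temperedN (temperedM (Tcst 2) Tfst))).
Qed.

Let A (z : R2) : R := sg z * dpsi L z.2.
Let TA : tempered T L A. Proof. exact: temperedM Tsg Tdpsi. Qed.

Let T0L : TL2 (fun z => cm z * Q0 z).
Proof. exact: (carleman_tempered_L2 L0 s0 LQ0 (@supp q)). Qed.
Let T1L : TL2 (fun z => cm z * Q1 z).
Proof. exact: (carleman_tempered_L2 L0 s0 LQ1 (@supp qx)). Qed.
Let T2L : TL2 (fun z => cm z * Q2 z).
Proof. exact: (carleman_tempered_L2 L0 s0 LQ2 (@supp qxx)). Qed.
Let T3L : TL2 (fun z => cm z * Q3 z).
Proof. exact: (carleman_tempered_L2 L0 s0 LQ3 (@supp qxxx)). Qed.
Let TtL : TL2 (fun z => cm z * Qt z).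
Proof. exact: (carleman_tempered_L2 L0 s0 LQt (@supp qt)). Qed.

Let cmE z : weight L (sg z) z.2 = cm z. Proof. by []. Qed.

Let TW0 : TL2 W0. Proof. exact: T0L. Qed.

Let TW1 : TL2 W1.
Proof.
apply: tempered_L2_ext (tempered_L2D T1L (tempered_L2M (temperedN TA) T0L)) => z.
by rewrite /W1 /w1 cmE /A; ring.
Qed.

Let TW2 : TL2 W2.
Proof.
apply: tempered_L2_ext (tempered_L2D T2L (tempered_L2D
  (tempered_L2M (temperedM (Tcst (-2)) TA) T1L)
  (tempered_L2M (temperedD (temperedX 2 TA) (temperedM (Tcst 2) Tsg)) T0L))) => z.
by rewrite /W2 /w2 cmE /A; ring.
Qed.

Let TW3 : TL2 W3.
Proof.
apply: tempered_L2_ext (tempered_L2D T3L (tempered_L2D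
  (tempered_L2M (temperedM (Tcst (-3)) TA) T2L) (tempered_L2D
  (tempered_L2M (temperedD (temperedM (Tcst 3) (temperedX 2 TA)) (temperedM (Tcst 6) Tsg)) T1L)
  (tempered_L2M (temperedN (temperedD (temperedX 3 TA) (temperedM (temperedM (Tcst 6) TA) Tsg))) T0L)))) => z.
by rewrite /W3 /w3 cmE /A; ring.
Qed.

Let TWt : TL2 Wt.
Proof.
apply: tempered_L2_ext (tempered_L2D TtL
  (tempered_L2M (temperedN (temperedM (temperedM (Tcst s) Tpsi) Txid)) T0L)) => z.
by rewrite /Wt; ring.
Qed.

Let TZ k : TL2 (Z k).
Proof.
apply: tempered_L2_ext (tempered_L2D (tempered_L2M (temperedX k Txi) TWt)
  (tempered_L2M (temperedN (temperedM (temperedM (Tcst k%:R)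
    (temperedD (Tcst T) (temperedN (temperedM (Tcst 2) Tfst)))) (temperedX k.+1 Txi))) TW0)) => z.
by rewrite /Z; ring.
Qed.

Let mulL2 F G : TL2 F -> TL2 G -> itg M (fun z => F z * G z).
Proof. by move=> hF hG; exact: L2M (tempered_L2_L2 hF) (tempered_L2_L2 hG). Qed.

Definition nul2 (F : R2 -> R) := itg M F /\ Int M F = 0.

Lemma nul2D F G : nul2 F -> nul2 G -> nul2 (fun z => F z + G z).
Proof. by move=> [I1 E1] [I2 E2]; split; [exact: itgD|rewrite IntD// E1 E2 addr0]. Qed.

Lemma nul2Z k F : nul2 F -> nul2 (fun z => k * F z).
Proof. by move=> [I1 E1]; split; [exact: itgZ|rewrite IntZ// E1 mulr0]. Qed.

(** Transfers the identities in space from almost every time slice to the rectangle, once joint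
    integrability is known. *)
Lemma nul2_sections F : itg M F -> {ae mu, forall t, Int mu (fun x => F (t, x)) = 0} ->
  nul2 F.
Proof.
move=> IF F0; split=> //; have [I1 <-] := Int_pair_fst IF.
rewrite -[RHS](Int0 mu); apply: (Int_ae _ _ _).2 => //.
Qed.

(** The derivative of psi' w_x; 3 s xi times it is the part 3 d A d of the symmetric operator. *)
Let flux (z : R2) := dpsi L z.2 * W2 z - 2 * W1 z.

Let Tflux : TL2 flux.
Proof.
apply: tempered_L2_ext (tempered_L2D (tempered_L2M Tdpsi TW2) (tempered_L2M (Tcst (-2)) TW1)) => z.
by rewrite /flux; ring.
Qed.

Let flux_ibp : nul2 (fun z => xid z * (dpsi L z.2 * W1 z ^+ 2 + flux z * W0 z)).
Proof.
apply: nul2_sections.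
  apply: itg_ext (itgD (mulL2 (tempered_L2M (temperedM Txid Tdpsi) TW1) TW1)
    (mulL2 (tempered_L2M Txid Tflux) TW0)) => z.
  by rewrite expr2; ring.
apply: aeS aeVx => t [V01 V12 V23].
have [I1 E1] := @dpsi_ibp R L (s * xi T t) _ _ _ L0 V01 V12.
(* [xid] depends on t alone; the second coordinate 0 is a dummy. *)
rewrite [LHS](_ : _ = Int mu (fun x => xid (t, 0) * (dpsi L x * W1 (t, x) ^+ 2 +
  flux (t, x) * W0 (t, x)))); last exact: Int_ext.
by rewrite IntZ//; rewrite E1 mulr0.
Qed.

Let Kz (z : R2) := W3 z + 3 * A z ^+ 2 * W1 z - 6 * A z * sg z * W0 z.
Let Sz (z : R2) := 3 * A z * W2 z - 6 * sg z * W1 z + A z ^+ 3 * W0 z.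
Let main_part (z : R2) := 18 * sg z * (W2 z ^+ 2 + 2 * A z ^+ 2 * W1 z ^+ 2 + A z ^+ 4 * W0 z ^+ 2) -
  24 * sg z ^+ 3 * W0 z ^+ 2.

Let TK : TL2 Kz.
Proof.
apply: tempered_L2_ext (tempered_L2D TW3 (tempered_L2D
  (tempered_L2M (temperedM (Tcst 3) (temperedX 2 TA)) TW1)
  (tempered_L2M (temperedN (temperedM (temperedM (Tcst 6) TA) Tsg)) TW0))) => z.
by rewrite /Kz; ring.
Qed.

Let TS : TL2 Sz.
Proof.
apply: tempered_L2_ext (tempered_L2D
  (tempered_L2M (temperedM (Tcst 3) TA) TW2) (tempered_L2D
  (tempered_L2M (temperedM (Tcst (-6)) Tsg) TW1)
  (tempered_L2M (temperedX 3 TA) TW0))) => z.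
by rewrite /Sz; ring.
Qed.

Let space_identity : nul2 (fun z => 2 * Kz z * Sz z - main_part z).
Proof.
apply: nul2_sections.
  have I1 := mulL2 (tempered_L2M (Tcst 2) TK) TS.
  have I2 := mulL2 (tempered_L2M (temperedM (Tcst (-18)) Tsg) TW2) TW2.
  have I3 := mulL2 (tempered_L2M (temperedM (temperedM (Tcst (-36)) Tsg) (temperedX 2 TA)) TW1) TW1.
  have I4 := mulL2 (tempered_L2M (temperedM (temperedM (Tcst (-18)) Tsg) (temperedX 4 TA)) TW0) TW0.
  have I5 := mulL2 (tempered_L2M (temperedM (Tcst 24) (temperedX 3 Tsg)) TW0) TW0.
  apply: itg_ext (itgD I1 (itgD I2 (itgD I3 (itgD I4 I5)))) => z.
  by rewrite /main_part; ring.
apply: aeS aeVx => t [V01 V12 V23].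
have [_ E] := @commutator_identity R L (s * xi T t) _ _ _ _ L0 V01 V12 V23.
exact: E.
Qed.

(** Integration by parts in time in which [flux] is never differentiated. Both pairings in the
    symmetry condition equal -xi(t) times the integral of psi' w_x(t) w_x(t'). *)
Let time_flux : nul2 (fun z => xi T z.1 * flux z * Z 0 z + flux z * Z 1 z).
Proof.
have v0 : {ae mu, forall x, vanishing_primitive 0 T (fun t => W0 (t, x)) (fun t => Z 0 (t, x))}.
  by apply: aeS (Vt 0) => x; apply: vanishing_ext => // t; rewrite expr0 mul1r.
have Tg : TL2 (fun z => xi T z.1 * flux z) by exact: tempered_L2M.
have Tz : TL2 (fun z => xi T z.1 ^+ 1 * W0 z) by exact: tempered_L2M (temperedX 1 Txi) TW0.
apply: (@time_symmetry R T _ _ _ _ _ _ Vx (tempered_L2_L2 TW0) (tempered_L2_L2 (TZ 0))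
  (tempered_L2_L2 Tg) (tempered_L2_L2 Tz) (tempered_L2_L2 (TZ 1)) (tempered_L2_L2 Tflux)
  v0 (Vt 1) aeVx).
move=> t t' /VW[V01 V12 _] /VW[V01' V12' _].
have Dd := @dpsi_derivative R L.
have cd : continuous ((fun=> -2) : R -> R) by exact: has_derivative_continuous (has_derivative_cst (-2)).
have Vf := vanishing_mul LL Dd cd V12.
have Vf' := vanishing_mul LL Dd cd V12'.
have [I1 E1] := vanishing_ibp V01' Vf.
have [I2 E2] := vanishing_ibp Vf' V01.
have J1 := vanishing_itg V01' Vf.
have J2 := vanishing_itg V01 Vf'.
have J3 : itg mu (fun x => W1 (t', x) * (dpsi L x * W1 (t, x))).
  by apply: itg_ext (itgB I1 J1) => x; ring.
have J3' : Int mu (fun x => W1 (t', x) * (dpsi L x * W1 (t, x))) +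
    Int mu (fun x => W0 (t', x) * (-2 * W1 (t, x) + dpsi L x * W2 (t, x))) = 0.
  by rewrite -IntD.
have J4' : Int mu (fun x => W1 (t', x) * (dpsi L x * W1 (t, x))) +
    Int mu (fun x => W0 (t, x) * (-2 * W1 (t', x) + dpsi L x * W2 (t', x))) = 0.
  by rewrite -IntD// -E2; apply: Int_ext => x; ring.
transitivity (xi T t * Int mu (fun x => W0 (t', x) * (-2 * W1 (t, x) + dpsi L x * W2 (t, x)))).
  by rewrite -IntZ//; apply: Int_ext => x; rewrite /flux /=; ring.
transitivity (xi T t * Int mu (fun x => W0 (t, x) * (-2 * W1 (t', x) + dpsi L x * W2 (t', x)))).
  by congr (_ * _); lra.
by rewrite -IntZ//; apply: Int_ext => x; rewrite /flux /=; ring.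
Qed.

(** The counterpart for the part A^3 of the symmetric operator; a multiplication operator makes the
    symmetry immediate. *)
Let time_mass : nul2 (fun z => dpsi L z.2 ^+ 3 * xi T z.1 ^+ 3 * W0 z * Z 0 z +
  dpsi L z.2 ^+ 3 * W0 z * Z 3 z).
Proof.
have v0 : {ae mu, forall x, vanishing_primitive 0 T (fun t => W0 (t, x)) (fun t => Z 0 (t, x))}.
  by apply: aeS (Vt 0) => x; apply: vanishing_ext => // t; rewrite expr0 mul1r.
have Tg : TL2 (fun z => dpsi L z.2 ^+ 3 * xi T z.1 ^+ 3 * W0 z).
  exact: tempered_L2M (temperedM (temperedX 3 Tdpsi) (temperedX 3 Txi)) TW0.
have Tz : TL2 (fun z => xi T z.1 ^+ 3 * W0 z) by exact: tempered_L2M (temperedX 3 Txi) TW0.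
have Th : TL2 (fun z => dpsi L z.2 ^+ 3 * W0 z) by exact: tempered_L2M (temperedX 3 Tdpsi) TW0.
apply: (@time_symmetry R T _ _ _ _ _ _ (fun=> True) (tempered_L2_L2 TW0) (tempered_L2_L2 (TZ 0))
  (tempered_L2_L2 Tg) (tempered_L2_L2 Tz) (tempered_L2_L2 (TZ 3)) (tempered_L2_L2 Th)
  v0 (Vt 3)); first exact: nearW.
by move=> t t' _ _; apply: Int_ext => x /=; ring.
Qed.

(** The factors 3 s and s^3 are those of 3 A and A^3 in the symmetric part; the term with -3 s
    removes the product of xi', [flux] and w left by [time_flux] and puts xi' psi' w_x^2 in its
    place. *)
Let Nz (z : R2) := (2 * Kz z * Sz z - main_part z) +
  (3 * s * (xi T z.1 * flux z * Z 0 z + flux z * Z 1 z) +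
  ((-3 * s) * (xid z * (dpsi L z.2 * W1 z ^+ 2 + flux z * W0 z)) +
   s ^+ 3 * (dpsi L z.2 ^+ 3 * xi T z.1 ^+ 3 * W0 z * Z 0 z + dpsi L z.2 ^+ 3 * W0 z * Z 3 z))).

Let Nz_nul : nul2 Nz.
Proof.
exact: nul2D space_identity (nul2D (nul2Z (3 * s) time_flux)
  (nul2D (nul2Z (-3 * s) flux_ibp) (nul2Z (s ^+ 3) time_mass))).
Qed.

Definition carleman_lhs (z : R2) : R := (sg z ^+ 5 * Q0 z ^+ 2 + sg z ^+ 3 * Q1 z ^+ 2 +
  sg z * Q2 z ^+ 2) * cm z ^+ 2.
Definition carleman_rhs (z : R2) : R := (Qt z - Q2 z + Q3 z) ^+ 2 * cm z ^+ 2.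

Hypothesis s_large : 8 * T ^+ 2 + T ^+ 2 / L ^+ 2 + 2 * T / L + 2 * T <= s.

Let C1 : R := 12 + 2 * L ^- 2 + L ^- 4.

(** Undoes the conjugation: the two squared sums are those of the conjugating factor times q_x and
    q_xx. *)
Let lhs_eq z : carleman_lhs z = sg z ^+ 5 * W0 z ^+ 2 +
  sg z ^+ 3 * (W1 z + A z * W0 z) ^+ 2 +
  sg z * (W2 z + 2 * A z * W1 z + (A z ^+ 2 - 2 * sg z) * W0 z) ^+ 2.
Proof.
by rewrite /carleman_lhs /W2 /W1 /W0 /w2 /w1 /w0 !cmE /A; ring.
Qed.

(** Besides w_t and the two parts of the third derivative there is a remainder: s xi' psi w from
    differentiating the weight in time, and minus the conjugated second derivative. *)
Let rhs_eq z : cm z * (Qt z - Q2 z + Q3 z) = Wt z + Kz z + Sz z +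
  (s * xid z * psi L z.2 * W0 z - W2 z - 2 * A z * W1 z - (A z ^+ 2 - 2 * sg z) * W0 z).
Proof.
by rewrite /Kz /Sz /Wt /W3 /W2 /W1 /W0 /w3 /w2 /w1 /w0 !cmE /A; ring.
Qed.

Let Nz_eq z : Nz z = 2 * (Wt z + Kz z) * Sz z - (18 * sg z * (W2 z ^+ 2 +
  2 * A z ^+ 2 * W1 z ^+ 2 + A z ^+ 4 * W0 z ^+ 2) -
  24 * sg z ^+ 3 * W0 z ^+ 2 + 3 * s * xid z * dpsi L z.2 * W1 z ^+ 2 -
  3 * s ^+ 3 * dpsi L z.2 ^+ 3 * xi T z.1 ^+ 2 * xid z * W0 z ^+ 2).
Proof.
rewrite /Nz /main_part /flux /Z; move: (Kz z) => K; rewrite /Sz /A /sg /xid.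
by move: (W0 z) (W1 z) (W2 z) (Wt z) => v0 v1 v2 vt; ring.
Qed.

Let lhs_le z : carleman_lhs z <= C1 * (2 * carleman_rhs z - Nz z).
Proof.
case: z => t x; case: (boolP ((0 < t < T) && (- L < x < L))) => [/andP[tT xL]|h]; last first.
  have q0 u : extend T L u (t, x) = 0 by exact: supp.
  rewrite /carleman_lhs /carleman_rhs /Nz /Kz /Sz /main_part /flux /Z /Wt /W3 /W2 /W1 /W0
    /w3 /w2 /w1 /w0 /Q0 /Q1 /Q2 /Q3 /Qt !q0.
  by rewrite le_eqVlt; apply/orP; left; apply/eqP; ring.
have X0 := xi_gt0 tT.
have [t0 t1] := andP tT; have [x1 x2] := andP xL.
have xab : - L <= x <= L by rewrite (ltW x1) (ltW x2).
(* t (T - t) <= T^2 / 4, that is, (T - 2 t)^2 >= 0. *)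
have XT : 4 <= xi T t * T ^+ 2.
  rewrite /xi mulrC ler_pdivlMr; last by rewrite mulr_gt0// subr_gt0.
  have := sqr_ge0 (T - 2 * t); lra.
have hD : `|xid (t, x)| <= T * xi T t ^+ 2.
  rewrite /xid /= normrM [`|_ ^+ 2|]ger0_norm ?sqr_ge0// ler_wpM2r ?sqr_ge0//.
  by rewrite ler_norml; apply/andP; split; lra.
have T20 : 0 <= T ^+ 2 by exact: sqr_ge0.
have p1 : 0 <= T ^+ 2 / L ^+ 2 by rewrite divr_ge0// sqr_ge0.
have p2 : 0 <= 2 * T / L by rewrite divr_ge0 ?mulr_ge0// ltW.
(* Each summand of the threshold serves one absorption: 8 T^2 gives 32 <= s xi, T^2 / L^2 gives 2 <=
   s xi L^2, and 2 T / L and 2 T give the two bounds that absorb xi'. *)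
have s8 : 8 * T ^+ 2 <= s by move: s_large T0; lra.
have sT : 2 * T <= s by move: s_large T0; lra.
have sL2 : T ^+ 2 <= s * L ^+ 2.
  by rewrite -ler_pdivrMr ?exprn_gt0//; move: s_large T0; lra.
have sL : 2 * T <= s * L by rewrite -ler_pdivrMr//; move: s_large T0; lra.
have a1 : 32 <= s * xi T t.
  apply: (@le_trans _ _ (8 * T ^+ 2 * xi T t)); last by rewrite ler_wpM2r// ltW.
  by rewrite -mulrA [_ ^+ 2 * _]mulrC; lra.
have a2 : 2 <= s * xi T t * L ^+ 2.
  apply: (@le_trans _ _ (T ^+ 2 * xi T t)); first by rewrite mulrC; lra.
  by rewrite [leRHS]mulrAC ler_wpM2r// ltW.
have a3 : 3 * T <= s * (s * xi T t) * (2 * L).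
  apply: (@le_trans _ _ ((2 * T) * 32 * 2)); first by move: T0; lra.
  rewrite (_ : s * (s * xi T t) * (2 * L) = (s * L) * (s * xi T t) * 2); last by ring.
  have p3 : 0 <= 2 * T by rewrite mulr_ge0// ltW.
  have p4 : (2 * T) * 32 <= (s * L) * (s * xi T t) by apply: ler_pM.
  by rewrite ler_wpM2r.
have a4 : 41 * T ^+ 2 <= s ^+ 2 * (s * xi T t).
  apply: (@le_trans _ _ ((2 * T) ^+ 2 * 32)); first by rewrite exprMn; lra.
  apply: ler_pM => //; first exact: sqr_ge0.
  by rewrite ler_sqr ?nnegrE ?(ltW s0)// mulr_ge0// ltW.
have := carleman_pointwise (k := Wt (t, x) + Kz (t, x)) (W0 := W0 (t, x)) (W1 := W1 (t, x))
  (W2 := W2 (t, x)) L0 T0 s0 X0 hD (dpsi_bounds xab) (psi_bounds L0 xab) a1 a2 a3 a4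
  erefl erefl erefl erefl erefl.
rewrite lhs_eq Nz_eq /carleman_rhs -exprMn [_ * cm _]mulrC rhs_eq.
exact.
Qed.

(** In the integral of [lhs_le] the term [Nz] disappears; Tonelli passes between the iterated
    integrals and those over the plane. *)
Lemma carleman_global :
  (\int[mu]_(t in `]0%R, T[) \int[mu]_(x in `](- L)%R, L[) (carleman_lhs (t, x))%:E <=
   (2 * (12 + 2 * L ^- 2 + L ^- 4))%:E *
   \int[mu]_(t in `]0%R, T[) \int[mu]_(x in `](- L)%R, L[) (carleman_rhs (t, x))%:E)%E.
Proof.
have TF : TL2 (fun z => cm z * (Qt z - Q2 z + Q3 z)).
  apply: tempered_L2_ext (tempered_L2D TtL (tempered_L2D (tempered_L2M (Tcst (-1)) T2L) T3L)) => z.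
  by rewrite mulN1r; ring.
have IR : itg M carleman_rhs.
  apply: itg_ext (mulL2 TF TF) => z; rewrite /carleman_rhs; ring.
have IL : itg M carleman_lhs.
  have J0 := mulL2 (tempered_L2M (temperedX 5 Tsg) T0L) T0L.
  have J1 := mulL2 (tempered_L2M (temperedX 3 Tsg) T1L) T1L.
  have J2 := mulL2 (tempered_L2M Tsg T2L) T2L.
  apply: itg_ext (itgD J0 (itgD J1 J2)) => z; rewrite /carleman_lhs; ring.
have [IN EN] := Nz_nul.
have I2 : itg M (fun z => 2 * carleman_rhs z - Nz z) by apply: itgB => //; exact: itgZ.
have q0 u (t x : R) : ~~ ((0 < t < T) && (- L < x < L)) -> extend T L u (t, x) = 0.
  exact: supp.
have dom (t x : R) : ~ (`]0, T[ `*` `](- L), L[)%classic (t, x) ->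
    ~~ ((0 < t < T) && (- L < x < L)).
  move=> h; apply/negP => /andP[tT xL]; apply: h.
  by split; rewrite /= in_itv.
rewrite (integral_domain (f := fun z => (carleman_lhs z)%:E)); first last.
- move=> [t x] /dom h; rewrite /carleman_lhs /Q0 /Q1 /Q2 !q0//.
  by rewrite !expr0n /= !mulr0 !addr0 mul0r.
- move=> [t x]; rewrite lee_fin /carleman_lhs.
  case: (boolP ((0 < t < T) && (- L < x < L))) => [/andP[tT _]|h]; last first.
    by rewrite /Q0 /Q1 /Q2 !q0// !expr0n /= !mulr0 !addr0 mul0r.
  have sg0 : 0 <= sg (t, x) by rewrite mulr_ge0 ?ltW// xi_gt0.
  by rewrite mulr_ge0 ?sqr_ge0// !addr_ge0// mulr_ge0 ?sqr_ge0 ?exprn_ge0.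
- by apply/measurable_EFinP; exact: itg_measurable IL.
rewrite (integral_domain (f := fun z => (carleman_rhs z)%:E)); first last.
- move=> [t x] /dom h; rewrite /carleman_rhs /Qt /Q2 /Q3 !q0//.
  by rewrite subr0 addr0 expr0n /= mul0r.
- by move=> z; rewrite lee_fin mulr_ge0 ?sqr_ge0.
- by apply/measurable_EFinP; exact: itg_measurable IR.
rewrite -(EFin_Int IL) -(EFin_Int IR) -EFinM lee_fin.
apply: (le_trans (Int_le IL (itgZ C1 I2) lhs_le)).
rewrite IntZ// IntB//; last exact: itgZ.
by rewrite IntZ// EN subr0 mulrA [C1 * 2]mulrC.
Qed.

End Global.

(** * From the global estimate to the stated integrals *)

Theorem lemma3p5 (R : realType) (L : R) (L_gt0 : 0 < L) :
  exists psi : R -> R,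
    [/\ smooth psi,
        (forall x : R, x \in `[- L, L] -> 0 < psi x)
      & forall T : R, 0 < T ->
        exists s0 C : R, [/\ 0 < s0, 0 < C
          & forall (s : R) (q qx qxx qxxx qt : R -> R -> R),
            s0 <= s ->
            in_L2H3 T L q qx qxx qxxx ->
            in_H1L2 T L q qt ->
            zero_boundary_trace T L q ->
            zero_boundary_trace T L qx ->
            zero_boundary_trace T L qxx ->
            (\int[lebesgue_measure]_(t in `]0%R, T[)
               \int[lebesgue_measure]_(x in `](- L)%R, L[)
                 ((s ^+ 5 / (t ^+ 5 * (T - t) ^+ 5) * `|q t x| ^+ 2
                   + s ^+ 3 / (t ^+ 3 * (T - t) ^+ 3) * `|qx t x| ^+ 2
                   + s / (t * (T - t)) * `|qxx t x| ^+ 2)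
                  * carleman_weight T s psi t x)%R%:E
             <= C%:E *
                \int[lebesgue_measure]_(t in `]0%R, T[)
                  \int[lebesgue_measure]_(x in `](- L)%R, L[)
                    (`|qt t x - qxx t x + qxxx t x| ^+ 2
                     * carleman_weight T s psi t x)%R%:E)%E]].
Proof.
have C0 : 0 < 12 + 2 * L ^- 2 + L ^- 4.
  have L2 : 0 <= L ^- 2 by rewrite invr_ge0 exprn_ge0// ltW.
  have L4 : 0 <= L ^- 4 by rewrite invr_ge0 exprn_ge0// ltW.
  lra.
exists (psi L); split; first exact: psi_smooth.
  move=> x; rewrite in_itv /= => xab; have /andP[h _] := psi_bounds L_gt0 xab.
  by apply: lt_le_trans h; rewrite exprn_gt0.
move=> T T0.
(* The first witness is the sum of the thresholds of the pointwise absorptions; the outer factor 2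
   of the second comes from the doubled square of the conjugated operator there. *)
exists (8 * T ^+ 2 + T ^+ 2 / L ^+ 2 + 2 * T / L + 2 * T), (2 * (12 + 2 * L ^- 2 + L ^- 4)).
have p0 : 0 <= T ^+ 2 by exact: sqr_ge0.
have p1 : 0 <= T ^+ 2 / L ^+ 2 by rewrite divr_ge0// sqr_ge0.
have p2 : 0 <= 2 * T / L by rewrite divr_ge0 ?mulr_ge0// ltW.
split; [by lra|by rewrite mulr_gt0|].
move=> s q qx qxx qxxx qt s_large Hspace Htime Tq Tqx Tqxx.
have s0 : 0 < s by move: s_large T0; lra.
have weightE t x : 0 < t < T -> carleman_weight T s (psi L) t x = carleman T L s (t, x) ^+ 2.
  move=> tT; rewrite /carleman_weight /carleman /weight /xi /= expr2 -expRD.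
  by congr expR; ring.
have := carleman_global T0 L_gt0 s0 Hspace Htime Tq Tqx Tqxx s_large.
congr (_ <= _ * _)%E.
  apply: eq_integral => t; rewrite inE /= in_itv /= => tT.
  apply: eq_integral => x; rewrite inE /= in_itv /= => xL.
  rewrite weightE// /carleman_lhs !extend_in// !real_normK ?num_real// /xi /=.
  by rewrite !exprMn !exprVn !exprMn.
apply: eq_integral => t; rewrite inE /= in_itv /= => tT.
apply: eq_integral => x; rewrite inE /= in_itv /= => xL.
by rewrite weightE// /carleman_rhs !extend_in// real_normK ?num_real.
Qed.
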